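(* Let $\alpha>\tfrac12$ and let $f$ be a slice regular function on the circular cone $C(\pi/\alpha)$, continuous on its closure $\overline{C(\pi/\alpha)}$. Suppose the order $\rho$ of $f$ satisfies $\rho<\alpha$. If there exists $M\ge0$ with $|f|\le M$ on $\partial C(\pi/\alpha)$, then $|f|\le M$ on $C(\pi/\alpha)$.
   Context: $\mathbb{H}$ denotes the quaternions, $|q|$ the Euclidean norm, $\mathbb{S}=\{ix_1+jx_2+kx_3: x_1^2+x_2^2+x_3^2=1\}$, and for $I\in\mathbb{S}$, $L_I=\mathbb{R}+\mathbb{R}I$; every $q\in\mathbb{H}$ can be written $q=re^{I\vartheta}=r(\cos\vartheta+I\sin\vartheta)$ with $r=|q|$, $I\in\mathbb{S}$, $\vartheta\in\mathbb{R}$. For $\Omega\subseteq\mathbb{H}$ set $\Omega_I=\Omega\cap L_I$. A function $f:\Omega\to\mathbb{H}$ on an open set $\Omega$ is slice regular if for every $I\in\mathbb{S}$ its restriction $f_I$ to $\Omega_I$ satisfies $\frac12\left(\frac{\partial}{\partial x}+I\frac{\partial}{\partial y}\right)f_I(x+yI)=0$ on $\Omega_I$. For $0<\varphi<2\pi$ the circular cone is $C(\varphi)=\{re^{I\vartheta}: r>0,\ |\vartheta|<\varphi/2,\ I\in\mathbb{S}\}$. For $f$ slice regular on $\Omega$ and continuous up to the boundary, set $M_f(r,\Omega)=\max\{|f(q)|: q\in\overline{\Omega},\ |q|=r\}$ and define the order of $f$ as $\rho=\limsup_{r\to+\infty}\frac{\ln^+\ln^+M_f(r,\Omega)}{\ln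 r}$, where $\ln^+x=\max\{\ln x,0\}$. *)

(* Defs.v *)
From Stdlib Require Import Reals Lra.
Open Scope R_scope.

Record quat : Type := mkQ { qre : R; qi : R; qj : R; qk : R }.

Definition qadd (p q : quat) : quat :=
  mkQ (qre p + qre q) (qi p + qi q) (qj p + qj q) (qk p + qk q).
Definition qsub (p q : quat) : quat :=
  mkQ (qre p - qre q) (qi p - qi q) (qj p - qj q) (qk p - qk q).
Definition qmul (p q : quat) : quat :=
  mkQ (qre p * qre q - qi p * qi q - qj p * qj q - qk p * qk q)
      (qre p * qi q + qi p * qre q + qj p * qk q - qk p * qj q)
      (qre p * qj q - qi p * qk q + qj p * qre q + qk p * qi q)
      (qre p * qk q + qi p * qj q - qj p * qi q + qk p * qre q).
Definition qzero : quat := mkQ 0 0 0 0.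

Definition qnorm (q : quat) : R :=
  sqrt (qre q ^ 2 + qi q ^ 2 + qj q ^ 2 + qk q ^ 2).

Definition in_S (I : quat) : Prop :=
  qre I = 0 /\ qi I ^ 2 + qj I ^ 2 + qk I ^ 2 = 1.

Definition slice (I : quat) (x y : R) : quat :=
  mkQ (x + y * qre I) (y * qi I) (y * qj I) (y * qk I).

Definition polar (r : R) (I : quat) (th : R) : quat :=
  slice I (r * cos th) (r * sin th).

Definition qopen (A : quat -> Prop) : Prop :=
  forall q, A q -> exists eps, eps > 0 /\ forall p, qnorm (qsub p q) < eps -> A p.
Definition closure (A : quat -> Prop) (q : quat) : Prop :=
  forall eps, eps > 0 -> exists p, A p /\ qnorm (qsub p q) < eps.
Definition boundary (A : quat -> Prop) (q : quat) : Prop :=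
  closure A q /\ closure (fun p => ~ A p) q.

Definition qderiv_lim (g : R -> quat) (t : R) (d : quat) : Prop :=
  derivable_pt_lim (fun s => qre (g s)) t (qre d) /\
  derivable_pt_lim (fun s => qi (g s)) t (qi d) /\
  derivable_pt_lim (fun s => qj (g s)) t (qj d) /\
  derivable_pt_lim (fun s => qk (g s)) t (qk d).

Definition slice_regular (f : quat -> quat) (Om : quat -> Prop) : Prop :=
  qopen Om /\
  forall I, in_S I -> forall x y, Om (slice I x y) ->
    exists dx dy : quat,
      qderiv_lim (fun s => f (slice I s y)) x dx /\
      qderiv_lim (fun s => f (slice I x s)) y dy /\
      qmul (mkQ (1/2) 0 0 0) (qadd dx (qmul I dy)) = qzero.

Definition cone (phi : R) (q : quat) : Prop :=
  exists r I th, r > 0 /\ Rabs th < phi / 2 /\ in_S I /\ q = polar r I th.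

Definition continuous_on_closure (f : quat -> quat) (Om : quat -> Prop) : Prop :=
  forall q, closure Om q -> forall eps, eps > 0 ->
    exists del, del > 0 /\ forall p, closure Om p -> qnorm (qsub p q) < del ->
      qnorm (qsub (f p) (f q)) < eps.

Definition is_Mf (f : quat -> quat) (Om : quat -> Prop) (r m : R) : Prop :=
  (exists q, closure Om q /\ qnorm q = r /\ qnorm (f q) = m) /\
  (forall q, closure Om q -> qnorm q = r -> qnorm (f q) <= m).

Definition lnp (x : R) : R := Rmax (ln x) 0.

Definition limsup_lt (g : R -> R) (a : R) : Prop :=
  exists b, b < a /\ exists R0, forall r, r > R0 -> g r <= b.

Definition order_lt (f : quat -> quat) (Om : quat -> Prop) (a : R) : Prop :=
  exists Mf : R -> R,
    (forall r, r > 0 -> is_Mf f Om r (Mf r)) /\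
    limsup_lt (fun r => lnp (lnp (Mf r)) / ln r) a.

(* Main.v *)
From Stdlib Require Import Reals Lra Lia Classical ClassicalEpsilon FunctionalExtensionality.
From Coquelicot Require Import Coquelicot.
Require Import Defs.
Open Scope R_scope.

(** On a slice [L_I], pairing [f] with the frame [v, I v], where [v = f q0 / |f q0|], gives a complex
    function [F] with [|F| <= |f|] and [|F q0| = |f q0|], so the theorem reduces to the classical
    Phragmen-Lindelof principle in a plane sector: apply the maximum principle to
    [F z * exp (- eps * z ^ beta)] with [rho < beta < alpha].

    Slice regularity only provides partial derivatives satisfying the Cauchy-Riemann equations, so
    holomorphy is not available at the start.  When the derivative is locally bounded, integrating the
    difference quotients against radial test functions (by Arzela's bounded convergence theorem)
    yields a mean value property, which excludes a strict Gaussian peak and hence gives the maximum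
    principle.  The general case is the Looman-Menchoff theorem: by Baire, on a portion of the set
    where the derivative is not locally bounded, [f] is uniformly Lipschitz along the axes; the
    maximum principle on the complement of this set propagates the Lipschitz bound to a full
    neighbourhood, a contradiction. *)

(** * Bounded convergence for continuous functions *)

(** Even where they are bounded, the partial derivatives need not be Riemann integrable, so Green's
    theorem is out of reach: only continuous functions are integrated, and derivatives enter through
    difference quotients alone. The test pair is [(x k, y k)] with [k] radial. It pairs the
    conjugate function [V] with [x k_y - y k_x = 0], which leaves an identity for [U] alone; its
    kernel concentrates at the origin as a parameter [s] tends to 0, so a mean value property
    appears without circle integrals. Excluding a strict peak is enough for the maximum principle,
    because a weight [exp (eps |z|^2)] forces any violation to be attained at an interior point;
    connectedness and the structure of zero sets never enter. The maximum principle takes an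
    arbitrary bounded open set and asks only for local upper bounds near its boundary: the later
    domains are cut by an unknown closed set, and the quotients used there are singular at a
    boundary point. In the sector, [beta < alpha] keeps the real part of [z ^ beta] above a positive
    multiple of [|z| ^ beta], and [beta > rho] makes its decay win against the growth of [F]. *)

Lemma ex_RInt_cont (f : R -> R) (a b : R) : continuity f -> ex_RInt f a b.
Proof.
  intros Hf. apply (ex_RInt_continuous (V := R_CompleteNormedModule)).
  intros z _. apply continuity_pt_filterlim, Hf.
Qed.

Lemma continuity_Rmax (f g : R -> R) :
  continuity f -> continuity g -> continuity (fun x => Rmax (f x) (g x)).
Proof.
  intros Hf Hg x.
  apply continuity_pt_ext with (fun x => (f x + g x + Rabs (f x - g x)) * / 2).
  { intros t. unfold Rmax, Rabs. destruct (Rle_dec (f t) (g t)), (Rcase_abs (f t - g t)); lra. }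
  apply continuity_pt_mult; [|apply continuity_pt_const; now intros ? ?].
  apply continuity_pt_plus; [now apply continuity_pt_plus|].
  apply (continuity_pt_comp (fun x => f x - g x) Rabs).
  - now apply continuity_pt_minus.
  - apply Rcontinuity_abs.
Qed.

Lemma continuity_Rmin (f g : R -> R) :
  continuity f -> continuity g -> continuity (fun x => Rmin (f x) (g x)).
Proof.
  intros Hf Hg x.
  apply continuity_pt_ext with (fun x => - Rmax (- f x) (- g x)).
  { intros t. unfold Rmin, Rmax. destruct (Rle_dec (f t) (g t)), (Rle_dec (- f t) (- g t)); lra. }
  apply continuity_pt_opp.
  apply (continuity_Rmax (fun x => - f x) (fun x => - g x)); intros y; now apply continuity_pt_opp.
Qed.

Lemma RInt_le_cont (f g : R -> R) (a b : R) : a <= b -> continuity f -> continuity g ->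
  (forall x, a <= x <= b -> f x <= g x) -> RInt f a b <= RInt g a b.
Proof.
  intros Hab Hf Hg H. apply RInt_le; auto using ex_RInt_cont.
  intros x Hx. apply H; lra.
Qed.

Lemma RInt_plus_cont (f g : R -> R) (a b : R) : continuity f -> continuity g ->
  RInt (fun x => f x + g x) a b = RInt f a b + RInt g a b.
Proof.
  intros Hf Hg.
  apply (RInt_plus (V := R_CompleteNormedModule) f g); now apply ex_RInt_cont.
Qed.

Lemma RInt_minus_cont (f g : R -> R) (a b : R) : continuity f -> continuity g ->
  RInt (fun x => f x - g x) a b = RInt f a b - RInt g a b.
Proof.
  intros Hf Hg.
  apply (RInt_minus (V := R_CompleteNormedModule) f g); now apply ex_RInt_cont.
Qed.

Lemma RInt_scal_cont (f : R -> R) (c a b : R) : continuity f ->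
  RInt (fun x => c * f x) a b = c * RInt f a b.
Proof.
  intros Hf.
  apply (RInt_scal (V := R_CompleteNormedModule) f); now apply ex_RInt_cont.
Qed.

(** Compactness is used through a gauge: the radius at [t] is also at most [1 / (n + 1)], where [n]
    is an index good near [t]. A positive lower bound [d] on the radii then bounds these indices by
    [1 / d], and monotonicity lets one index serve everywhere. *)
Lemma dini (h : nat -> R -> R) (a b eps : R) :
  0 < eps -> (forall n, continuity (h n)) ->
  (forall n x, h (S n) x <= h n x) ->
  (forall x, a <= x <= b -> exists n, h n x < eps) ->
  exists n, forall x, a <= x <= b -> h n x < eps.
Proof.
  intros Heps Hc Hd Hp.
  assert (Hmon : forall n m x, (n <= m)%nat -> h m x <= h n x).
  { intros n m x Hnm. induction Hnm as [|m Hnm IH]; [lra|].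
    eapply Rle_trans; [apply Hd|exact IH]. }
  assert (Hsel : forall t, exists d : posreal, a <= t <= b -> exists n : nat,
    INR n * d <= 1 /\ forall x, Rabs (x - t) < d -> h n x < eps).
  { intros t. destruct (classic (a <= t <= b)) as [Ht|Ht].
    2:{ exists (mkposreal 1 Rlt_0_1). tauto. }
    destruct (Hp t Ht) as [n Hn].
    destruct (proj1 (continuity_pt_locally (h n) t) (Hc n t)
       (mkposreal (eps - h n t) (proj2 (Rlt_0_minus _ _) Hn))) as [d Hdd].
    assert (Hpos : 0 < / (INR n + 1)) by (apply Rinv_0_lt_compat; pose proof (pos_INR n); lra).
    assert (Hm : 0 < Rmin d (/ (INR n + 1))) by (apply Rmin_pos; [apply cond_pos|exact Hpos]).
    exists (mkposreal _ Hm). intros _. exists n. split; simpl.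
    - pose proof (Rmin_r d (/ (INR n + 1))) as Hr. pose proof (pos_INR n) as Hn0.
      apply Rle_trans with (INR n * / (INR n + 1)).
      + now apply Rmult_le_compat_l.
      + apply Rle_trans with ((INR n + 1) * / (INR n + 1)); [|right; field; lra].
        apply Rmult_le_compat_r; lra.
    - intros x Hx. assert (Hx' : Rabs (x - t) < d) by (eapply Rlt_le_trans; [exact Hx|apply Rmin_l]).
      specialize (Hdd x Hx'). simpl in Hdd.
      apply Rabs_def2 in Hdd. lra. }
  apply choice in Hsel. destruct Hsel as [delta Hdelta].
  destruct (compactness_value_1d a b delta) as [d Hd'].
  destruct (INR_unbounded (/ d)) as [N HN].
  exists N. intros x Hx. apply NNPP. intros Hno. apply (Hd' x Hx).
  intros [t [Ht [Hxt Hdt]]]. apply Hno.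
  destruct (Hdelta t Ht) as [n [Hn1 Hn2]].
  apply Rle_lt_trans with (h n x); [|now apply Hn2].
  apply Hmon. apply INR_le.
  pose proof (cond_pos d) as Hdp.
  apply Rlt_le, Rle_lt_trans with (/ d); [|exact HN].
  apply Rmult_le_reg_r with d; [exact Hdp|]. rewrite Rinv_l; [|lra].
  apply Rle_trans with (INR n * delta t); [|exact Hn1].
  apply Rmult_le_compat_l; [apply pos_INR|exact Hdt].
Qed.

(** Finite maxima stay continuous, hence Riemann integrable, which the supremum of a whole tail need
    not be. *)
Fixpoint run_max (u : nat -> R -> R) (i m : nat) (x : R) : R :=
  match m with O => u i x | S m' => Rmax (u (i + m)%nat x) (run_max u i m' x) end.

Fixpoint run_min (g : nat -> R -> R) (n : nat) (x : R) : R :=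
  match n with O => g O x | S n' => Rmin (g n x) (run_min g n' x) end.

Lemma run_max_cont u i m : (forall n, continuity (u n)) -> continuity (run_max u i m).
Proof.
  intros Hu. induction m as [|m IH]; simpl; [apply Hu|].
  now apply (continuity_Rmax (u (i + S m)%nat) (run_max u i m)).
Qed.

Lemma run_min_cont g n : (forall n, continuity (g n)) -> continuity (run_min g n).
Proof.
  intros Hg. induction n as [|n IH]; simpl; [apply Hg|].
  now apply (continuity_Rmin (g (S n)) (run_min g n)).
Qed.

Lemma run_max_lub u i m x B : (forall k, (i <= k)%nat -> u k x <= B) -> run_max u i m x <= B.
Proof.
  intros H. induction m as [|m IH]; simpl; [apply H; lia|].
  apply Rmax_lub; [apply H; lia|exact IH].
Qed.

Lemma run_max_ge u i m k x : (i <= k <= i + m)%nat -> u k x <= run_max u i m x.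
Proof.
  induction m as [|m IH]; simpl; intros Hk.
  - replace k with i by lia. lra.
  - destruct (Nat.eq_dec k (i + S m)) as [->|Hne]; [apply Rmax_l|].
    eapply Rle_trans; [apply IH; lia|apply Rmax_r].
Qed.

Lemma run_max_incl u i m j n x : (i <= j)%nat -> (j + n <= i + m)%nat ->
  run_max u j n x <= run_max u i m x.
Proof.
  intros Hij Hjn.
  assert (H : forall k, (j <= k <= j + n)%nat -> u k x <= run_max u i m x)
    by (intros k Hk; apply run_max_ge; lia).
  clear Hjn. induction n as [|n IH]; simpl; [apply H; lia|].
  apply Rmax_lub; [apply H; lia|]. apply IH. intros k Hk; apply H; lia.
Qed.

(* With [g_i] a maximum of finitely many [u_k], [k >= i], whose integral is within [e_i] of the
   supremum over all such maxima, the decreasing functions [min (g_0, ..., g_n)] tend to [0]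
   pointwise, hence uniformly by Dini, while their integrals lose at most [sum e_i]. *)
Lemma bounded_convergence_nonneg (u : nat -> R -> R) (a b N : R) :
  a <= b -> (forall n, continuity (u n)) ->
  (forall n x, a <= x <= b -> 0 <= u n x <= N) ->
  (forall x, a <= x <= b -> is_lim_seq (fun n => u n x) 0) ->
  is_lim_seq (fun n => RInt (u n) a b) 0.
Proof.
  intros Hab Hu HN Hlim.
  assert (Hmax : forall i eps, exists m, 0 < eps -> forall m',
     RInt (run_max u i m') a b <= RInt (run_max u i m) a b + eps).
  { intros i eps. destruct (Rlt_dec 0 eps) as [Heps|Heps]; [|exists O; tauto].
    destruct (completeness (fun y => exists m, y = RInt (run_max u i m) a b)) as [S [HS1 HS2]].
    - exists (N * (b - a)). intros y [m ->].
      replace (N * (b - a)) with (RInt (fun _ => N) a b).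
      2:{ rewrite RInt_const. unfold scal; simpl; unfold mult; simpl. ring. }
      apply RInt_le_cont; auto.
      + now apply run_max_cont.
      + intros x. apply continuity_pt_const. now intros ? ?.
      + intros x Hx. apply run_max_lub. intros k _. now apply HN.
    - exists (RInt (run_max u i 0) a b). now exists O.
    - destruct (classic (exists m, S - eps < RInt (run_max u i m) a b)) as [[m Hm]|Hno].
      + exists m. intros _ m'. assert (RInt (run_max u i m') a b <= S) by (apply HS1; now exists m').
        lra.
      + exfalso. assert (S <= S - eps); [|lra]. apply HS2. intros y [m ->].
        apply Rnot_lt_le. intros Hc. apply Hno. now exists m. }
  apply is_lim_seq_spec. intros eps0. simpl.
  (* The summed losses cost at most [eps] and the uniform bound from Dini costs [eps * (b - a)];
     together they make [eps0 / 2]. *)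
  set (eps := eps0 / (2 * (b - a + 1))).
  assert (Heps : 0 < eps).
  { unfold eps. apply Rdiv_lt_0_compat; [apply cond_pos|lra]. }
  pose (e := fun i => eps / 2 ^ (S i)).
  assert (He : forall i, 0 < e i).
  { intros i. unfold e. apply Rdiv_lt_0_compat; [exact Heps|]. apply pow_lt; lra. }
  assert (Hm' : exists m : nat -> nat, forall i m', RInt (run_max u i m') a b
      <= RInt (run_max u i (m i)) a b + e i).
  { destruct (choice (fun i m => forall m', RInt (run_max u i m') a b
      <= RInt (run_max u i m) a b + e i)) as [m Hm].
    - intros i. destruct (Hmax i (e i)) as [m Hm]. exists m. now apply Hm.
    - now exists m. }
  destruct Hm' as [m Hm].
  pose (g := fun i => run_max u i (m i)).
  assert (Hg : forall i, continuity (g i)) by (intros; now apply run_max_cont).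
  (* Pointwise, [min k u <= min (min g k) u + (max u g - g)]. The last bracket integrates to at most
     [e i], because [max u_w g_i] lies below a longer running maximum; the [e i] add up to
     [eps (1 - 2^-(n+1))]. *)
  assert (Hloss : forall n w, (n <= w)%nat ->
    RInt (u w) a b - eps * (1 - / 2 ^ (S n))
      <= RInt (fun x => Rmin (run_min g n x) (u w x)) a b).
  { assert (Hstep : forall i w, (i <= w)%nat ->
       RInt (fun x => Rmax (u w x) (g i x)) a b <= RInt (g i) a b + e i).
    { intros i w Hiw. set (m' := Nat.max (m i) (w - i)).
      apply Rle_trans with (RInt (run_max u i m') a b); [|apply Hm].
      apply RInt_le_cont; auto.
      - now apply (continuity_Rmax (u w) (g i)).
      - now apply run_max_cont.
      - intros x _. apply Rmax_lub.
        + apply run_max_ge. lia.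
        + apply run_max_incl; lia. }
    induction n as [|n IH]; intros w Hw.
    - simpl run_min.
      assert (H1 : RInt (u w) a b <= RInt (fun x => Rmin (g O x) (u w x)
                     + (Rmax (u w x) (g O x) - g O x)) a b).
      { apply RInt_le_cont; auto.
        - intros x. apply continuity_pt_plus; [now apply (continuity_Rmin (g O) (u w))|].
          apply continuity_pt_minus; [now apply (continuity_Rmax (u w) (g O))|apply Hg].
        - intros x _. unfold Rmin, Rmax. destruct (Rle_dec (g O x) (u w x)), (Rle_dec (u w x) (g O x)); lra. }
      rewrite RInt_plus_cont, RInt_minus_cont in H1; auto.
      2: now apply (continuity_Rmax (u w) (g O)).
      2: now apply (continuity_Rmin (g O) (u w)).
      2: intros x; apply continuity_pt_minus; [now apply (continuity_Rmax (u w) (g O))|apply Hg].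
      pose proof (Hstep O w Hw) as H2. unfold e in H2. simpl in H2 |- *. lra.
    - simpl run_min.
      set (k := run_min g n) in *.
      assert (Hk : continuity k) by now apply run_min_cont.
      assert (H1 : RInt (fun x => Rmin (k x) (u w x)) a b
               <= RInt (fun x => Rmin (Rmin (g (S n) x) (k x)) (u w x)
                     + (Rmax (u w x) (g (S n) x) - g (S n) x)) a b).
      { apply RInt_le_cont; auto.
        - now apply (continuity_Rmin k (u w)).
        - intros x. apply continuity_pt_plus.
          + apply (continuity_Rmin (fun x => Rmin (g (S n) x) (k x)) (u w)); auto.
            now apply (continuity_Rmin (g (S n)) k).
          + apply continuity_pt_minus; [now apply (continuity_Rmax (u w) (g (S n)))|apply Hg].
        - intros x _. unfold Rmin, Rmax.
          destruct (Rle_dec (g (S n) x) (k x)), (Rle_dec (u w x) (g (S n) x)), (Rle_dec (k x) (u w x));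
           repeat destruct Rle_dec; lra. }
      rewrite RInt_plus_cont, RInt_minus_cont in H1; auto.
      2: now apply (continuity_Rmax (u w) (g (S n))).
      2:{ apply (continuity_Rmin (fun x => Rmin (g (S n) x) (k x)) (u w)); auto.
            now apply (continuity_Rmin (g (S n)) k). }
      2: intros x; apply continuity_pt_minus; [now apply (continuity_Rmax (u w) (g (S n)))|apply Hg].
      pose proof (Hstep (S n) w Hw) as H2. pose proof (IH w ltac:(lia)) as H3.
      unfold e in H2.
      assert (Hid : eps / 2 ^ S (S n) = eps * / 2 ^ S n - eps * / 2 ^ S (S n)).
      { simpl. field. apply pow_nonzero; lra. }
      lra. }
  destruct (dini (run_min g) a b eps) as [n Hn]; auto.
  { intros n. now apply run_min_cont. }
  { intros n x. simpl. apply Rmin_r. }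
  { intros x Hx. pose proof (Hlim x Hx) as Hl. apply is_lim_seq_spec in Hl.
    assert (Heps2 : 0 < eps / 2) by lra.
    destruct (Hl (mkposreal _ Heps2)) as [K HK]. simpl in HK.
    exists K. apply Rle_lt_trans with (g K x).
    - destruct K; simpl; [lra|apply Rmin_l].
    - apply Rle_lt_trans with (eps / 2); [|lra]. apply run_max_lub. intros k Hk.
      specialize (HK k Hk). apply Rabs_def2 in HK. lra. }
  exists n. intros w Hw.
  specialize (Hloss n w Hw).
  assert (H1 : RInt (fun x => Rmin (run_min g n x) (u w x)) a b <= RInt (fun _ => eps) a b).
  { apply RInt_le_cont; auto.
    - apply (continuity_Rmin (run_min g n) (u w)); auto. now apply run_min_cont.
    - intros x. apply continuity_pt_const. now intros ? ?.
    - intros x Hx. eapply Rle_trans; [apply Rmin_l|]. now apply Rlt_le, Hn. }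
  rewrite RInt_const in H1. unfold scal in H1; simpl in H1; unfold mult in H1; simpl in H1.
  assert (H0 : 0 <= RInt (u w) a b).
  { apply RInt_ge_0; auto; [now apply ex_RInt_cont|]. intros x Hx. apply HN; lra. }
  assert (Hp : 0 < / 2 ^ S n) by (apply Rinv_0_lt_compat, pow_lt; lra).
  rewrite Rminus_0_r, Rabs_pos_eq; [|exact H0].
  assert (Hid : eps * (2 * (b - a + 1)) = eps0) by (unfold eps; field; lra).
  pose proof (cond_pos eps0).
  simpl in Hloss, Hp. nra.
Qed.

Lemma bounded_convergence (f : nat -> R -> R) (a b N : R) :
  a <= b -> (forall n, continuity (f n)) ->
  (forall n x, a <= x <= b -> Rabs (f n x) <= N) ->
  (forall x, a <= x <= b -> is_lim_seq (fun n => f n x) 0) ->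
  is_lim_seq (fun n => RInt (f n) a b) 0.
Proof.
  intros Hab Hf HN Hlim.
  apply (proj2 (is_lim_seq_abs_0 _)).
  assert (Habs : forall n, continuity (fun x => Rabs (f n x))).
  { intros n x. apply (continuity_pt_comp (f n) Rabs); [apply Hf|apply Rcontinuity_abs]. }
  apply is_lim_seq_le_le with (fun _ => 0) (fun n => RInt (fun x => Rabs (f n x)) a b).
  - intros n. split; [apply Rabs_pos|]. apply abs_RInt_le; auto. now apply ex_RInt_cont.
  - apply is_lim_seq_const.
  - apply bounded_convergence_nonneg with N; auto.
    + intros n x Hx. split; [apply Rabs_pos|now apply HN].
    + intros x Hx. now apply (proj1 (is_lim_seq_abs_0 _)), Hlim.
Qed.

(** * Iterated integrals over a square *)

Definition continuous2 (F : R -> R -> R) : Prop := forall x y, continuity_2d_pt F x y.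

Definition RInt2 (F : R -> R -> R) (a b : R) : R :=
  RInt (fun y => RInt (fun x => F x y) a b) a b.

Lemma continuous2_const c : continuous2 (fun _ _ => c).
Proof. intros x y. apply continuity_2d_pt_const. Qed.

Lemma continuous2_fst : continuous2 (fun x _ => x).
Proof. intros x y. apply continuity_2d_pt_id1. Qed.

Lemma continuous2_snd : continuous2 (fun _ y => y).
Proof. intros x y. apply continuity_2d_pt_id2. Qed.

Lemma continuous2_plus F G : continuous2 F -> continuous2 G -> continuous2 (fun x y => F x y + G x y).
Proof. intros HF HG x y. now apply continuity_2d_pt_plus. Qed.

Lemma continuous2_minus F G : continuous2 F -> continuous2 G -> continuous2 (fun x y => F x y - G x y).
Proof. intros HF HG x y. now apply continuity_2d_pt_minus. Qed.

Lemma continuous2_mult F G : continuous2 F -> continuous2 G -> continuous2 (fun x y => F x y * G x y).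
Proof. intros HF HG x y. now apply continuity_2d_pt_mult. Qed.

Lemma continuous2_opp F : continuous2 F -> continuous2 (fun x y => - F x y).
Proof. intros HF x y. now apply continuity_2d_pt_opp. Qed.

Lemma continuous2_comp1 f F : continuity f -> continuous2 F -> continuous2 (fun x y => f (F x y)).
Proof. intros Hf HF x y. now apply continuity_1d_2d_pt_comp. Qed.

Lemma continuous2_comp F G H : continuous2 F -> continuous2 G -> continuous2 H ->
  continuous2 (fun x y => F (G x y) (H x y)).
Proof.
  intros HF HG HH x y eps.
  destruct (HF (G x y) (H x y) eps) as [d Hd].
  destruct (HG x y d) as [d1 Hd1]. destruct (HH x y d) as [d2 Hd2].
  assert (Hm : 0 < Rmin d1 d2) by (apply Rmin_pos; apply cond_pos).
  exists (mkposreal _ Hm). simpl. intros u v Hu Hv.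
  apply Hd; [apply Hd1|apply Hd2]; eapply Rlt_le_trans; eauto using Rmin_l, Rmin_r.
Qed.

Lemma continuous2_inv F : continuous2 F -> (forall x y, F x y <> 0) ->
  continuous2 (fun x y => / F x y).
Proof. intros HF Hn x y. now apply continuity_2d_pt_inv. Qed.

Lemma continuous2_Rmax0 F : continuous2 F -> continuous2 (fun x y => Rmax (F x y) 0).
Proof.
  intros HF. apply (continuous2_comp1 (fun t => Rmax t 0)); [|exact HF].
  apply (continuity_Rmax (fun t => t) (fun _ => 0)).
  - intros t. apply continuity_pt_id.
  - intros t. apply continuity_pt_const. now intros ? ?.
Qed.

Ltac continuous2_tac := repeat first
  [ apply continuous2_const | apply continuous2_fst | apply continuous2_snd | assumption
  | match goal with H : continuous2 ?F |- continuous2 (fun x y => ?F (@?G x y) (@?K x y)) =>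
      apply (continuous2_comp F G K) end
  | apply continuous2_Rmax0
  | apply continuous2_plus | apply continuous2_minus | apply continuous2_mult
  | apply continuous2_opp | apply continuous2_inv ].

Lemma continuous2_slice F y : continuous2 F -> continuity (fun x => F x y).
Proof.
  intros HF x. apply continuity_pt_locally. intros eps.
  destruct (HF x y eps) as [d Hd]. exists d. intros u Hu. apply Hd; [exact Hu|].
  rewrite Rminus_diag, Rabs_R0. apply cond_pos.
Qed.

Lemma continuity_RInt_slice F a b : a <= b -> continuous2 F ->
  continuity (fun y => RInt (fun x => F x y) a b).
Proof.
  intros Hab HF c. apply continuity_pt_locally. intros eps.
  assert (He : 0 < eps / (2 * (b - a + 1))).
  { apply Rdiv_lt_0_compat; [apply cond_pos|lra]. }
  destruct (uniform_continuity_2d_1d F a b c (fun x _ => HF x c) (mkposreal _ He)) as [d Hd].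
  exists d. intros v Hv. apply Rabs_lt_between' in Hv.
  rewrite <- RInt_minus_cont by now apply continuous2_slice.
  assert (Hc : continuity (fun x => F x v - F x c)).
  { intros x. apply continuity_pt_minus; now apply (continuous2_slice F). }
  apply Rle_lt_trans with ((b - a) * (eps / (2 * (b - a + 1)))).
  - apply abs_RInt_le_const; auto using ex_RInt_cont.
    intros x Hx. pose proof (cond_pos d).
    apply Rlt_le, (Hd x c x v); try lra. rewrite Rminus_diag, Rabs_R0. lra.
  - pose proof (cond_pos eps).
    assert (Hid : (b - a + 1) * (eps / (2 * (b - a + 1))) = eps / 2) by (field; lra).
    nra.
Qed.

Lemma RInt2_ext F G a b : a <= b -> (forall x y, a <= x <= b -> a <= y <= b -> F x y = G x y) ->
  RInt2 F a b = RInt2 G a b.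
Proof.
  intros Hab H. apply RInt_ext. intros y Hy. apply RInt_ext. intros x Hx.
  rewrite Rmin_left, Rmax_right in * by exact Hab. apply H; lra.
Qed.

Lemma RInt2_le F G a b : a <= b -> continuous2 F -> continuous2 G ->
  (forall x y, a <= x <= b -> a <= y <= b -> F x y <= G x y) -> RInt2 F a b <= RInt2 G a b.
Proof.
  intros Hab HF HG H. apply RInt_le_cont; auto using continuity_RInt_slice.
  intros y Hy. apply RInt_le_cont; auto using continuous2_slice.
Qed.

Lemma RInt2_plus F G a b : a <= b -> continuous2 F -> continuous2 G ->
  RInt2 (fun x y => F x y + G x y) a b = RInt2 F a b + RInt2 G a b.
Proof.
  intros Hab HF HG. unfold RInt2.
  rewrite <- RInt_plus_cont by now apply continuity_RInt_slice.
  apply RInt_ext. intros y _. apply RInt_plus_cont; now apply continuous2_slice.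
Qed.

Lemma RInt2_minus F G a b : a <= b -> continuous2 F -> continuous2 G ->
  RInt2 (fun x y => F x y - G x y) a b = RInt2 F a b - RInt2 G a b.
Proof.
  intros Hab HF HG. unfold RInt2.
  rewrite <- RInt_minus_cont by now apply continuity_RInt_slice.
  apply RInt_ext. intros y _. apply RInt_minus_cont; now apply continuous2_slice.
Qed.

Lemma RInt2_scal F c a b : a <= b -> continuous2 F ->
  RInt2 (fun x y => c * F x y) a b = c * RInt2 F a b.
Proof.
  intros Hab HF. unfold RInt2.
  rewrite <- RInt_scal_cont by now apply continuity_RInt_slice.
  apply RInt_ext. intros y _. apply RInt_scal_cont; now apply continuous2_slice.
Qed.

Lemma RInt2_ge_0 F a b : a <= b -> continuous2 F ->
  (forall x y, a <= x <= b -> a <= y <= b -> 0 <= F x y) -> 0 <= RInt2 F a b.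
Proof.
  intros Hab HF H. apply RInt_ge_0; [exact Hab|now apply ex_RInt_cont, continuity_RInt_slice|].
  intros y Hy. apply RInt_ge_0; [exact Hab|now apply ex_RInt_cont, continuous2_slice|].
  intros x Hx. apply H; lra.
Qed.

Lemma RInt_pos_cont (f : R -> R) (a b x0 : R) : a < x0 < b -> continuity f ->
  (forall x, a <= x <= b -> 0 <= f x) -> 0 < f x0 -> 0 < RInt f a b.
Proof.
  intros Hx0 Hf H0 Hp.
  destruct (proj1 (continuity_pt_locally f x0) (Hf x0) (mkposreal _ Hp)) as [d Hd]. simpl in Hd.
  set (c := Rmin (x0 + d) b).
  assert (Hc : x0 < c <= b /\ c <= x0 + d).
  { unfold c. pose proof (cond_pos d). split; [split|].
    - apply Rmin_glb_lt; lra.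
    - apply Rmin_r.
    - apply Rmin_l. }
  assert (HC : RInt f a b = RInt f a x0 + (RInt f x0 c + RInt f c b)).
  { pose proof (RInt_Chasles (V := R_CompleteNormedModule) f x0 c b) as H1.
    pose proof (RInt_Chasles (V := R_CompleteNormedModule) f a x0 b) as H2.
    unfold plus in H1, H2; simpl in H1, H2.
    rewrite H1, H2; auto using ex_RInt_cont. }
  assert (0 <= RInt f a x0).
  { apply RInt_ge_0; [lra|now apply ex_RInt_cont|]. intros x Hx; apply H0; lra. }
  assert (0 <= RInt f c b).
  { apply RInt_ge_0; [lra|now apply ex_RInt_cont|]. intros x Hx; apply H0; lra. }
  assert (0 < RInt f x0 c).
  { apply RInt_gt_0; [lra| |].
    - intros x Hx. assert (Hxd : Rabs (x - x0) < d) by (apply Rabs_lt_between'; lra).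
      specialize (Hd x Hxd). apply Rabs_lt_between' in Hd. lra.
    - intros x _. apply continuity_pt_filterlim, Hf. }
  lra.
Qed.

Lemma RInt2_pos F (a b x0 y0 : R) : a < x0 < b -> a < y0 < b -> continuous2 F ->
  (forall x y, a <= x <= b -> a <= y <= b -> 0 <= F x y) -> 0 < F x0 y0 -> 0 < RInt2 F a b.
Proof.
  intros Hx0 Hy0 HF H0 Hp. apply (RInt_pos_cont _ a b y0); auto.
  - apply continuity_RInt_slice; auto; lra.
  - intros y Hy. apply RInt_ge_0; [lra| |].
    + now apply ex_RInt_cont, continuous2_slice.
    + intros x Hx. apply H0; lra.
  - apply (RInt_pos_cont _ a b x0); auto.
    + now apply continuous2_slice.
    + intros x Hx. apply H0; lra.
Qed.

(** The inner integrals are themselves bounded, continuous in [y] and convergent to 0, so the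
    one-dimensional result applies twice. *)
Lemma bounded_convergence2 (F : nat -> R -> R -> R) (a b N : R) :
  a <= b -> (forall n, continuous2 (F n)) ->
  (forall n x y, a <= x <= b -> a <= y <= b -> Rabs (F n x y) <= N) ->
  (forall x y, a <= x <= b -> a <= y <= b -> is_lim_seq (fun n => F n x y) 0) ->
  is_lim_seq (fun n => RInt2 (F n) a b) 0.
Proof.
  intros Hab HF HN Hlim.
  apply (bounded_convergence (fun n y => RInt (fun x => F n x y) a b) a b ((b - a) * N)); auto.
  - intros n. now apply continuity_RInt_slice.
  - intros n y Hy. apply abs_RInt_le_const; auto. now apply ex_RInt_cont, continuous2_slice.
  - intros y Hy. apply (bounded_convergence (fun n x => F n x y) a b N); auto.
    intros n. now apply continuous2_slice.
Qed.

Lemma RInt_shift (f : R -> R) (a b h : R) : continuity f ->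
  RInt (fun x => f (x + h)) a b = RInt f (a + h) (b + h).
Proof.
  intros Hf.
  pose proof (RInt_comp_lin (V := R_CompleteNormedModule) f 1 h a b) as H.
  rewrite !Rmult_1_l in H. rewrite <- H by now apply ex_RInt_cont.
  apply RInt_ext. intros x _. unfold scal; simpl; unfold mult; simpl. now rewrite !Rmult_1_l.
Qed.

Lemma RInt_zero_outside (f : R -> R) (a b c d : R) : continuity f -> a <= c <= d -> d <= b ->
  (forall x, a <= x <= c -> f x = 0) -> (forall x, d <= x <= b -> f x = 0) ->
  RInt f a b = RInt f c d.
Proof.
  intros Hf Hac Hdb H1 H2.
  pose proof (RInt_Chasles (V := R_CompleteNormedModule) f a c b) as E1.
  pose proof (RInt_Chasles (V := R_CompleteNormedModule) f c d b) as E2.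
  unfold plus in E1, E2; simpl in E1, E2.
  rewrite <- E1, <- E2 by now apply ex_RInt_cont.
  assert (Z : forall u v, u <= v -> (forall x, u <= x <= v -> f x = 0) -> RInt f u v = 0).
  { intros u v Huv Hz. rewrite (RInt_ext f (fun _ => 0)).
    - rewrite RInt_const. unfold scal; simpl; unfold mult; simpl. ring.
    - intros x. rewrite Rmin_left, Rmax_right by exact Huv. intros Hx. apply Hz. lra. }
  rewrite (Z a c), (Z d b); auto; lra.
Qed.

(** Shrinking the support by [Rabs h] keeps it inside both the interval and its translate, so no
    mass crosses the endpoints. *)
Lemma RInt_shift_supp (f : R -> R) (A B h : R) : continuity f -> B <= A -> 0 <= B - Rabs h ->
  (forall x, B - Rabs h <= Rabs x -> f x = 0) ->
  RInt (fun x => f (x + h)) (- A) A = RInt f (- A) A.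
Proof.
  intros Hf HBA HB Hz. rewrite RInt_shift by exact Hf.
  set (c := B - Rabs h) in *.
  assert (Hh : - Rabs h <= h <= Rabs h).
  { unfold Rabs. destruct (Rcase_abs h); lra. }
  rewrite (RInt_zero_outside f (- A + h) (A + h) (- c) c), (RInt_zero_outside f (- A) A (- c) c); auto;
   try (unfold c in *; lra);
   intros x Hx; apply Hz; unfold c in *; unfold Rabs at 2; destruct (Rcase_abs x); lra.
Qed.

Lemma RInt2_shift_x F (A B h : R) : continuous2 F -> B <= A -> 0 <= B - Rabs h ->
  (forall x y, B - Rabs h <= Rabs x -> F x y = 0) ->
  RInt2 (fun x y => F (x + h) y) (- A) A = RInt2 F (- A) A.
Proof.
  intros HF HBA HB Hz. apply RInt_ext. intros y _.
  apply (RInt_shift_supp (fun x => F x y) A B h); auto. now apply continuous2_slice.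
Qed.

Lemma RInt2_shift_y F (A B h : R) : continuous2 F -> B <= A -> 0 <= B - Rabs h ->
  (forall x y, B - Rabs h <= Rabs y -> F x y = 0) ->
  RInt2 (fun x y => F x (y + h)) (- A) A = RInt2 F (- A) A.
Proof.
  intros HF HBA HB Hz.
  assert (0 <= Rabs h) by apply Rabs_pos.
  apply (RInt_shift_supp (fun y => RInt (fun x => F x y) (- A) A) A B h); auto.
  - apply continuity_RInt_slice; auto; lra.
  - intros y Hy. rewrite (RInt_ext _ (fun _ => 0)).
    + rewrite RInt_const. unfold scal; simpl; unfold mult; simpl. ring.
    + intros x _. now apply Hz.
Qed.

(** * Weak Cauchy-Riemann equations *)

Lemma is_derive_val (f : R -> R) (x l l' : R) : is_derive f x l -> l = l' -> is_derive f x l'.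
Proof. now intros H <-. Qed.

Lemma is_derive_continuity_pt (f : R -> R) x l : is_derive f x l -> continuity_pt f x.
Proof.
  intros H. apply is_derive_Reals in H. apply derivable_continuous_pt. now exists l.
Qed.

Lemma mvt_bound (f : R -> R) (a b N : R) :
  (forall x, Rmin a b <= x <= Rmax a b -> exists d, is_derive f x d /\ Rabs d <= N) ->
  Rabs (f b - f a) <= N * Rabs (b - a).
Proof.
  intros H.
  destruct (MVT_gen f a b (Derive f)) as [c [Hc He]].
  - intros x Hx. destruct (H x) as [d [Hd _]]; [lra|].
    rewrite (is_derive_unique _ _ _ Hd). exact Hd.
  - intros x Hx. destruct (H x Hx) as [d [Hd _]]. now apply is_derive_continuity_pt with d.
  - rewrite He, Rabs_mult. apply Rmult_le_compat_r; [apply Rabs_pos|].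
    destruct (H c Hc) as [d [Hd Hb]]. now rewrite (is_derive_unique _ _ _ Hd).
Qed.

Lemma is_derive_quotient_lim (f : R -> R) x l (h : nat -> R) :
  is_derive f x l -> (forall n, h n <> 0) -> is_lim_seq h 0 ->
  is_lim_seq (fun n => (f (x + h n) - f x) / h n) l.
Proof.
  intros Hf Hn Hh. apply is_derive_Reals in Hf.
  apply is_lim_seq_spec. intros eps. destruct (Hf eps (cond_pos eps)) as [d Hd].
  apply is_lim_seq_spec in Hh. destruct (Hh d) as [K HK].
  exists K. intros n Hk. apply Hd; auto. specialize (HK n Hk). now rewrite Rminus_0_r in HK.
Qed.

Lemma continuous2_bounded F (a b : R) : continuous2 F ->
  exists N, 0 <= N /\ forall x y, a <= x <= b -> a <= y <= b -> Rabs (F x y) <= N.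
Proof.
  intros HF.
  assert (Hsel : forall u v, exists d : posreal,
    (Rabs (F u v) + 1) * d <= 1 /\
    forall x y, Rabs (x - u) < d -> Rabs (y - v) < d -> Rabs (F x y - F u v) < 1).
  { intros u v. destruct (HF u v (mkposreal 1 Rlt_0_1)) as [d Hd]. simpl in Hd.
    pose proof (Rabs_pos (F u v)) as Hp.
    assert (Hi : 0 < / (Rabs (F u v) + 1)) by (apply Rinv_0_lt_compat; lra).
    assert (Hm : 0 < Rmin d (/ (Rabs (F u v) + 1))) by (apply Rmin_pos; [apply cond_pos|exact Hi]).
    exists (mkposreal _ Hm). simpl. split.
    - apply Rle_trans with ((Rabs (F u v) + 1) * / (Rabs (F u v) + 1)); [|right; field; lra].
      apply Rmult_le_compat_l; [lra|apply Rmin_r].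
    - intros x y Hx Hy. apply Hd; eapply Rlt_le_trans; eauto using Rmin_l. }
  assert (Hsel2 : exists delta : R -> R -> posreal, forall u v,
    (Rabs (F u v) + 1) * delta u v <= 1 /\
    forall x y, Rabs (x - u) < delta u v -> Rabs (y - v) < delta u v -> Rabs (F x y - F u v) < 1).
  { destruct (choice (fun (p : R * R) (d : posreal) => 
      (Rabs (F (fst p) (snd p)) + 1) * d <= 1 /\
      forall x y, Rabs (x - fst p) < d -> Rabs (y - snd p) < d ->
        Rabs (F x y - F (fst p) (snd p)) < 1)) as [delta Hdel].
    - intros [u v]. apply Hsel.
    - exists (fun u v => delta (u, v)). intros u v. exact (Hdel (u, v)). }
  destruct Hsel2 as [delta Hdel].
  destruct (compactness_value_2d a b a b delta) as [d Hd].
  pose proof (cond_pos d) as Hdp.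
  exists (/ d). split; [apply Rlt_le, Rinv_0_lt_compat, Hdp|].
  intros x y Hx Hy. apply NNPP. intros Hno. apply (Hd x y Hx Hy).
  intros [u [v [_ [_ [Hu [Hv Hduv]]]]]]. apply Hno.
  destruct (Hdel u v) as [H1 H2]. specialize (H2 x y Hu Hv).
  assert (Hb : Rabs (F x y) <= Rabs (F u v) + 1).
  { pose proof (Rabs_triang_inv (F x y) (F u v)). lra. }
  apply Rle_trans with (1 := Hb).
  apply Rmult_le_reg_r with d; [exact Hdp|]. rewrite Rinv_l by lra.
  apply Rle_trans with (2 := H1). apply Rmult_le_compat_l; [|exact Hduv].
  pose proof (Rabs_pos (F u v)). lra.
Qed.

(** The complex derivative of [U + i V] is [p + i q]. The bound [N] is included because it controls
    all difference quotients through the mean value theorem, which is what bounded convergence asks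
    for. *)
Definition cauchy_riemann (U V : R -> R -> R) (N x y : R) : Prop := exists p q : R,
  is_derive (fun t => U t y) x p /\ is_derive (fun t => V t y) x q /\
  is_derive (fun t => U x t) y (- q) /\ is_derive (fun t => V x t) y p /\
  Rabs p <= N /\ Rabs q <= N.

(** * Integration by parts through difference quotients *)

Section Weak.
Variable R0 : R.
Hypothesis HR0 : 0 < R0.

Let h (n : nat) : R := R0 / (INR n + 1).

Lemma step_bounds n : 0 < h n <= R0.
Proof.
  unfold h. pose proof (pos_INR n). split; [apply Rdiv_lt_0_compat; lra|].
  apply Rmult_le_reg_r with (INR n + 1); [lra|].
  replace (R0 / (INR n + 1) * (INR n + 1)) with R0 by (field; lra). nra.
Qed.

Lemma step_lim : is_lim_seq h 0.
Proof.
  unfold h. apply is_lim_seq_ext with (fun n => R0 * / (INR (S n))).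
  { intros n. rewrite S_INR. reflexivity. }
  replace (Finite 0) with (Rbar_mult R0 0) by (simpl; f_equal; ring).
  apply is_lim_seq_scal_l.
  apply (is_lim_seq_incr_1 (fun n => / INR n)).
  replace (Finite 0) with (Rbar_inv p_infty) by reflexivity.
  apply is_lim_seq_inv; [apply is_lim_seq_INR|discriminate].
Qed.

Lemma step_opp_lim : is_lim_seq (fun n => - h n) 0.
Proof.
  replace (Finite 0) with (Rbar_opp 0) by (simpl; f_equal; ring).
  apply (is_lim_seq_opp h 0), step_lim.
Qed.

(** Translating the integral moves the difference quotient from [U] to the test function [a], where
    the limit can be taken; [U] only has to be continuous. *)
Lemma integration_by_parts_x (U a ax : R -> R -> R) :
  continuous2 U -> continuous2 a -> continuous2 ax ->
  (forall x y, is_derive (fun t => a t y) x (ax x y)) ->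
  (forall x y, R0 <= Rabs x -> a x y = 0) ->
  is_lim_seq (fun n => RInt2 (fun x y => (U (x + h n) y - U x y) / h n * a x y) (- (3 * R0)) (3 * R0))
    (- RInt2 (fun x y => U x y * ax x y) (- (3 * R0)) (3 * R0)).
Proof.
  intros HU Ha Hax Hd Hs.
  assert (Hle : - (3 * R0) <= 3 * R0) by lra.
  destruct (continuous2_bounded U (- (4 * R0)) (4 * R0) HU) as [N1 [HN1 HU1]].
  destruct (continuous2_bounded ax (- (4 * R0)) (4 * R0) Hax) as [N2 [HN2 Hax2]].
  apply is_lim_seq_ext with (fun n =>
    RInt2 (fun x y => U x y * ((a (x + - h n) y - a x y) / h n + ax x y)) (- (3 * R0)) (3 * R0)
    - RInt2 (fun x y => U x y * ax x y) (- (3 * R0)) (3 * R0)).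
  { intros n. pose proof (step_bounds n) as Hh.
    rewrite <- RInt2_minus by (auto; unfold Rdiv; continuous2_tac).
    transitivity (RInt2 (fun x y => / h n * (U x y * a (x + - h n) y)) (- (3 * R0)) (3 * R0)
       - RInt2 (fun x y => / h n * (U x y * a x y)) (- (3 * R0)) (3 * R0)).
    - rewrite <- RInt2_minus by (auto; continuous2_tac).
      apply RInt2_ext; auto. intros x y _ _. field. lra.
    (* The translated product vanishes for [|x| >= R0 + h n], so [B = R0 + 2 * h n] works. As
       [h n <= R0], this is at most [3 * R0], which is why the square has that half-side. *)
    - rewrite <- (RInt2_shift_x (fun x y => / h n * (U x y * a (x + - h n) y)) (3 * R0) (R0 + 2 * h n) (h n)).
      + rewrite <- RInt2_minus by (auto; continuous2_tac).
        apply RInt2_ext; auto. intros x y _ _. replace (x + h n + - h n) with x by ring.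
        field. lra.
      + continuous2_tac.
      + lra.
      + rewrite Rabs_pos_eq; lra.
      + intros x y Hx. rewrite (Rabs_pos_eq (h n)) in Hx by lra.
        rewrite Hs; [ring|]. unfold Rabs in *. destruct (Rcase_abs x), (Rcase_abs (x + - h n)); lra. }
  replace (Finite (- RInt2 (fun x y => U x y * ax x y) (- (3 * R0)) (3 * R0)))
    with (Rbar_minus 0 (RInt2 (fun x y => U x y * ax x y) (- (3 * R0)) (3 * R0)))
    by (simpl; f_equal; ring).
  apply is_lim_seq_minus'; [|apply is_lim_seq_const].
  apply bounded_convergence2 with (N1 * (N2 + N2)); auto.
  - intros n. pose proof (step_bounds n) as Hh. unfold Rdiv. continuous2_tac.
  - intros n x y Hx Hy. pose proof (step_bounds n) as Hh. rewrite Rabs_mult.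
    apply Rmult_le_compat; try apply Rabs_pos; [apply HU1; lra|].
    apply Rle_trans with (1 := Rabs_triang _ _).
    apply Rplus_le_compat; [|apply Hax2; lra].
    unfold Rdiv. rewrite Rabs_mult, (Rabs_pos_eq (/ h n)) by (apply Rlt_le, Rinv_0_lt_compat; lra).
    apply Rmult_le_reg_r with (h n); [lra|]. rewrite Rmult_assoc, Rinv_l, Rmult_1_r by lra.
    replace (h n) with (Rabs (x + - h n - x)) at 2.
    2:{ replace (x + - h n - x) with (- h n) by ring. rewrite Rabs_Ropp. apply Rabs_pos_eq; lra. }
    apply (mvt_bound (fun t => a t y)). intros t Ht. exists (ax t y). split; [apply Hd|].
    rewrite Rmin_right, Rmax_left in Ht by lra. apply Hax2; lra.
  - intros x y _ _.
    apply is_lim_seq_ext with (fun n => U x y * (ax x y - (a (x + - h n) y - a x y) / (- h n))).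
    { intros n. pose proof (step_bounds n). field. lra. }
    replace (Finite 0) with (Rbar_mult (U x y) (Rbar_minus (ax x y) (ax x y)))
      by (simpl; f_equal; ring).
    apply is_lim_seq_scal_l. apply is_lim_seq_minus'; [apply is_lim_seq_const|].
    apply (is_derive_quotient_lim (fun t => a t y) x (ax x y) (fun n => - h n)).
    + apply Hd.
    + intros n. pose proof (step_bounds n). lra.
    + apply step_opp_lim.
Qed.

Lemma integration_by_parts_y (U a ay : R -> R -> R) :
  continuous2 U -> continuous2 a -> continuous2 ay ->
  (forall x y, is_derive (fun t => a x t) y (ay x y)) ->
  (forall x y, R0 <= Rabs y -> a x y = 0) ->
  is_lim_seq (fun n => RInt2 (fun x y => (U x (y + h n) - U x y) / h n * a x y) (- (3 * R0)) (3 * R0))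
    (- RInt2 (fun x y => U x y * ay x y) (- (3 * R0)) (3 * R0)).
Proof.
  intros HU Ha Hax Hd Hs.
  assert (Hle : - (3 * R0) <= 3 * R0) by lra.
  destruct (continuous2_bounded U (- (4 * R0)) (4 * R0) HU) as [N1 [HN1 HU1]].
  destruct (continuous2_bounded ay (- (4 * R0)) (4 * R0) Hax) as [N2 [HN2 Hax2]].
  apply is_lim_seq_ext with (fun n =>
    RInt2 (fun x y => U x y * ((a x (y + - h n) - a x y) / h n + ay x y)) (- (3 * R0)) (3 * R0)
    - RInt2 (fun x y => U x y * ay x y) (- (3 * R0)) (3 * R0)).
  { intros n. pose proof (step_bounds n) as Hh.
    rewrite <- RInt2_minus by (auto; unfold Rdiv; continuous2_tac).
    transitivity (RInt2 (fun x y => / h n * (U x y * a x (y + - h n))) (- (3 * R0)) (3 * R0)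
       - RInt2 (fun x y => / h n * (U x y * a x y)) (- (3 * R0)) (3 * R0)).
    - rewrite <- RInt2_minus by (auto; continuous2_tac).
      apply RInt2_ext; auto. intros x y _ _. field. lra.
    - rewrite <- (RInt2_shift_y (fun x y => / h n * (U x y * a x (y + - h n))) (3 * R0) (R0 + 2 * h n) (h n)).
      + rewrite <- RInt2_minus by (auto; continuous2_tac).
        apply RInt2_ext; auto. intros x y _ _. replace (y + h n + - h n) with y by ring.
        field. lra.
      + continuous2_tac.
      + lra.
      + rewrite Rabs_pos_eq; lra.
      + intros x y Hy. rewrite (Rabs_pos_eq (h n)) in Hy by lra.
        rewrite Hs; [ring|]. unfold Rabs in *. destruct (Rcase_abs y), (Rcase_abs (y + - h n)); lra. }
  replace (Finite (- RInt2 (fun x y => U x y * ay x y) (- (3 * R0)) (3 * R0)))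
    with (Rbar_minus 0 (RInt2 (fun x y => U x y * ay x y) (- (3 * R0)) (3 * R0)))
    by (simpl; f_equal; ring).
  apply is_lim_seq_minus'; [|apply is_lim_seq_const].
  apply bounded_convergence2 with (N1 * (N2 + N2)); auto.
  - intros n. pose proof (step_bounds n) as Hh. unfold Rdiv. continuous2_tac.
  - intros n x y Hx Hy. pose proof (step_bounds n) as Hh. rewrite Rabs_mult.
    apply Rmult_le_compat; try apply Rabs_pos; [apply HU1; lra|].
    apply Rle_trans with (1 := Rabs_triang _ _).
    apply Rplus_le_compat; [|apply Hax2; lra].
    unfold Rdiv. rewrite Rabs_mult, (Rabs_pos_eq (/ h n)) by (apply Rlt_le, Rinv_0_lt_compat; lra).
    apply Rmult_le_reg_r with (h n); [lra|]. rewrite Rmult_assoc, Rinv_l, Rmult_1_r by lra.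
    replace (h n) with (Rabs (y + - h n - y)) at 2.
    2:{ replace (y + - h n - y) with (- h n) by ring. rewrite Rabs_Ropp. apply Rabs_pos_eq; lra. }
    apply (mvt_bound (fun t => a x t)). intros t Ht. exists (ay x t). split; [apply Hd|].
    rewrite Rmin_right, Rmax_left in Ht by lra. apply Hax2; lra.
  - intros x y _ _.
    apply is_lim_seq_ext with (fun n => U x y * (ay x y - (a x (y + - h n) - a x y) / (- h n))).
    { intros n. pose proof (step_bounds n). field. lra. }
    replace (Finite 0) with (Rbar_mult (U x y) (Rbar_minus (ay x y) (ay x y)))
      by (simpl; f_equal; ring).
    apply is_lim_seq_scal_l. apply is_lim_seq_minus'; [apply is_lim_seq_const|].
    apply (is_derive_quotient_lim (fun t => a x t) y (ay x y) (fun n => - h n)).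
    + apply Hd.
    + intros n. pose proof (step_bounds n). lra.
    + apply step_opp_lim.
Qed.

(** One sequence of integrals has two limits. Integration by parts gives the combination of the four
    integrals; bounded convergence gives 0, since the quotients stay below [N] and tend pointwise to
    [U_x - V_y] and [V_x + U_y]. *)
Lemma cauchy_riemann_weak (U V a ax ay b bx by_ : R -> R -> R) (N : R) :
  continuous2 U -> continuous2 V ->
  continuous2 a -> continuous2 ax -> continuous2 ay ->
  continuous2 b -> continuous2 bx -> continuous2 by_ ->
  (forall x y, is_derive (fun t => a t y) x (ax x y)) ->
  (forall x y, is_derive (fun t => a x t) y (ay x y)) ->
  (forall x y, is_derive (fun t => b t y) x (bx x y)) ->
  (forall x y, is_derive (fun t => b x t) y (by_ x y)) ->
  (forall x y, R0 <= Rabs x \/ R0 <= Rabs y -> a x y = 0 /\ b x y = 0) ->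
  (forall x y, Rabs x < 3 * R0 -> Rabs y < 3 * R0 -> cauchy_riemann U V N x y) ->
  RInt2 (fun x y => U x y * ax x y) (- (3 * R0)) (3 * R0)
  + RInt2 (fun x y => U x y * by_ x y) (- (3 * R0)) (3 * R0)
  = RInt2 (fun x y => V x y * ay x y) (- (3 * R0)) (3 * R0)
  - RInt2 (fun x y => V x y * bx x y) (- (3 * R0)) (3 * R0).
Proof.
  intros HU HV Ha Hax Hay Hb Hbx Hby Dax Day Dbx Dby Hs HCR.
  assert (Hle : - (3 * R0) <= 3 * R0) by lra.
  pose proof (integration_by_parts_x U a ax HU Ha Hax Dax (fun x y H => proj1 (Hs x y (or_introl H)))) as L1.
  pose proof (integration_by_parts_y V a ay HV Ha Hay Day (fun x y H => proj1 (Hs x y (or_intror H)))) as L2.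
  pose proof (integration_by_parts_x V b bx HV Hb Hbx Dbx (fun x y H => proj2 (Hs x y (or_introl H)))) as L3.
  pose proof (integration_by_parts_y U b by_ HU Hb Hby Dby (fun x y H => proj2 (Hs x y (or_intror H)))) as L4.
  pose proof (is_lim_seq_plus' _ _ _ _ (is_lim_seq_minus' _ _ _ _ L1 L2) (is_lim_seq_plus' _ _ _ _ L3 L4)) as L.
  clear L1 L2 L3 L4.
  destruct (continuous2_bounded a (- (3 * R0)) (3 * R0) Ha) as [Na [HNa Ba]].
  destruct (continuous2_bounded b (- (3 * R0)) (3 * R0) Hb) as [Nb [HNb Bb]].
  assert (HN : 0 <= N).
  { destruct (HCR 0 0) as (p & q & _ & _ & _ & _ & Hp & _); try (rewrite Rabs_R0; lra).
    pose proof (Rabs_pos p). lra. }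
  assert (L0 : is_lim_seq (fun n => RInt2 (fun x y =>
      ((U (x + h n) y - U x y) / h n - (V x (y + h n) - V x y) / h n) * a x y
     + ((V (x + h n) y - V x y) / h n + (U x (y + h n) - U x y) / h n) * b x y)
     (- (3 * R0)) (3 * R0)) 0).
  { apply bounded_convergence2 with ((N + N) * Na + (N + N) * Nb); auto.
    - intros n. unfold Rdiv. continuous2_tac.
    - intros n x y Hx Hy.
      destruct (classic (R0 <= Rabs x \/ R0 <= Rabs y)) as [Ho|Hi].
      + destruct (Hs x y Ho) as [-> ->]. rewrite !Rmult_0_r, Rplus_0_r, Rabs_R0.
        assert (0 <= (N + N) * Na) by (apply Rmult_le_pos; lra).
        assert (0 <= (N + N) * Nb) by (apply Rmult_le_pos; lra). lra.
      + assert (Hxi : Rabs x < R0) by (apply Rnot_le_lt; tauto).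
        assert (Hyi : Rabs y < R0) by (apply Rnot_le_lt; tauto).
        pose proof (step_bounds n) as Hh. apply Rabs_lt_between in Hxi, Hyi.
        assert (Q : forall f : R -> R,
          forall z, (forall t, z <= t <= z + h n -> exists d, is_derive f t d /\ Rabs d <= N) ->
            Rabs ((f (z + h n) - f z) / h n) <= N).
        { intros f z Hf. unfold Rdiv.
          rewrite Rabs_mult, (Rabs_pos_eq (/ h n)) by (apply Rlt_le, Rinv_0_lt_compat; lra).
          apply Rmult_le_reg_r with (h n); [lra|]. rewrite Rmult_assoc, Rinv_l, Rmult_1_r by lra.
          replace (h n) with (Rabs (z + h n - z)) at 2.
          2:{ replace (z + h n - z) with (h n) by ring. apply Rabs_pos_eq; lra. }
          apply mvt_bound. intros t Ht. rewrite Rmin_left, Rmax_right in Ht by lra. now apply Hf. }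
        assert (Hd : forall x' y', - R0 < x' < 2 * R0 -> - R0 < y' < 2 * R0 -> cauchy_riemann U V N x' y').
        { intros x' y' Hx' Hy'. apply HCR; apply Rabs_lt_between; lra. }
        assert (Q1 : Rabs ((U (x + h n) y - U x y) / h n) <= N).
        { apply (Q (fun t => U t y)); auto. intros t Ht.
          destruct (Hd t y) as (p & q & H1 & H2 & H3 & H4 & H5 & H6); try lra. eauto. }
        assert (Q2 : Rabs ((V x (y + h n) - V x y) / h n) <= N).
        { apply (Q (fun t => V x t)); auto. intros t Ht.
          destruct (Hd x t) as (p & q & H1 & H2 & H3 & H4 & H5 & H6); try lra. eauto. }
        assert (Q3 : Rabs ((V (x + h n) y - V x y) / h n) <= N).
        { apply (Q (fun t => V t y)); auto. intros t Ht.
          destruct (Hd t y) as (p & q & H1 & H2 & H3 & H4 & H5 & H6); try lra. eauto. }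
        assert (Q4 : Rabs ((U x (y + h n) - U x y) / h n) <= N).
        { apply (Q (fun t => U x t)); auto. intros t Ht.
          destruct (Hd x t) as (p & q & H1 & H2 & H3 & H4 & H5 & H6); try lra.
          exists (- q). rewrite Rabs_Ropp. auto. }
        apply Rle_trans with (1 := Rabs_triang _ _). rewrite !Rabs_mult.
        apply Rplus_le_compat; apply Rmult_le_compat; try apply Rabs_pos; auto.
        * unfold Rminus at 1. apply Rle_trans with (1 := Rabs_triang _ _). rewrite Rabs_Ropp. lra.
        * apply Rle_trans with (1 := Rabs_triang _ _). lra.
    - intros x y Hx Hy.
      destruct (classic (R0 <= Rabs x \/ R0 <= Rabs y)) as [Ho|Hi].
      + destruct (Hs x y Ho) as [-> ->]. apply is_lim_seq_ext with (fun _ => 0).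
        { intros n. ring. } apply is_lim_seq_const.
      + destruct (HCR x y) as (p & q & H1 & H2 & H3 & H4 & H5 & H6).
        { apply Rlt_trans with R0; [apply Rnot_le_lt; tauto|lra]. }
        { apply Rlt_trans with R0; [apply Rnot_le_lt; tauto|lra]. }
        assert (Hn0 : forall n, h n <> 0) by (intros n; pose proof (step_bounds n); lra).
        replace (Finite 0) with (Finite ((p - p) * a x y + (q + - q) * b x y)) by (f_equal; ring).
        apply is_lim_seq_plus'; apply is_lim_seq_mult'; try apply is_lim_seq_const.
        * apply is_lim_seq_minus'.
          -- now apply (is_derive_quotient_lim (fun t => U t y)), step_lim.
          -- now apply (is_derive_quotient_lim (fun t => V x t)), step_lim.
        * apply is_lim_seq_plus'.
          -- now apply (is_derive_quotient_lim (fun t => V t y)), step_lim.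
          -- now apply (is_derive_quotient_lim (fun t => U x t)), step_lim. }
  assert (E : is_lim_seq (fun n => RInt2 (fun x y =>
      ((U (x + h n) y - U x y) / h n - (V x (y + h n) - V x y) / h n) * a x y
     + ((V (x + h n) y - V x y) / h n + (U x (y + h n) - U x y) / h n) * b x y)
     (- (3 * R0)) (3 * R0)) 
     (- RInt2 (fun x y => U x y * ax x y) (- (3 * R0)) (3 * R0) -
         - RInt2 (fun x y => V x y * ay x y) (- (3 * R0)) (3 * R0) +
         (- RInt2 (fun x y => V x y * bx x y) (- (3 * R0)) (3 * R0) +
          - RInt2 (fun x y => U x y * by_ x y) (- (3 * R0)) (3 * R0)))).
  { apply is_lim_seq_ext with (2 := L). intros n.
    rewrite <- !RInt2_plus, <- RInt2_minus by (auto; unfold Rdiv; continuous2_tac).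
    rewrite <- RInt2_plus by (auto; unfold Rdiv; continuous2_tac).
    apply RInt2_ext; auto. intros x y _ _. ring. }
  apply is_lim_seq_unique in L0. apply is_lim_seq_unique in E.
  rewrite E in L0. injection L0. intros H. lra.
Qed.
End Weak.

(** Squaring removes the corner of the positive part, so the squared cutoff below is continuously
    differentiable across the circle of radius [R0]. *)
Lemma is_derive_pos_part_sq (u : R) : is_derive (fun t => Rmax t 0 * Rmax t 0) u (2 * Rmax u 0).
Proof.
  apply is_derive_Reals. intros eps Heps. exists (mkposreal eps Heps). intros h Hh Hb. simpl in Hb.
  apply Rle_lt_trans with (2 := Hb).
  replace ((Rmax (u + h) 0 * Rmax (u + h) 0 - Rmax u 0 * Rmax u 0) / h - 2 * Rmax u 0)
    with ((Rmax (u + h) 0 * Rmax (u + h) 0 - Rmax u 0 * Rmax u 0 - 2 * Rmax u 0 * h) * / h)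
    by (field; exact Hh).
  rewrite Rabs_mult, Rabs_inv.
  assert (Hp : 0 < Rabs h) by now apply Rabs_pos_lt.
  apply Rmult_le_reg_r with (Rabs h); [exact Hp|].
  rewrite Rmult_assoc, Rinv_l, Rmult_1_r by lra.
  replace (Rabs h * Rabs h) with (h * h) by (rewrite <- Rabs_mult; symmetry; apply Rabs_pos_eq; nra).
  apply Rabs_le. unfold Rmax. destruct (Rle_dec (u + h) 0), (Rle_dec u 0); nra.
Qed.

(** * A radial kernel concentrating at the origin *)

Section TestFunction.
Variables R0 s : R.
Hypothesis HR0 : 0 < R0.
Hypothesis Hs : 0 < s.

Let q (x y : R) : R := Rmax (R0 * R0 - (x * x + y * y)) 0.
Let rs (x y : R) : R := x * x + y * y + s.

Lemma shifted_sq_pos x y : 0 < rs x y.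
Proof. unfold rs. nra. Qed.

Lemma cutoff_continuous : continuous2 q.
Proof. unfold q. continuous2_tac. Qed.

Lemma shifted_sq_continuous : continuous2 rs.
Proof. unfold rs. continuous2_tac. Qed.

Lemma cutoff_outside x y : R0 <= Rabs x \/ R0 <= Rabs y -> q x y = 0.
Proof.
  intros H. unfold q. apply Rmax_right.
  assert (Hsq : forall t, R0 <= Rabs t -> R0 * R0 <= t * t).
  { intros t Ht. replace (t * t) with (Rabs t * Rabs t) by (rewrite <- Rabs_mult; apply Rabs_pos_eq; nra).
    nra. }
  destruct H as [H|H]; apply Hsq in H; nra.
Qed.

Lemma kernel_derive_radial (w z : R) : z * z + w + s <> 0 -> is_derive
  (fun t => Rmax (R0 * R0 - (t * t + w)) 0 * Rmax (R0 * R0 - (t * t + w)) 0 / (t * t + w + s)) z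
  (- 4 * z * Rmax (R0 * R0 - (z * z + w)) 0 / (z * z + w + s)
   - 2 * z * (Rmax (R0 * R0 - (z * z + w)) 0 * Rmax (R0 * R0 - (z * z + w)) 0)
      / ((z * z + w + s) * (z * z + w + s))).
Proof.
  intros H0.
  eapply is_derive_val.
  - apply (is_derive_div (fun t => Rmax (R0 * R0 - (t * t + w)) 0 * Rmax (R0 * R0 - (t * t + w)) 0)
      (fun t => t * t + w + s) z); [|auto_derive; [exact I|reflexivity]|exact H0].
    apply (is_derive_comp (fun u => Rmax u 0 * Rmax u 0) (fun t => R0 * R0 - (t * t + w)) z).
    + apply is_derive_pos_part_sq.
    + auto_derive; [exact I|reflexivity].
  - unfold scal; simpl; unfold mult; simpl. field. exact H0.
Qed.

Let kd (x y : R) : R :=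
  - 4 * x * q x y / rs x y - 2 * x * (q x y * q x y) / (rs x y * rs x y).
(** The shift [s] regularizes the singular radial kernel [q^2 / |z|^2] at the origin. *)
Let k (x y : R) : R := q x y * q x y / rs x y.

Lemma kernel_derive_x x y : is_derive (fun t => k t y) x (kd x y).
Proof.
  apply (kernel_derive_radial (y * y) x). apply Rgt_not_eq, shifted_sq_pos.
Qed.

Lemma kernel_sym x y : k x y = k y x.
Proof. unfold k, q, rs. now rewrite (Rplus_comm (x * x)). Qed.

Lemma kernel_derive_y x y : is_derive (fun t => k x t) y (kd y x).
Proof. apply is_derive_ext with (fun t => k t x); [intros t; apply kernel_sym|apply kernel_derive_x]. Qed.

Lemma kernel_continuous : continuous2 k.
Proof.
  pose proof cutoff_continuous. pose proof shifted_sq_continuous. unfold k. continuous2_tac.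
  intros x y. now apply Rgt_not_eq, shifted_sq_pos.
Qed.

Lemma kernel_partial_continuous : continuous2 kd.
Proof.
  pose proof cutoff_continuous. pose proof shifted_sq_continuous.
  unfold kd. continuous2_tac; intros x y; apply Rgt_not_eq; [apply shifted_sq_pos|].
  apply Rmult_lt_0_compat; apply shifted_sq_pos.
Qed.

(** Take [a = x k] and [b = y k]. As [k] is radial, [a_y - b_x = 0] and [V] cancels, while [a_x +
    b_y = 2 (s q^2 / rs^2 - 2 |z|^2 q / rs)]. As [s] tends to 0 the first weight concentrates at the
    origin and the second tends to [2 q]: this is a mean value property in regularized form. *)
Lemma mean_identity (U V : R -> R -> R) (N : R) :
  continuous2 U -> continuous2 V ->
  (forall x y, Rabs x < 3 * R0 -> Rabs y < 3 * R0 -> cauchy_riemann U V N x y) ->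
  RInt2 (fun x y => U x y * (s * (q x y * q x y) / (rs x y * rs x y))) (- (3 * R0)) (3 * R0)
  = RInt2 (fun x y => U x y * (2 * (x * x + y * y) * q x y / rs x y)) (- (3 * R0)) (3 * R0).
Proof.
  intros HU HV HCR.
  pose proof cutoff_continuous as Hq. pose proof shifted_sq_continuous as Hrs. pose proof kernel_continuous as Hk. pose proof kernel_partial_continuous as Hkd.
  assert (Hkd' : continuous2 (fun x y => kd y x)) by continuous2_tac.
  assert (Hle : - (3 * R0) <= 3 * R0) by lra.
  assert (H : 
    RInt2 (fun x y => U x y * (k x y + x * kd x y)) (- (3 * R0)) (3 * R0)
  + RInt2 (fun x y => U x y * (k x y + y * kd y x)) (- (3 * R0)) (3 * R0)
  = RInt2 (fun x y => V x y * (x * kd y x)) (- (3 * R0)) (3 * R0)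
  - RInt2 (fun x y => V x y * (y * kd x y)) (- (3 * R0)) (3 * R0)).
  { apply (cauchy_riemann_weak R0 HR0 U V (fun x y => x * k x y) (fun x y => k x y + x * kd x y)
      (fun x y => x * kd y x) (fun x y => y * k x y) (fun x y => y * kd x y)
      (fun x y => k x y + y * kd y x) N); auto; try (continuous2_tac; fail).
    - intros x y. eapply is_derive_val.
      + apply (is_derive_mult (fun t => t) (fun t => k t y) x).
        * apply (is_derive_id (K := R_AbsRing)).
        * apply kernel_derive_x.
        * intros; apply Rmult_comm.
      + unfold plus, mult, one; simpl. ring.
    - intros x y. apply (is_derive_scal (fun t => k x t) y x). apply kernel_derive_y.
    - intros x y. apply (is_derive_scal (fun t => k t y) x y). apply kernel_derive_x.
    - intros x y. eapply is_derive_val.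
      + apply (is_derive_mult (fun t => t) (fun t => k x t) y).
        * apply (is_derive_id (K := R_AbsRing)).
        * apply kernel_derive_y.
        * intros; apply Rmult_comm.
      + unfold plus, mult, one; simpl. ring.
    - intros x y Ho. unfold k. rewrite (cutoff_outside x y Ho). unfold Rdiv. split; ring. }
  assert (Hsym : forall x y, q y x = q x y /\ rs y x = rs x y).
  { intros x y. unfold q, rs. now rewrite (Rplus_comm (y * y)). }
  assert (E : RInt2 (fun x y => V x y * (x * kd y x)) (- (3 * R0)) (3 * R0)
            = RInt2 (fun x y => V x y * (y * kd x y)) (- (3 * R0)) (3 * R0)).
  { apply RInt2_ext; auto. intros x y _ _. unfold kd.
    destruct (Hsym x y) as [-> ->]. pose proof (shifted_sq_pos x y). field. lra. }
  rewrite E, Rminus_diag, <- RInt2_plus in H by (auto; continuous2_tac).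
  assert (E2 : RInt2 (fun x y => U x y * (k x y + x * kd x y) + U x y * (k x y + y * kd y x)) (- (3 * R0)) (3 * R0)
    = 2 * (RInt2 (fun x y => U x y * (s * (q x y * q x y) / (rs x y * rs x y))) (- (3 * R0)) (3 * R0)
  - RInt2 (fun x y => U x y * (2 * (x * x + y * y) * q x y / rs x y)) (- (3 * R0)) (3 * R0))).
  { assert (Hn : forall x y, rs x y <> 0) by (intros x y; now apply Rgt_not_eq, shifted_sq_pos).
    assert (Hn2 : forall x y, rs x y * rs x y <> 0) by (intros x y; now apply Rmult_integral_contrapositive).
    rewrite <- RInt2_minus, <- RInt2_scal by (auto; continuous2_tac).
    apply RInt2_ext; auto. intros x y _ _. unfold kd, k.
    destruct (Hsym x y) as [-> ->]. specialize (Hn x y). 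
    replace (x * x + y * y) with (rs x y - s) by (unfold rs; ring).
    transitivity (U x y * (2 * (q x y * q x y) / rs x y - 4 * (x * x + y * y) * q x y / rs x y
       - 2 * (x * x + y * y) * (q x y * q x y) / (rs x y * rs x y))); [field; exact Hn|].
    replace (x * x + y * y) with (rs x y - s) by (unfold rs; ring). field. exact Hn. }
  lra.
Qed.
End TestFunction.

(** * Absence of Gaussian peaks *)

(** Apply the mean identity to [G = 1 - U], which is nonnegative and vanishes only at the origin.
    For small [s] the concentrating side is at most [c0 / 2], because [G] is small near the origin,
    while the other side stays above [c0 > 0]. *)
Lemma no_gaussian_peak_global (U V : R -> R -> R) (N R0 eps : R) :
  0 < R0 -> 0 < eps -> continuous2 U -> continuous2 V ->
  (forall x y, Rabs x < 3 * R0 -> Rabs y < 3 * R0 -> cauchy_riemann U V N x y) ->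
  U 0 0 = 1 ->
  (forall x y, Rabs x <= 3 * R0 -> Rabs y <= 3 * R0 -> U x y <= exp (- eps * (x * x + y * y))) ->
  False.
Proof.
  intros HR0 Heps HU HV HCR H1 Hpeak.
  assert (Hle : - (3 * R0) <= 3 * R0) by lra.
  set (G := fun x y => 1 - U x y).
  assert (HG : continuous2 G) by (unfold G; continuous2_tac).
  assert (HGlow : forall x y, - (3 * R0) <= x <= 3 * R0 -> - (3 * R0) <= y <= 3 * R0 ->
     1 - exp (- eps * (x * x + y * y)) <= G x y).
  { intros x y Hx Hy. unfold G. specialize (Hpeak x y). apply Rabs_le in Hx, Hy. specialize (Hpeak Hx Hy). lra. }
  assert (HG0 : forall x y, - (3 * R0) <= x <= 3 * R0 -> - (3 * R0) <= y <= 3 * R0 -> 0 <= G x y).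
  { intros x y Hx Hy. apply Rle_trans with (2 := HGlow x y Hx Hy).
    assert (exp (- eps * (x * x + y * y)) <= exp 0); [|rewrite exp_0 in *; lra].
    destruct (Req_dec (- eps * (x * x + y * y)) 0) as [->|Hne]; [lra|].
    apply Rlt_le, exp_increasing. assert (0 <= eps * (x * x + y * y)) by nra. lra. }
  destruct (continuous2_bounded G (- (3 * R0)) (3 * R0) HG) as [B [HB0 HB]].
  set (q := fun x y => Rmax (R0 * R0 - (x * x + y * y)) 0).
  assert (Hq : continuous2 q) by (unfold q; continuous2_tac).
  assert (Hq0 : forall x y, 0 <= q x y) by (intros; apply Rmax_r).
  assert (Hrs : forall s, continuous2 (fun x y => x * x + y * y + s)) by (intros; continuous2_tac).
  assert (Hrsp : forall s, 0 < s -> forall x y, 0 < x * x + y * y + s) by (intros; nra).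
  assert (Hm : forall s U' V' N', 0 < s -> continuous2 U' -> continuous2 V' ->
    (forall x y, Rabs x < 3 * R0 -> Rabs y < 3 * R0 -> cauchy_riemann U' V' N' x y) ->
    RInt2 (fun x y => U' x y * (s * (q x y * q x y) / ((x * x + y * y + s) * (x * x + y * y + s)))) (- (3 * R0)) (3 * R0)
  = RInt2 (fun x y => U' x y * (2 * (x * x + y * y) * q x y / (x * x + y * y + s))) (- (3 * R0)) (3 * R0)).
  { intros s U' V' N' Hs. exact (mean_identity R0 s HR0 Hs U' V' N'). }
  assert (HmG : forall s, 0 < s ->
    RInt2 (fun x y => G x y * (s * (q x y * q x y) / ((x * x + y * y + s) * (x * x + y * y + s)))) (- (3 * R0)) (3 * R0)
  = RInt2 (fun x y => G x y * (2 * (x * x + y * y) * q x y / (x * x + y * y + s))) (- (3 * R0)) (3 * R0)).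
  { intros s Hs. apply (Hm s G (fun x y => - V x y) N); auto; [continuous2_tac|].
    intros x y Hx Hy. destruct (HCR x y Hx Hy) as (p & r & D1 & D2 & D3 & D4 & D5 & D6).
    exists (- p), (- r). unfold G. split; [|split; [|split; [|split; [|split]]]].
    - eapply is_derive_val; [apply (is_derive_minus (V := R_NormedModule) (fun _ => 1) (fun t => U t y) x 0 p); [apply (is_derive_const (V := R_NormedModule))|exact D1]|].
      unfold minus, plus, opp; simpl. ring.
    - now apply (is_derive_opp (V := R_NormedModule) (fun t => V t y)).
    - eapply is_derive_val; [apply (is_derive_minus (V := R_NormedModule) (fun _ => 1) (fun t => U x t) y 0 (- r)); [apply (is_derive_const (V := R_NormedModule))|exact D3]|].
      unfold minus, plus, opp; simpl. ring.
    - now apply (is_derive_opp (V := R_NormedModule) (fun t => V x t)).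
    - now rewrite Rabs_Ropp.
    - now rewrite Rabs_Ropp. }
  (* The identity for the constant 1 will bound the mass of the concentrating kernel by [C],
     uniformly in [s], without evaluating an integral. *)
  assert (Hm1 : forall s, 0 < s ->
    RInt2 (fun x y => 1 * (s * (q x y * q x y) / ((x * x + y * y + s) * (x * x + y * y + s)))) (- (3 * R0)) (3 * R0)
  = RInt2 (fun x y => 1 * (2 * (x * x + y * y) * q x y / (x * x + y * y + s))) (- (3 * R0)) (3 * R0)).
  { intros s Hs. apply (Hm s (fun _ _ => 1) (fun _ _ => 0) 0); auto; try (continuous2_tac; fail).
    intros x y _ _. exists 0, 0. rewrite Ropp_0, Rabs_R0.
    split; [|split; [|split; [|split; [|split]]]]; first [lra|auto_derive; trivial; ring]. }
  assert (Cq : forall s, 0 < s -> continuous2 (fun x y => s * (q x y * q x y) / ((x * x + y * y + s) * (x * x + y * y + s)))).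
  { intros s Hs. continuous2_tac. intros x y. specialize (Hrsp s Hs x y). apply Rgt_not_eq. now apply Rmult_lt_0_compat. }
  assert (Cr : forall s, 0 < s -> continuous2 (fun x y => 2 * (x * x + y * y) * q x y / (x * x + y * y + s))).
  { intros s Hs. continuous2_tac. intros x y. apply Rgt_not_eq. now apply Hrsp. }
  (* This is the spread-out side at [s = 1]. Its integrand grows as [s] decreases, so [c0] is a
     lower bound for every [s <= 1]. *)
  set (c0 := RInt2 (fun x y => G x y * (2 * (x * x + y * y) * q x y / (x * x + y * y + 1))) (- (3 * R0)) (3 * R0)).
  assert (Hc0 : 0 < c0).
  { apply (RInt2_pos _ _ _ (R0 / 2) 0); try lra.
    - pose proof (Cr 1 Rlt_0_1). continuous2_tac.
    - intros x y Hx Hy. apply Rmult_le_pos; [now apply HG0|].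
      apply Rmult_le_pos; [|apply Rlt_le, Rinv_0_lt_compat, Hrsp; lra].
      apply Rmult_le_pos; [nra|apply Hq0].
    - apply Rmult_lt_0_compat.
      + apply Rlt_le_trans with (2 := HGlow (R0 / 2) 0 ltac:(lra) ltac:(lra)).
        assert (exp (- eps * (R0 / 2 * (R0 / 2) + 0 * 0)) < exp 0); [|rewrite exp_0 in *; lra].
        apply exp_increasing. assert (0 < eps * (R0 * R0)) by (repeat apply Rmult_lt_0_compat; auto). lra.
      + apply Rdiv_lt_0_compat; [|apply Hrsp; lra].
        unfold q. rewrite Rmax_left by nra. apply Rmult_lt_0_compat; nra. }
  set (C := RInt2 (fun x y => 2 * q x y) (- (3 * R0)) (3 * R0)).
  assert (HC : 0 <= C).
  { apply RInt2_ge_0; auto; [continuous2_tac|]. intros x y _ _. specialize (Hq0 x y). lra. }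
  set (D := RInt2 (fun x y => q x y * q x y) (- (3 * R0)) (3 * R0)).
  assert (HD : 0 <= D).
  { apply RInt2_ge_0; auto; [continuous2_tac|]. intros x y _ _. specialize (Hq0 x y). nra. }
  assert (HIC : forall s, 0 < s -> RInt2 (fun x y => s * (q x y * q x y) / ((x * x + y * y + s) * (x * x + y * y + s))) (- (3 * R0)) (3 * R0) <= C).
  { intros s Hs. specialize (Hm1 s Hs). specialize (Cr s Hs). specialize (Cq s Hs).
    apply Rle_trans with (RInt2 (fun x y => 1 * (s * (q x y * q x y) / ((x * x + y * y + s) * (x * x + y * y + s)))) (- (3 * R0)) (3 * R0)).
    - right. apply RInt2_ext; auto. intros; ring.
    - rewrite Hm1. apply RInt2_le; auto; [continuous2_tac|continuous2_tac|]. intros x y _ _.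
      specialize (Hrsp s Hs x y). specialize (Hq0 x y).
      rewrite Rmult_1_l. apply Rmult_le_reg_r with (x * x + y * y + s); auto.
      unfold Rdiv. rewrite Rmult_assoc, Rinv_l, Rmult_1_r by lra.
      assert (0 <= q x y * s) by (apply Rmult_le_pos; lra). nra. }
  set (eta := c0 / (4 * (C + 1))).
  assert (Heta : 0 < eta) by (unfold eta; apply Rdiv_lt_0_compat; lra).
  assert (HetaC : eta * C <= c0 / 4).
  { assert (eta * (C + 1) = c0 / 4) by (unfold eta; field; lra). nra. }
  (* Continuity at the origin gives [eta] near it, and [B / d^4] suffices elsewhere. The fourth
     power of [|z|] is chosen to cancel [(|z|^2 + s)^2] in the kernel, which leaves a term of order
     [s]. *)
  assert (HK : exists K, 0 <= K /\ forall x y, - (3 * R0) <= x <= 3 * R0 -> - (3 * R0) <= y <= 3 * R0 ->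
    G x y <= eta + K * ((x * x + y * y) * (x * x + y * y))).
  { destruct (HG 0 0 (mkposreal _ Heta)) as [d Hd]. simpl in Hd.
    assert (G00 : G 0 0 = 0) by (unfold G; lra). rewrite G00 in Hd.
    pose proof (cond_pos d) as Hdp.
    set (d4 := (d * d) * (d * d)).
    assert (Hd4 : 0 < d4) by (unfold d4; repeat apply Rmult_lt_0_compat; auto).
    exists (B / d4). assert (HBd : 0 <= B / d4) by (apply Rmult_le_pos; [lra|apply Rlt_le, Rinv_0_lt_compat, Hd4]).
    split; [exact HBd|]. intros x y Hx Hy.
    assert (Hr : 0 <= (x * x + y * y) * (x * x + y * y)) by nra.
    destruct (Rlt_dec (x * x + y * y) (d * d)) as [Hlt|Hge].
    - assert (Hxy : Rabs (x - 0) < d /\ Rabs (y - 0) < d).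
      { rewrite !Rminus_0_r. split; apply Rabs_lt_between; split; nra. }
      destruct Hxy as [Hx' Hy']. specialize (Hd x y Hx' Hy'). apply Rabs_lt_between in Hd.
      assert (0 <= B / d4 * ((x * x + y * y) * (x * x + y * y))) by (now apply Rmult_le_pos). lra.
    - apply Rnot_lt_le in Hge. specialize (HB x y Hx Hy). apply Rabs_le_between in HB.
      assert (B / d4 * d4 <= B / d4 * ((x * x + y * y) * (x * x + y * y))).
      { apply Rmult_le_compat_l; [exact HBd|]. unfold d4. apply Rmult_le_compat; nra. }
      replace (B / d4 * d4) with B in * by (field; lra). lra. }
  destruct HK as [K [HK0 HK]].
  set (s := Rmin 1 (c0 / (4 * (K * D + 1)))).
  assert (HKD : 0 <= K * D) by now apply Rmult_le_pos.
  assert (Hs : 0 < s) by (apply Rmin_pos; [lra|apply Rdiv_lt_0_compat; lra]).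
  assert (Hs1 : s <= 1) by apply Rmin_l.
  assert (HsD : s * (K * D) <= c0 / 4).
  { assert (Hs2 : s <= c0 / (4 * (K * D + 1))) by apply Rmin_r.
    assert (c0 / (4 * (K * D + 1)) * (K * D + 1) = c0 / 4) by (field; lra). nra. }
  specialize (HmG s Hs). specialize (HIC s Hs). pose proof (Cr s Hs) as Crs. pose proof (Cq s Hs) as Cqs.
  assert (L : c0 <= RInt2 (fun x y => G x y * (2 * (x * x + y * y) * q x y / (x * x + y * y + s))) (- (3 * R0)) (3 * R0)).
  { pose proof (Cr 1 Rlt_0_1) as Cr1. apply RInt2_le; auto; [continuous2_tac|continuous2_tac|]. intros x y Hx Hy.
    apply Rmult_le_compat_l; [now apply HG0|].
    apply Rmult_le_compat_l; [apply Rmult_le_pos; [nra|apply Hq0]|].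
    apply Rinv_le_contravar; [now apply Hrsp|lra]. }
  assert (Up : RInt2 (fun x y => G x y * (s * (q x y * q x y) / ((x * x + y * y + s) * (x * x + y * y + s)))) (- (3 * R0)) (3 * R0)
    <= RInt2 (fun x y => eta * (s * (q x y * q x y) / ((x * x + y * y + s) * (x * x + y * y + s)))
           + (s * K) * (q x y * q x y)) (- (3 * R0)) (3 * R0)).
  { apply RInt2_le; auto; [continuous2_tac|continuous2_tac|]. intros x y Hx Hy.
    specialize (HK x y Hx Hy). specialize (Hq0 x y). specialize (Hrsp s Hs x y).
    set (r := x * x + y * y) in *. assert (Hr : 0 <= r) by (unfold r; nra).
    set (w := s * (q x y * q x y) / ((r + s) * (r + s))).
    assert (Hw : w * ((r + s) * (r + s)) = s * (q x y * q x y)) by (unfold w; field; lra).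
    assert (Hw0 : 0 <= w).
    { unfold w. apply Rmult_le_pos; [apply Rmult_le_pos; nra|apply Rlt_le, Rinv_0_lt_compat; nra]. }
    apply Rle_trans with ((eta + K * (r * r)) * w); [now apply Rmult_le_compat_r|].
    replace (s * K * (q x y * q x y)) with (K * (w * ((r + s) * (r + s)))) by (rewrite Hw; ring).
    assert (K * (r * r * w) <= K * (w * ((r + s) * (r + s)))).
    { apply Rmult_le_compat_l; [exact HK0|]. rewrite (Rmult_comm w). apply Rmult_le_compat_r; [exact Hw0|nra]. }
    lra. }
  rewrite RInt2_plus, !RInt2_scal in Up by (auto; continuous2_tac).
  fold D in Up. assert (eta * RInt2 (fun x y => s * (q x y * q x y) / ((x * x + y * y + s) * (x * x + y * y + s))) (- (3 * R0)) (3 * R0) <= eta * C) by (apply Rmult_le_compat_l; lra).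
  lra.
Qed.

(** Composing with this retraction onto [[-c, c]] extends a function from a square to the whole
    plane continuously, as the integration lemmas require global continuity. *)
Definition clamp (c t : R) : R := Rmax (Rmin t c) (- c).

Lemma clamp_lipschitz c t u : Rabs (clamp c t - clamp c u) <= Rabs (t - u).
Proof.
  unfold clamp, Rmax, Rmin, Rabs.
  destruct (Rle_dec t c), (Rle_dec u c); repeat destruct Rle_dec; repeat destruct Rcase_abs; lra.
Qed.

Lemma clamp_bounds c t : 0 <= c -> - c <= clamp c t <= c.
Proof. intros Hc. unfold clamp, Rmax, Rmin. destruct (Rle_dec t c); repeat destruct Rle_dec; lra. Qed.

Lemma clamp_id c t : - c <= t <= c -> clamp c t = t.
Proof. intros H. unfold clamp. rewrite Rmin_left, Rmax_left; lra. Qed.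

Lemma no_gaussian_peak (U V : R -> R -> R) (N delta eps : R) :
  0 < delta -> 0 < eps ->
  (forall x y, Rabs x < delta -> Rabs y < delta -> cauchy_riemann U V N x y) ->
  U 0 0 = 1 ->
  (forall x y, Rabs x < delta -> Rabs y < delta -> U x y <= exp (- eps * (x * x + y * y))) ->
  False.
Proof.
  intros Hdelta Heps HCR H1 Hpeak.
  set (c := delta / 2). assert (Hc : 0 < c) by (unfold c; lra).
  assert (Hin : forall t, Rabs (clamp c t) < delta).
  { intros t. apply Rle_lt_trans with c; [|unfold c; lra]. apply Rabs_le, clamp_bounds; lra. }
  assert (Hseg : forall x u t, Rabs x < delta -> Rabs u < delta -> Rmin x u <= t <= Rmax x u -> Rabs t < delta).
  { intros x u t Hx Hu Ht. apply Rabs_lt_between in Hx, Hu. apply Rabs_lt_between.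
    unfold Rmin, Rmax in Ht. destruct (Rle_dec x u); lra. }
  (* Bounded partial derivatives make [W] Lipschitz on the square, moving along one coordinate at a
     time; the clamp does not increase distances. *)
  assert (Hcont : forall W : R -> R -> R,
    (forall x y, Rabs x < delta -> Rabs y < delta -> exists p q, 
       is_derive (fun t => W t y) x p /\ is_derive (fun t => W x t) y q /\ Rabs p <= N /\ Rabs q <= N) ->
    continuous2 (fun x y => W (clamp c x) (clamp c y))).
  { intros W HW x y e.
    assert (HN : 0 <= N).
    { destruct (HW 0 0) as (p & q & _ & _ & Hp & _); try (rewrite Rabs_R0; lra).
      pose proof (Rabs_pos p). lra. }
    assert (He : 0 < e / (2 * (N + 1))) by (apply Rdiv_lt_0_compat; [apply cond_pos|lra]).
    exists (mkposreal _ He). simpl. intros u v Hu Hv.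
    set (x' := clamp c x). set (y' := clamp c y). set (u' := clamp c u). set (v' := clamp c v).
    assert (A1 : Rabs (W u' v' - W x' v') <= N * Rabs (u' - x')).
    { apply (mvt_bound (fun t => W t v')). intros t Ht.
      destruct (HW t v') as (p & q & H2 & H3 & H4 & H5); [apply (Hseg x' u'); auto; apply Hin|apply Hin|].
      now exists p. }
    assert (A2 : Rabs (W x' v' - W x' y') <= N * Rabs (v' - y')).
    { apply (mvt_bound (fun t => W x' t)). intros t Ht.
      destruct (HW x' t) as (p & q & H2 & H3 & H4 & H5); [apply Hin|apply (Hseg y' v'); auto; apply Hin|].
      now exists q. }
    assert (B1 : Rabs (u' - x') <= Rabs (u - x)) by apply clamp_lipschitz.
    assert (B2 : Rabs (v' - y') <= Rabs (v - y)) by apply clamp_lipschitz.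
    replace (W u' v' - W x' y') with ((W u' v' - W x' v') + (W x' v' - W x' y')) by ring.
    apply Rle_lt_trans with (1 := Rabs_triang _ _).
    assert (Hid : e / (2 * (N + 1)) * (2 * (N + 1)) = e) by (field; lra).
    pose proof (cond_pos e). pose proof (Rabs_pos (u' - x')). pose proof (Rabs_pos (v' - y')).
    nra. }
  (* With [R0 = c / 4] the square of integration has half-side [3 c / 4 < c], so the clamp is the
     identity near each of its points and derivatives are unchanged. *)
  assert (Hloc : forall t, Rabs t < 3 * (c / 4) -> locally t (fun u => u = clamp c u)).
  { intros t Ht. apply Rabs_lt_between in Ht.
    assert (Hp : 0 < c / 4) by lra. exists (mkposreal _ Hp). intros u Hu.
    symmetry. apply clamp_id. apply Rabs_lt_between' in Hu. simpl in Hu. lra. }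
  apply (no_gaussian_peak_global (fun x y => U (clamp c x) (clamp c y))
     (fun x y => V (clamp c x) (clamp c y)) N (c / 4) eps); auto; try lra.
  - apply Hcont. intros x y Hx Hy. destruct (HCR x y Hx Hy) as (p & q & D1 & D2 & D3 & D4 & D5 & D6).
    exists p, (- q). rewrite Rabs_Ropp. auto.
  - apply Hcont. intros x y Hx Hy. destruct (HCR x y Hx Hy) as (p & q & D1 & D2 & D3 & D4 & D5 & D6).
    exists q, p. auto.
  - intros x y Hx Hy.
    assert (Hx' : Rabs x < delta) by (unfold c in Hx; lra).
    assert (Hy' : Rabs y < delta) by (unfold c in Hy; lra).
    assert (Ex : clamp c x = x) by (symmetry; apply (locally_singleton _ _ (Hloc x Hx))).
    assert (Ey : clamp c y = y) by (symmetry; apply (locally_singleton _ _ (Hloc y Hy))).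
    destruct (HCR x y Hx' Hy') as (p & q & D1 & D2 & D3 & D4 & D5 & D6).
    exists p, q. rewrite Ex, Ey.
    split; [|split; [|split; [|split; [|split; assumption]]]].
    + apply is_derive_ext_loc with (2 := D1). destruct (Hloc x Hx) as [e He]. exists e. intros t Ht. now rewrite <- (He t Ht).
    + apply is_derive_ext_loc with (2 := D2). destruct (Hloc x Hx) as [e He]. exists e. intros t Ht. now rewrite <- (He t Ht).
    + apply is_derive_ext_loc with (2 := D3). destruct (Hloc y Hy) as [e He]. exists e. intros t Ht. now rewrite <- (He t Ht).
    + apply is_derive_ext_loc with (2 := D4). destruct (Hloc y Hy) as [e He]. exists e. intros t Ht. now rewrite <- (He t Ht).
  - rewrite clamp_id by lra. exact H1.
  - intros x y Hx Hy. apply Rabs_le_between in Hx, Hy.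
    rewrite !clamp_id by lra. apply Hpeak; apply Rabs_lt_between; unfold c in *; lra.
Qed.

(** * Complex derivatives *)

Notation C := Complex.C.

Definition curve_deriv (g : R -> C) (t : R) (d : C) : Prop :=
  is_derive (fun s => fst (g s)) t (fst d) /\ is_derive (fun s => snd (g s)) t (snd d).

(** Only the two axis derivatives, tied by the Cauchy-Riemann equations; full complex
    differentiability is not implied. *)
Definition complex_deriv (f : C -> C) (z d : C) : Prop :=
  curve_deriv (fun t => f (t, snd z)) (fst z) d /\
  curve_deriv (fun t => f (fst z, t)) (snd z) (Ci * d)%C.

(** The working substitute for holomorphy: it is stable under the algebraic operations and [Cexp],
    and it suffices for the maximum principle. *)
Definition deriv_bounded (f : C -> C) (z : C) : Prop :=
  exists delta N, 0 < delta /\ forall w, Cmod (w - z) < delta ->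
    exists d, complex_deriv f w d /\ Cmod d <= N.

Definition continuous_C (f : C -> C) (z : C) : Prop :=
  forall eps, 0 < eps -> exists delta, 0 < delta /\
    forall w, Cmod (w - z) < delta -> Cmod (f w - f z) < eps.

Definition Cexp (z : C) : C := (exp (fst z) * cos (snd z), exp (fst z) * sin (snd z)).

Lemma Cmod_sq (z : C) : Cmod z * Cmod z = fst z * fst z + snd z * snd z.
Proof. unfold Cmod. rewrite sqrt_sqrt by nra. ring. Qed.

Lemma Cmod_le_sum (z : C) : Cmod z <= Rabs (fst z) + Rabs (snd z).
Proof.
  pose proof (Rabs_pos (fst z)). pose proof (Rabs_pos (snd z)).
  apply Rsqr_incr_0_var; [|lra]. unfold Rsqr. rewrite Cmod_sq.
  pose proof (Rabs_mult (fst z) (fst z)) as H1. pose proof (Rabs_mult (snd z) (snd z)) as H2.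
  rewrite Rabs_pos_eq in H1, H2 by nra. nra.
Qed.

Lemma Rabs_fst_le (z : C) : Rabs (fst z) <= Cmod z.
Proof. apply Rle_trans with (2 := Rmax_Cmod z), Rmax_l. Qed.

Lemma Rabs_snd_le (z : C) : Rabs (snd z) <= Cmod z.
Proof. apply Rle_trans with (2 := Rmax_Cmod z), Rmax_r. Qed.

Lemma Cmod_minus_sym (z w : C) : Cmod (z - w) = Cmod (w - z).
Proof. rewrite <- Cmod_opp. f_equal. ring. Qed.

Lemma Cmod_triang_minus (z w v : C) : Cmod (z - v) <= Cmod (z - w) + Cmod (w - v).
Proof. replace (z - v)%C with ((z - w) + (w - v))%C by ring. apply Cmod_triangle. Qed.

Lemma Cmod_le_minus (z w : C) : Cmod z <= Cmod w + Cmod (z - w).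
Proof. replace z with (w + (z - w))%C at 1 by ring. apply Cmod_triangle. Qed.

Lemma Cmod_minus_diag (z : C) : Cmod (z - z) = 0.
Proof. replace (z - z)%C with (RtoC 0) by ring. apply Cmod_0. Qed.

Lemma Cmod_Cexp (z : C) : Cmod (Cexp z) = exp (fst z).
Proof.
  unfold Cmod, Cexp. simpl. pose proof (exp_pos (fst z)).
  replace (_ + _) with (exp (fst z) * exp (fst z) * (Rsqr (sin (snd z)) + Rsqr (cos (snd z)))) by (unfold Rsqr; ring).
  rewrite sin2_cos2, Rmult_1_r. apply sqrt_square. lra.
Qed.

Lemma curve_deriv_const c t : curve_deriv (fun _ => c) t 0.
Proof. split; simpl; auto_derive; trivial. Qed.

Lemma curve_deriv_plus g h t d e : curve_deriv g t d -> curve_deriv h t e ->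
  curve_deriv (fun s => g s + h s)%C t (d + e)%C.
Proof.
  intros [G1 G2] [H1 H2]; split; simpl.
  - exact (is_derive_plus (V := R_NormedModule) _ _ _ _ _ G1 H1).
  - exact (is_derive_plus (V := R_NormedModule) _ _ _ _ _ G2 H2).
Qed.

Lemma is_derive_mult_R (u v : R -> R) t a b : is_derive u t a -> is_derive v t b ->
  is_derive (fun s => u s * v s) t (a * v t + u t * b).
Proof. intros Hu Hv. apply (is_derive_mult u v t a b Hu Hv). intros; apply Rmult_comm. Qed.

Lemma curve_deriv_mult g h t d e : curve_deriv g t d -> curve_deriv h t e ->
  curve_deriv (fun s => g s * h s)%C t (d * h t + g t * e)%C.
Proof.
  intros [G1 G2] [H1 H2]; split; simpl.
  - eapply is_derive_val.
    + apply (is_derive_minus (V := R_NormedModule)); apply is_derive_mult_R; eassumption.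
    + unfold minus, plus, opp; simpl. ring.
  - eapply is_derive_val.
    + apply (is_derive_plus (V := R_NormedModule)); apply is_derive_mult_R; eassumption.
    + unfold plus; simpl. ring.
Qed.

Lemma curve_deriv_exp g t d : curve_deriv g t d -> curve_deriv (fun s => Cexp (g s)) t (Cexp (g t) * d)%C.
Proof.
  intros [G1 G2]; split; simpl.
  - eapply is_derive_val.
    + apply is_derive_mult_R.
      * apply (is_derive_comp exp (fun s => fst (g s))); [apply is_derive_exp|exact G1].
      * apply (is_derive_comp cos (fun s => snd (g s))); [apply is_derive_cos|exact G2].
    + unfold scal; simpl; unfold mult; simpl. ring.
  - eapply is_derive_val.
    + apply is_derive_mult_R.
      * apply (is_derive_comp exp (fun s => fst (g s))); [apply is_derive_exp|exact G1].
      * apply (is_derive_comp sin (fun s => snd (g s))); [apply is_derive_sin|exact G2].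
    + unfold scal; simpl; unfold mult; simpl. ring.
Qed.

Lemma Csq_norm_pos (z : C) : z <> 0%C -> 0 < fst z * fst z + snd z * snd z.
Proof. intros H. rewrite <- Cmod_sq. apply Cmod_gt_0 in H. nra. Qed.

Lemma curve_deriv_inv g t d : curve_deriv g t d -> g t <> 0%C ->
  curve_deriv (fun s => / g s)%C t (- (/ (g t * g t)) * d)%C.
Proof.
  intros [G1 G2] Hn. apply Csq_norm_pos in Hn.
  assert (Hn' : fst (g t) * (fst (g t) * 1) + snd (g t) * (snd (g t) * 1) <> 0) by lra.
  assert (Hq : is_derive (fun s => fst (g s) * (fst (g s) * 1) + snd (g s) * (snd (g s) * 1)) t
     (2 * (fst (g t) * fst d + snd (g t) * snd d))).
  { apply is_derive_ext with (fun s => fst (g s) * fst (g s) + snd (g s) * snd (g s)).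
    { intros s. rewrite !Rmult_1_r. reflexivity. }
    eapply is_derive_val.
    - apply (is_derive_plus (V := R_NormedModule)); apply is_derive_mult_R; eassumption.
    - unfold plus; simpl. ring. }
  set (x := fst (g t)) in *. set (y := snd (g t)) in *.
  assert (Hxy : (x * x - y * y) * (x * x - y * y) + (x * y + y * x) * (x * y + y * x) <> 0).
  { replace (_ + _) with ((x * x + y * y) * (x * x + y * y)) by ring. nra. }
  split; simpl; fold x y.
  - eapply is_derive_val; [apply (is_derive_div (fun s => fst (g s)) _ t _ _ G1 Hq Hn')|].
    fold x y. match goal with |- @eq _ ?a ?b => change (@eq R a b) end. field. split; [exact Hxy|apply Rgt_not_eq, Hn].
  - eapply is_derive_val.
    + exact (is_derive_div (fun s => - snd (g s)) _ t _ _
        (is_derive_opp (V := R_NormedModule) _ _ _ G2) Hq Hn').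
    + unfold opp; simpl. fold x y. match goal with |- @eq _ ?a ?b => change (@eq R a b) end. field. split; [exact Hxy|apply Rgt_not_eq, Hn].
Qed.

Lemma curve_deriv_val g t d e : curve_deriv g t d -> d = e -> curve_deriv g t e.
Proof. now intros H <-. Qed.

Lemma Cpair_surjective (z : C) : (fst z, snd z) = z.
Proof. now destruct z. Qed.

Lemma complex_deriv_const c z : complex_deriv (fun _ => c) z 0.
Proof.
  split; [apply curve_deriv_const|].
  eapply curve_deriv_val; [apply curve_deriv_const|ring].
Qed.

Lemma complex_deriv_id z : complex_deriv (fun w => w) z 1.
Proof. split; split; simpl; auto_derive; trivial; ring. Qed.

Lemma complex_deriv_plus f g z d e : complex_deriv f z d -> complex_deriv g z e ->
  complex_deriv (fun w => f w + g w)%C z (d + e)%C.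
Proof.
  intros [F1 F2] [G1 G2]; split; [now apply curve_deriv_plus|].
  eapply curve_deriv_val; [apply curve_deriv_plus; eassumption|ring].
Qed.

Lemma complex_deriv_mult f g z d e : complex_deriv f z d -> complex_deriv g z e ->
  complex_deriv (fun w => f w * g w)%C z (d * g z + f z * e)%C.
Proof.
  intros [F1 F2] [G1 G2]; split.
  - eapply curve_deriv_val; [apply curve_deriv_mult; eassumption|]. simpl. now rewrite Cpair_surjective.
  - eapply curve_deriv_val; [apply curve_deriv_mult; eassumption|]. simpl. rewrite Cpair_surjective. ring.
Qed.

Lemma complex_deriv_exp f z d : complex_deriv f z d ->
  complex_deriv (fun w => Cexp (f w)) z (Cexp (f z) * d)%C.
Proof.
  intros [F1 F2]; split.
  - eapply curve_deriv_val; [apply curve_deriv_exp; eassumption|]. cbv beta. now rewrite Cpair_surjective.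
  - eapply curve_deriv_val; [apply curve_deriv_exp; eassumption|]. cbv beta. rewrite Cpair_surjective. ring.
Qed.

Lemma complex_deriv_inv f z d : complex_deriv f z d -> f z <> 0%C ->
  complex_deriv (fun w => / f w)%C z (- (/ (f z * f z)) * d)%C.
Proof.
  intros [F1 F2] Hn; split.
  - eapply curve_deriv_val; [apply curve_deriv_inv; [eassumption|]|]; cbv beta; now rewrite Cpair_surjective.
  - eapply curve_deriv_val; [apply curve_deriv_inv; [eassumption|]|]; cbv beta; rewrite Cpair_surjective; [exact Hn|ring].
Qed.

Lemma curve_deriv_shift g a t d : curve_deriv g (t + a) d -> curve_deriv (fun s => g (s + a)) t d.
Proof.
  assert (H : forall u : R -> R, forall l, is_derive u (t + a) l -> is_derive (fun s => u (s + a)) t l).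
  { intros u l Hu. eapply is_derive_val.
    - apply (is_derive_comp u (fun s => s + a) t); [exact Hu|].
      instantiate (1 := 1). auto_derive; trivial.
    - unfold scal; simpl; unfold mult; simpl. ring. }
  intros [G1 G2]. split; [apply (H (fun s => fst (g s))), G1|apply (H (fun s => snd (g s))), G2].
Qed.

Lemma complex_deriv_shift f a z d : complex_deriv f (z + a)%C d -> complex_deriv (fun w => f (w + a)%C) z d.
Proof.
  intros [F1 F2]. split.
  - apply (curve_deriv_shift (fun t => f (t, snd z + snd a)) (fst a)), F1.
  - apply (curve_deriv_shift (fun t => f (fst z + fst a, t)) (snd a)), F2.
Qed.

Lemma deriv_bounded_shift f a z : deriv_bounded f (z + a)%C -> deriv_bounded (fun w => f (w + a)%C) z.
Proof.
  intros (delta & N & Hd & H). exists delta, N. split; [exact Hd|]. intros w Hw.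
  destruct (H (w + a)%C) as [d [H1 H2]].
  - replace (w + a - (z + a))%C with (w - z)%C by ring. exact Hw.
  - exists d. split; [now apply complex_deriv_shift|exact H2].
Qed.

Lemma deriv_bounded_open f z : deriv_bounded f z ->
  exists delta, 0 < delta /\ forall w, Cmod (w - z) < delta -> deriv_bounded f w.
Proof.
  intros (delta & N & Hd & H). exists (delta / 2). split; [lra|]. intros w Hw.
  exists (delta / 2), N. split; [lra|]. intros v Hv. apply H.
  pose proof (Cmod_triang_minus v w z). lra.
Qed.

(** The path from [z] to [w] through the corner [(fst w, snd z)] stays in the disc. Two legs and two
    real coordinates, each costing [N], give the factor 4. *)
Lemma deriv_bounded_lipschitz f z delta N :
  (forall w, Cmod (w - z) < delta -> exists d, complex_deriv f w d /\ Cmod d <= N) ->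
  forall w, Cmod (w - z) < delta -> Cmod (f w - f z) <= 4 * N * Cmod (w - z).
Proof.
  intros H w Hw.
  pose proof (Rabs_fst_le (w - z)) as Hx. pose proof (Rabs_snd_le (w - z)) as Hy. simpl in Hx, Hy.
  set (m := Cmod (w - z)) in *.
  assert (Hbetween : forall a b t, Rmin a b <= t <= Rmax a b -> Rabs (t - a) <= Rabs (b - a)).
  { intros a b t. unfold Rmin, Rmax, Rabs. destruct (Rle_dec a b), (Rcase_abs (t - a)), (Rcase_abs (b - a)); lra. }
  assert (A1 : forall t, Rmin (fst z) (fst w) <= t <= Rmax (fst z) (fst w) ->
     exists d, complex_deriv f (t, snd z) d /\ Cmod d <= N).
  { intros t Ht. apply H. apply Hbetween in Ht.
    apply Rle_lt_trans with (1 := Cmod_le_sum _). simpl.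
    replace (snd z + - snd z) with 0 by ring. rewrite Rabs_R0. unfold Rminus in *. lra. }
  assert (A2 : forall t, Rmin (snd z) (snd w) <= t <= Rmax (snd z) (snd w) ->
     exists d, complex_deriv f (fst w, t) d /\ Cmod d <= N).
  { intros t Ht. apply H. apply Hbetween in Ht.
    apply Rle_lt_trans with (2 := Hw). unfold m, Cmod. apply sqrt_le_1_alt. simpl.
    apply Rplus_le_compat_l. rewrite !Rmult_1_r. apply Rsqr_le_abs_1 in Ht. exact Ht. }
  set (p := (fst w, snd z) : C).
  assert (B : forall pr : C -> R, (forall d, Rabs (pr d) <= Cmod d) ->
     (forall g t d, curve_deriv g t d -> is_derive (fun s => pr (g s)) t (pr d)) ->
      Rabs (pr (f w) - pr (f z)) <= 2 * N * m).
  { intros pr Hpr Hder.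
    assert (C1 : Rabs (pr (f p) - pr (f z)) <= N * Rabs (fst w - fst z)).
    { replace (pr (f z)) with (pr (f (fst z, snd z))) by (now rewrite Cpair_surjective).
      apply (mvt_bound (fun t => pr (f (t, snd z)))). intros t Ht.
      destruct (A1 t Ht) as [d [[D1 _] Hd]]. exists (pr d). split; [now apply Hder|].
      apply Rle_trans with (1 := Hpr d). exact Hd. }
    assert (C2 : Rabs (pr (f w) - pr (f p)) <= N * Rabs (snd w - snd z)).
    { replace (pr (f w)) with (pr (f (fst w, snd w))) by (now rewrite Cpair_surjective).
      apply (mvt_bound (fun t => pr (f (fst w, t)))). intros t Ht.
      destruct (A2 t Ht) as [d [[_ D2] Hd]]. exists (pr (Ci * d)%C). split; [now apply (Hder (fun t => f (fst w, t)))|].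
      apply Rle_trans with (1 := Hpr _). rewrite Cmod_mult, Cmod_Ci. lra. }
    assert (HN : 0 <= N).
    { destruct (A1 (fst z)) as [d [_ Hd]].
      - split; [apply Rmin_l|apply Rmax_l].
      - pose proof (Cmod_ge_0 d). lra. }
    unfold Rminus in *.
    replace (pr (f w) + - pr (f z)) with ((pr (f w) + - pr (f p)) + (pr (f p) + - pr (f z))) by ring.
    apply Rle_trans with (1 := Rabs_triang _ _). nra. }
  pose proof (B fst Rabs_fst_le (fun g t d H => proj1 H)) as B1.
  pose proof (B snd Rabs_snd_le (fun g t d H => proj2 H)) as B2.
  apply Rle_trans with (1 := Cmod_le_sum _). simpl. unfold Rminus in *. lra.
Qed.

Lemma deriv_bounded_continuous f z : deriv_bounded f z -> continuous_C f z.
Proof.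
  intros (delta & N & Hd & H) eps Heps.
  assert (HN : 0 <= N).
  { destruct (H z) as [d [_ Hd']]; [rewrite Cmod_minus_diag; exact Hd|]. pose proof (Cmod_ge_0 d). lra. }
  assert (He : 0 < eps / (4 * N + 1)) by (apply Rdiv_lt_0_compat; lra).
  exists (Rmin delta (eps / (4 * N + 1))). split; [now apply Rmin_pos|]. intros w Hw.
  apply Rle_lt_trans with (4 * N * Cmod (w - z)).
  - apply (deriv_bounded_lipschitz f z delta N H). apply Rlt_le_trans with (1 := Hw), Rmin_l.
  - assert (Hw2 : Cmod (w - z) < eps / (4 * N + 1)) by (apply Rlt_le_trans with (1 := Hw), Rmin_r).
    pose proof (Cmod_ge_0 (w - z)).
    assert (eps / (4 * N + 1) * (4 * N + 1) = eps) by (field; lra). nra.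
Qed.

Lemma deriv_bounded_local_bound f z : deriv_bounded f z -> exists delta N B, 0 < delta /\ 0 <= B /\ 0 <= N /\
  forall w, Cmod (w - z) < delta -> Cmod (f w - f z) < 1 /\ Cmod (f w) <= B /\
    exists d, complex_deriv f w d /\ Cmod d <= N.
Proof.
  intros Hf. destruct (deriv_bounded_continuous f z Hf 1 Rlt_0_1) as [d1 [Hd1 H1]].
  destruct Hf as (d2 & N & Hd2 & H2).
  exists (Rmin d1 d2), N, (Cmod (f z) + 1).
  split; [now apply Rmin_pos|]. pose proof (Cmod_ge_0 (f z)). split; [lra|]. split.
  { destruct (H2 z) as [d [_ Hd']]; [rewrite Cmod_minus_diag; exact Hd2|]. pose proof (Cmod_ge_0 d). lra. }
  intros w Hw.
  assert (Hw1 : Cmod (f w - f z) < 1) by (apply H1, (Rlt_le_trans _ _ _ Hw), Rmin_l).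
  split; [exact Hw1|]. split.
  - pose proof (Cmod_le_minus (f w) (f z)). lra.
  - apply H2, (Rlt_le_trans _ _ _ Hw), Rmin_r.
Qed.

Lemma deriv_bounded_const c z : deriv_bounded (fun _ => c) z.
Proof.
  exists 1, 0. split; [lra|]. intros w _. exists (RtoC 0). split; [apply complex_deriv_const|].
  rewrite Cmod_0. lra.
Qed.

Lemma deriv_bounded_id z : deriv_bounded (fun w => w) z.
Proof.
  exists 1, 1. split; [lra|]. intros w _. exists (RtoC 1). split; [apply complex_deriv_id|].
  rewrite Cmod_1. lra.
Qed.

Lemma deriv_bounded_plus f g z : deriv_bounded f z -> deriv_bounded g z ->
  deriv_bounded (fun w => f w + g w)%C z.
Proof.
  intros (d1 & N1 & Hd1 & H1) (d2 & N2 & Hd2 & H2).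
  exists (Rmin d1 d2), (N1 + N2). split; [now apply Rmin_pos|]. intros w Hw.
  destruct (H1 w) as [p [Hp Bp]]; [apply (Rlt_le_trans _ _ _ Hw), Rmin_l|].
  destruct (H2 w) as [q [Hq Bq]]; [apply (Rlt_le_trans _ _ _ Hw), Rmin_r|].
  exists (p + q)%C. split; [now apply complex_deriv_plus|].
  pose proof (Cmod_triangle p q). lra.
Qed.

Lemma deriv_bounded_mult f g z : deriv_bounded f z -> deriv_bounded g z ->
  deriv_bounded (fun w => f w * g w)%C z.
Proof.
  intros Hf Hg.
  destruct (deriv_bounded_local_bound f z Hf) as (d1 & N1 & B1 & Hd1 & HB1 & HN1 & H1).
  destruct (deriv_bounded_local_bound g z Hg) as (d2 & N2 & B2 & Hd2 & HB2 & HN2 & H2).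
  exists (Rmin d1 d2), (N1 * B2 + B1 * N2). split; [now apply Rmin_pos|]. intros w Hw.
  destruct (H1 w) as (_ & F & p & Hp & Bp); [apply (Rlt_le_trans _ _ _ Hw), Rmin_l|].
  destruct (H2 w) as (_ & G & q & Hq & Bq); [apply (Rlt_le_trans _ _ _ Hw), Rmin_r|].
  exists (p * g w + f w * q)%C. split; [now apply complex_deriv_mult|].
  apply Rle_trans with (1 := Cmod_triangle _ _). rewrite !Cmod_mult.
  apply Rplus_le_compat; apply Rmult_le_compat; auto using Cmod_ge_0.
Qed.

Lemma deriv_bounded_exp f z : deriv_bounded f z -> deriv_bounded (fun w => Cexp (f w)) z.
Proof.
  intros Hf.
  destruct (deriv_bounded_local_bound f z Hf) as (d1 & N1 & B1 & Hd1 & HB1 & HN1 & H1).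
  exists d1, (exp B1 * N1). split; [exact Hd1|]. intros w Hw.
  destruct (H1 w Hw) as (_ & F & p & Hp & Bp).
  exists (Cexp (f w) * p)%C. split; [now apply complex_deriv_exp|].
  rewrite Cmod_mult, Cmod_Cexp. apply Rmult_le_compat; auto using Cmod_ge_0.
  - apply Rlt_le, exp_pos.
  - assert (Hle : fst (f w) <= B1).
    { pose proof (Rabs_fst_le (f w)). pose proof (Rle_abs (fst (f w))). lra. }
    destruct Hle as [Hlt|Heq]; [now apply Rlt_le, exp_increasing|rewrite Heq; lra].
Qed.

Lemma deriv_bounded_inv f z : deriv_bounded f z -> f z <> 0%C -> deriv_bounded (fun w => / f w)%C z.
Proof.
  intros Hf Hn. apply Cmod_gt_0 in Hn. set (m := Cmod (f z)) in *.
  assert (Hm2 : 0 < m / 2) by lra.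
  destruct (deriv_bounded_continuous f z Hf (m / 2) Hm2) as [d1 [Hd1 H1]].
  destruct Hf as (d2 & N & Hd2 & H2).
  exists (Rmin d1 d2), (/ (m / 2 * (m / 2)) * N). split; [now apply Rmin_pos|]. intros w Hw.
  assert (Hw1 : Cmod (f w - f z) < m / 2) by (apply H1, (Rlt_le_trans _ _ _ Hw), Rmin_l).
  destruct (H2 w) as (p & Hp & Bp); [apply (Rlt_le_trans _ _ _ Hw), Rmin_r|].
  assert (Hlow : m / 2 < Cmod (f w)).
  { pose proof (Cmod_le_minus (f z) (f w)) as H. rewrite Cmod_minus_sym in H. fold m in H. lra. }
  assert (Hnz : f w <> 0%C) by (apply Cmod_gt_0; lra).
  exists (- (/ (f w * f w)) * p)%C. split; [now apply complex_deriv_inv|].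
  rewrite Cmod_mult, Cmod_opp, Cmod_inv by (apply Cmod_gt_0; rewrite Cmod_mult; nra).
  rewrite Cmod_mult. apply Rmult_le_compat; auto using Cmod_ge_0.
  - apply Rlt_le, Rinv_0_lt_compat. nra.
  - apply Rinv_le_contravar; nra.
Qed.

Lemma deriv_bounded_minus f g z : deriv_bounded f z -> deriv_bounded g z ->
  deriv_bounded (fun w => f w - g w)%C z.
Proof.
  intros Hf Hg. apply deriv_bounded_plus; [exact Hf|].
  replace (fun w => - g w)%C with (fun w => (- (1)) * g w)%C.
  - apply deriv_bounded_mult; [apply deriv_bounded_const|exact Hg].
  - apply FunctionalExtensionality.functional_extensionality. intros w. ring.
Qed.

Lemma deriv_bounded_pow f n z : deriv_bounded f z -> deriv_bounded (fun w => Cpow (f w) n) z.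
Proof.
  intros Hf. induction n as [|n IH]; simpl.
  - apply (deriv_bounded_const (RtoC 1)).
  - exact (deriv_bounded_mult f (fun w => Cpow (f w) n) z Hf IH).
Qed.

(** * The maximum principle *)

(* The gap to the supremum is taken for [t / (1 + t)], so that no a priori bound on [phi] is needed. *)
Lemma usc_attains_max (phi : C -> R) (A : R) : 0 <= A ->
  (forall z, 0 < phi z) ->
  (forall z eta, 0 < eta -> exists delta, 0 < delta /\
     forall w, Cmod (w - z) < delta -> phi w <= phi z + eta) ->
  exists z, forall w, Rabs (fst w) <= A -> Rabs (snd w) <= A -> phi w <= phi z.
Proof.
  intros HA Hpos Husc. apply NNPP. intros Hno.
  set (psi := fun z => 1 - / (1 + phi z)).
  assert (Hi : forall z, 0 < / (1 + phi z) <= 1).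
  { intros z. specialize (Hpos z). split; [apply Rinv_0_lt_compat; lra|].
    rewrite <- Rinv_1. apply Rinv_le_contravar; lra. }
  set (E := fun y => exists w, Rabs (fst w) <= A /\ Rabs (snd w) <= A /\ y = psi w).
  assert (Hz0 : E (psi (RtoC 0))).
  { exists (RtoC 0). simpl. rewrite Rabs_R0. auto. }
  destruct (completeness E) as [S [HS1 HS2]].
  { exists 1. intros y (w & _ & _ & ->). unfold psi. specialize (Hi w). lra. }
  { now exists (psi (RtoC 0)). }
  assert (Hlt : forall z, Rabs (fst z) <= A -> Rabs (snd z) <= A -> psi z < S).
  { intros z Hz1 Hz2. apply Rnot_le_lt. intros Hc. apply Hno. exists z. intros w Hw1 Hw2.
    assert (Hw : psi w <= S) by (apply HS1; exists w; auto).
    apply Rnot_lt_le. intros Hc2. apply (Rlt_irrefl (psi z)).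
    apply Rlt_le_trans with (psi w); [|lra]. unfold psi.
    assert (/ (1 + phi w) < / (1 + phi z)); [|lra].
    pose proof (Hpos z). pose proof (Hpos w).
    apply Rinv_lt_contravar; [apply Rmult_lt_0_compat; lra|lra]. }
  (* The radius doubles as a gap below the supremum [S], so a uniform lower bound on the radii is a
     uniform gap, against the choice of [S]. *)
  assert (Hsel : forall u v, exists d : posreal, Rabs u <= A -> Rabs v <= A ->
    forall x y, Rabs (x - u) < d -> Rabs (y - v) < d -> psi (x, y) <= S - d).
  { intros u v. destruct (classic (Rabs u <= A /\ Rabs v <= A)) as [[Hu Hv]|Hn].
    2:{ exists (mkposreal 1 Rlt_0_1). tauto. }
    set (g := S - psi (u, v)). assert (Hg : 0 < g) by (specialize (Hlt (u, v) Hu Hv); unfold g; lra).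
    destruct (Husc (u, v) (g / 2)) as [d [Hd H]]; [lra|].
    assert (Hm : 0 < Rmin (d / 2) (g / 2)) by (apply Rmin_pos; lra).
    exists (mkposreal _ Hm). intros _ _ x y Hx Hy. simpl in *.
    pose proof (Rmin_l (d / 2) (g / 2)). pose proof (Rmin_r (d / 2) (g / 2)).
    assert (Hle : phi (x, y) <= phi (u, v) + g / 2).
    { apply H. apply Rle_lt_trans with (1 := Cmod_le_sum _). simpl. unfold Rminus in *. lra. }
    assert (psi (x, y) <= psi (u, v) + g / 2); [|unfold g in *; lra].
    unfold psi. pose proof (Hi (u, v)). pose proof (Hi (x, y)).
    pose proof (Hpos (u, v)). pose proof (Hpos (x, y)).
    set (p := phi (x, y)) in *. set (q := phi (u, v)) in *.
    destruct (Rle_dec p q) as [Hpq|Hpq].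
    - assert (/ (1 + q) <= / (1 + p)) by (apply Rinv_le_contravar; lra). lra.
    - replace (/ (1 + p)) with (/ (1 + q) - (p - q) * (/ (1 + p) * / (1 + q))) by (field; lra).
      assert (/ (1 + p) * / (1 + q) <= 1) by nra. nra. }
  assert (Hsel2 : exists delta : R -> R -> posreal, forall u v, Rabs u <= A -> Rabs v <= A ->
    forall x y, Rabs (x - u) < delta u v -> Rabs (y - v) < delta u v -> psi (x, y) <= S - delta u v).
  { destruct (choice (fun (p : R * R) (d : posreal) => Rabs (fst p) <= A -> Rabs (snd p) <= A ->
      forall x y, Rabs (x - fst p) < d -> Rabs (y - snd p) < d -> psi (x, y) <= S - d)) as [delta Hdel].
    - intros [u v]. apply Hsel.
    - exists (fun u v => delta (u, v)). intros u v. exact (Hdel (u, v)). }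
  destruct Hsel2 as [delta Hdel].
  destruct (compactness_value_2d (- A) A (- A) A delta) as [d Hd].
  assert (HSd : S <= S - d).
  { apply HS2. intros y (w & Hw1 & Hw2 & ->). apply Rnot_lt_le. intros Hc.
    assert (Hw1' := proj1 (Rabs_le_between _ _) Hw1). assert (Hw2' := proj1 (Rabs_le_between _ _) Hw2).
    apply (Hd (fst w) (snd w) Hw1' Hw2'). intros (u & v & Hu & Hv & Hxu & Hyv & Hdd).
    specialize (Hdel u v (proj2 (Rabs_le_between _ _) Hu) (proj2 (Rabs_le_between _ _) Hv) _ _ Hxu Hyv).
    rewrite Cpair_surjective in Hdel. lra. }
  pose proof (cond_pos d). lra.
Qed.

(* The factor [exp (2 eps conj(z0) w)] turns a maximum of [|G| exp (eps |z|^2)] at [z0] into a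
   strict peak [|H w| <= exp (- eps |w|^2)]. *)
Lemma no_interior_max (G : C -> C) (z0 : C) (eps delta : R) :
  0 < eps -> 0 < delta -> deriv_bounded G z0 -> G z0 <> 0%C ->
  (forall w, Cmod (w - z0) < delta ->
     Cmod (G w) * exp (eps * (Cmod w * Cmod w)) <= Cmod (G z0) * exp (eps * (Cmod z0 * Cmod z0))) ->
  False.
Proof.
  intros Heps Hdelta HG Hn Hmax.
  set (H := fun w => (G (w + z0) * (/ G z0 * Cexp (RtoC (2 * eps) * Cconj z0 * w)))%C).
  assert (HH : deriv_bounded H 0%C).
  { unfold H. apply deriv_bounded_mult.
    - apply deriv_bounded_shift. replace (0 + z0)%C with z0 by ring. exact HG.
    - apply deriv_bounded_mult; [apply deriv_bounded_const|].
      apply (deriv_bounded_exp (fun w => (RtoC (2 * eps) * Cconj z0 * w)%C)).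
      apply deriv_bounded_mult; [apply deriv_bounded_const|apply deriv_bounded_id]. }
  destruct HH as (d & N & Hd & HH).
  set (r := Rmin d delta / 2).
  assert (Hr : 0 < r) by (unfold r; assert (0 < Rmin d delta) by (now apply Rmin_pos); lra).
  assert (Hball : forall x y, Rabs x < r -> Rabs y < r -> Cmod ((x, y) - 0)%C < d /\ Cmod (x, y) < delta).
  { intros x y Hx Hy.
    assert (Hc : Cmod (x, y) < Rmin d delta).
    { apply Rle_lt_trans with (1 := Cmod_le_sum _). simpl. unfold r in *. lra. }
    replace ((x, y) - 0)%C with ((x, y) : C) by (unfold Cminus, Cplus, Copp, RtoC; simpl; f_equal; ring).
    split; apply (Rlt_le_trans _ _ _ Hc); [apply Rmin_l|apply Rmin_r]. }
  apply (no_gaussian_peak (fun x y => fst (H (x, y))) (fun x y => snd (H (x, y))) N r eps); auto.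
  - intros x y Hx Hy. destruct (Hball x y Hx Hy) as [Hb _].
    destruct (HH _ Hb) as [D [[[D1 D2] [D3 D4]] HD]]. exists (fst D), (snd D).
    simpl in D1, D2, D3, D4.
    split; [exact D1|]. split; [exact D2|]. split.
    { eapply is_derive_val; [exact D3|]. ring. }
    split.
    { eapply is_derive_val; [exact D4|]. ring. }
    split; [apply Rle_trans with (1 := Rabs_fst_le D)|apply Rle_trans with (1 := Rabs_snd_le D)]; exact HD.
  - unfold H. replace ((0, 0) + z0)%C with z0 by (destruct z0; unfold Cplus; simpl; f_equal; ring).
    replace (RtoC (2 * eps) * Cconj z0 * (0, 0))%C with (RtoC 0) by (unfold Cmult, RtoC; simpl; f_equal; ring).
    replace (Cexp 0) with (RtoC 1).
    2:{ unfold Cexp; simpl. rewrite exp_0, cos_0, sin_0. unfold RtoC. f_equal; ring. }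
    replace (G z0 * (/ G z0 * 1))%C with (RtoC 1) by (field; exact Hn). reflexivity.
  - intros x y Hx Hy. destruct (Hball x y Hx Hy) as [_ Hb].
    apply Rle_trans with (Cmod (H (x, y))).
    { apply Rle_trans with (1 := Rle_abs _). apply Rabs_fst_le. }
    set (w := (x, y) : C).
    assert (Hm : Cmod (G (w + z0)%C) * exp (eps * (Cmod (w + z0) * Cmod (w + z0)))
               <= Cmod (G z0) * exp (eps * (Cmod z0 * Cmod z0))).
    { apply Hmax. replace (w + z0 - z0)%C with w by ring. exact Hb. }
    unfold H. fold w. rewrite !Cmod_mult, Cmod_inv, Cmod_Cexp by exact Hn.
    apply Cmod_gt_0 in Hn. set (m := Cmod (G z0)) in *.
    pose proof (exp_pos (eps * (Cmod (w + z0) * Cmod (w + z0)))) as He.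
    assert (Hm' : Cmod (G (w + z0)%C) <= m * exp (eps * (Cmod z0 * Cmod z0) - eps * (Cmod (w + z0) * Cmod (w + z0)))).
    { unfold Rminus. rewrite exp_plus, exp_Ropp.
      apply Rmult_le_reg_r with (1 := He). apply Rle_trans with (1 := Hm). right. field. lra. }
    set (X := fst (RtoC (2 * eps) * Cconj z0 * w)%C).
    replace (- eps * (x * x + y * y)) with
      (eps * (Cmod z0 * Cmod z0) - eps * (Cmod (w + z0) * Cmod (w + z0)) + X).
    2:{ rewrite !Cmod_sq. unfold X, w. simpl. ring. }
    rewrite exp_plus, <- Rmult_assoc. apply Rmult_le_compat_r; [apply Rlt_le, exp_pos|].
    apply Rmult_le_reg_r with m; [exact Hn|]. rewrite Rmult_assoc, Rinv_l by lra. lra.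
Qed.

(** If the bound fails at [z0], a weight [exp (eps |z|^2)] with [eps] small keeps the boundary
    values below [|G z0|]. The weighted modulus then attains its maximum inside [D], which
    [no_interior_max] forbids. *)
Lemma max_principle (D : C -> Prop) (G : C -> C) (A B : R) :
  0 <= B ->
  (forall z, D z -> exists delta, 0 < delta /\ forall w, Cmod (w - z) < delta -> D w) ->
  (forall z, D z -> Cmod z <= A) ->
  (forall z, D z -> deriv_bounded G z) ->
  (forall z, ~ D z -> (forall delta, 0 < delta -> exists w, D w /\ Cmod (w - z) < delta) ->
     forall eta, 0 < eta -> exists delta, 0 < delta /\
       forall w, D w -> Cmod (w - z) < delta -> Cmod (G w) <= B + eta) ->
  forall z, D z -> Cmod (G z) <= B.
Proof.
  intros HB Hopen HA HG Hbd z0 Hz0. apply Rnot_lt_le. intros Hgt.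
  assert (HA0 : 0 <= A) by (pose proof (Cmod_ge_0 z0); specialize (HA z0 Hz0); lra).
  set (eta := (Cmod (G z0) - B) / 2). assert (Heta : 0 < eta) by (unfold eta; lra).
  assert (HBe : 0 < B + eta < Cmod (G z0)) by (unfold eta in *; lra).
  set (ratio := Cmod (G z0) / (B + eta)).
  assert (Hratio : 1 < ratio).
  { unfold ratio. apply Rmult_lt_reg_r with (B + eta); [lra|]. unfold Rdiv. rewrite Rmult_assoc, Rinv_l by lra. lra. }
  assert (Hln : 0 < ln ratio) by (rewrite <- ln_1; apply ln_increasing; lra).
  (* Small enough that the weight, at most [exp (eps A^2)] on [D], does not lift [B + eta] to
     [|G z0|]. *)
  set (eps := ln ratio / (2 * (A * A + 1))).
  assert (HAA : 0 <= A * A) by nra.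
  assert (Heps : 0 < eps) by (unfold eps; apply Rdiv_lt_0_compat; lra).
  assert (HepsA : eps * (A * A) < ln ratio).
  { assert (eps * (A * A + 1) = ln ratio / 2) by (unfold eps; field; lra). nra. }
  set (c0 := (B + eta) * exp (eps * (A * A))).
  assert (Hc0 : 0 < c0) by (apply Rmult_lt_0_compat; [lra|apply exp_pos]).
  assert (Hc0z : c0 < Cmod (G z0)).
  { unfold c0. apply exp_increasing in HepsA. rewrite exp_ln in HepsA by lra.
    replace (Cmod (G z0)) with ((B + eta) * ratio) by (unfold ratio; field; lra).
    apply Rmult_lt_compat_l; lra. }
  set (gauss := fun z => exp (eps * (Cmod z * Cmod z))).
  assert (Hgauss1 : forall z, 1 <= gauss z).
  { intros z. unfold gauss. rewrite <- exp_0. pose proof (Cmod_ge_0 z).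
    destruct (Req_dec (eps * (Cmod z * Cmod z)) 0) as [->|Hne]; [lra|].
    apply Rlt_le, exp_increasing. assert (0 <= eps * (Cmod z * Cmod z)) by (apply Rmult_le_pos; nra). lra. }
  assert (HgaussA : forall z, D z -> gauss z <= exp (eps * (A * A))).
  { intros z Hz. specialize (HA z Hz). pose proof (Cmod_ge_0 z). unfold gauss.
    destruct (Req_dec (eps * (Cmod z * Cmod z)) (eps * (A * A))) as [->|Hne]; [lra|].
    apply Rlt_le, exp_increasing. assert (eps * (Cmod z * Cmod z) <= eps * (A * A)); [|lra].
    apply Rmult_le_compat_l; nra. }
  (* The floor [c0] makes [phi] upper semicontinuous on the whole plane: near a boundary point the
     weighted modulus is at most [c0]. Any value above [c0] is therefore taken inside [D]. *)
  set (phi := fun z => if excluded_middle_informative (D z)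
                       then Rmax c0 (Cmod (G z) * gauss z) else c0).
  destruct (usc_attains_max phi A HA0) as [z1 Hz1].
  { intros z. unfold phi. destruct (excluded_middle_informative (D z)); [|exact Hc0].
    apply Rlt_le_trans with (1 := Hc0), Rmax_l. }
  { intros z e He. destruct (classic (D z)) as [Hz|Hz].
    - destruct (deriv_bounded_local_bound G z (HG z Hz)) as (d0 & N0 & B0 & Hd0 & HB0 & HN0 & H0).
      (* The Gaussian weight is not holomorphic, so the closure properties of [deriv_bounded] do not
         apply and continuity is estimated by hand. *)
      assert (Hcont : continuous_C (fun w => (G w * Cexp (RtoC (eps * (Cmod w * Cmod w))))%C) z).
      { assert (Hexp : exists d N, 0 < d /\ 0 <= N /\ forall w, Cmod (w - z) < d ->
           gauss w <= N /\ Rabs (gauss w - gauss z) <= N * Cmod (w - z)).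
        { set (M := Cmod z + 1). assert (HM : 0 < M) by (unfold M; pose proof (Cmod_ge_0 z); lra).
          exists 1, (exp (eps * (M * M)) * (1 + 2 * eps * M)).
          pose proof (exp_pos (eps * (M * M))) as Hep.
          assert (HeM : 0 < eps * M) by now apply Rmult_lt_0_compat.
          split; [lra|]. split; [apply Rmult_le_pos; lra|]. intros w Hw.
          pose proof (Cmod_ge_0 w). pose proof (Cmod_ge_0 z).
          pose proof (Cmod_le_minus w z) as T1. pose proof (Cmod_le_minus z w) as T2.
          rewrite Cmod_minus_sym in T2.
          assert (HwM : Cmod w <= M) by (unfold M; lra). assert (HzM : Cmod z <= M) by (unfold M; lra).
          assert (Hmono : forall t, t * t <= M * M -> exp (eps * (t * t)) <= exp (eps * (M * M))).
          { intros t Ht. destruct (Req_dec (t * t) (M * M)) as [->|Hne]; [lra|].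
            apply Rlt_le, exp_increasing, Rmult_lt_compat_l; lra. }
          split.
          - apply Rle_trans with (exp (eps * (M * M))); [apply Hmono; nra|].
            rewrite <- (Rmult_1_r (exp (eps * (M * M)))) at 1. apply Rmult_le_compat_l; lra.
          - apply Rle_trans with (exp (eps * (M * M)) * (2 * eps * M) * Rabs (Cmod w - Cmod z)).
            + apply (mvt_bound (fun t => exp (eps * (t * t)))). intros t Ht.
              assert (Ht0 : 0 <= t <= M).
              { unfold Rmin, Rmax in Ht. destruct (Rle_dec (Cmod z) (Cmod w)); lra. }
              exists (exp (eps * (t * t)) * (2 * eps * t)). split.
              { auto_derive; trivial. ring. }
              rewrite Rabs_mult. apply Rmult_le_compat; try apply Rabs_pos.
              * rewrite Rabs_pos_eq by (apply Rlt_le, exp_pos). apply Hmono. nra.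
              * rewrite Rabs_pos_eq by (assert (0 <= eps * t) by (apply Rmult_le_pos; lra); lra).
                apply Rmult_le_compat_l; lra.
            + apply Rmult_le_compat; [apply Rmult_le_pos; lra|apply Rabs_pos| |].
              * apply Rmult_le_compat_l; lra.
              * apply Rabs_le. lra. }
        destruct Hexp as (d1 & N1 & Hd1 & HN1 & H1). intros e1 He1.
        assert (HeN : 0 < e1 / (2 * (N1 + 1))) by (apply Rdiv_lt_0_compat; lra).
        destruct (deriv_bounded_continuous G z (HG z Hz) _ HeN) as [d2 [Hd2 H2]].
        assert (HeB : 0 < e1 / (2 * (N1 * Cmod (G z) + 1))).
        { apply Rdiv_lt_0_compat; [lra|]. pose proof (Cmod_ge_0 (G z)). nra. }
        exists (Rmin d1 (Rmin d2 (e1 / (2 * (N1 * Cmod (G z) + 1))))).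
        split; [repeat apply Rmin_pos; assumption|]. intros w Hw.
        assert (Hw1 : Cmod (w - z) < d1) by (apply (Rlt_le_trans _ _ _ Hw), Rmin_l).
        assert (Hw2 : Cmod (w - z) < d2).
        { apply (Rlt_le_trans _ _ _ Hw), (Rle_trans _ _ _ (Rmin_r _ _)), Rmin_l. }
        assert (Hw3 : Cmod (w - z) < e1 / (2 * (N1 * Cmod (G z) + 1))).
        { apply (Rlt_le_trans _ _ _ Hw), (Rle_trans _ _ _ (Rmin_r _ _)), Rmin_r. }
        assert (Eg : forall v, Cexp (RtoC (eps * (Cmod v * Cmod v))) = RtoC (gauss v)).
        { intros v. unfold Cexp, gauss, RtoC. simpl. rewrite cos_0, sin_0. f_equal; ring. }
        rewrite !Eg.
        replace (G w * gauss w - G z * gauss z)%C with ((G w - G z) * gauss w + G z * (gauss w - gauss z))%C by ring.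
        destruct (H1 w Hw1) as [Q1 Q2]. specialize (H2 w Hw2).
        apply Rle_lt_trans with (1 := Cmod_triangle _ _).
        rewrite !Cmod_mult, <- RtoC_minus, !Cmod_R.
        rewrite (Rabs_pos_eq (gauss w)) by (specialize (Hgauss1 w); lra).
        pose proof (Cmod_ge_0 (G z)) as P1. pose proof (Cmod_ge_0 (G w - G z)) as P2. pose proof (Cmod_ge_0 (w - z)) as P3.
        assert (T1 : Cmod (G w - G z) * gauss w <= Cmod (G w - G z) * N1) by (apply Rmult_le_compat_l; auto).
        assert (T2 : Cmod (G z) * Rabs (gauss w - gauss z) <= Cmod (G z) * (N1 * Cmod (w - z))) by (apply Rmult_le_compat_l; auto).
        assert (I1 : e1 / (2 * (N1 + 1)) * (N1 + 1) = e1 / 2) by (field; lra).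
        assert (HNG : 0 <= N1 * Cmod (G z)) by now apply Rmult_le_pos.
        assert (I2 : e1 / (2 * (N1 * Cmod (G z) + 1)) * (N1 * Cmod (G z) + 1) = e1 / 2) by (field; lra).
        assert (T3 : Cmod (G w - G z) * N1 <= e1 / (2 * (N1 + 1)) * N1) by (apply Rmult_le_compat_r; lra).
        assert (T4 : N1 * Cmod (G z) * Cmod (w - z) <= N1 * Cmod (G z) * (e1 / (2 * (N1 * Cmod (G z) + 1)))) by (apply Rmult_le_compat_l; lra).
        lra. }
      destruct (Hcont e He) as [d [Hd H]]. destruct (Hopen z Hz) as [d' [Hd' H']].
      exists (Rmin d d'). split; [now apply Rmin_pos|]. intros w Hw.
      assert (Hw1 : Cmod (w - z) < d) by (apply (Rlt_le_trans _ _ _ Hw), Rmin_l).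
      assert (Hw2 : D w) by (apply H', (Rlt_le_trans _ _ _ Hw), Rmin_r).
      specialize (H w Hw1).
      unfold phi. destruct (excluded_middle_informative (D w)) as [_|]; [|tauto].
      destruct (excluded_middle_informative (D z)) as [_|]; [|tauto].
      assert (Em : forall v, Cmod (G v) * gauss v = Cmod (G v * Cexp (RtoC (eps * (Cmod v * Cmod v))))%C).
      { intros v. rewrite Cmod_mult, Cmod_Cexp. reflexivity. }
      rewrite !Em.
      pose proof (Cmod_le_minus (G w * Cexp (RtoC (eps * (Cmod w * Cmod w))))%C (G z * Cexp (RtoC (eps * (Cmod z * Cmod z))))%C) as T.
      apply Rmax_lub.
      + apply Rle_trans with (1 := Rmax_l c0 (Cmod (G z * Cexp (RtoC (eps * (Cmod z * Cmod z))))%C)). lra.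
      + apply Rle_trans with (1 := T). apply Rplus_le_compat; [apply Rmax_r|lra].
    - destruct (classic (forall delta, 0 < delta -> exists w, D w /\ Cmod (w - z) < delta)) as [Hcl|Hncl].
      + destruct (Hbd z Hz Hcl eta Heta) as [d [Hd H]]. exists d. split; [exact Hd|]. intros w Hw.
        unfold phi. destruct (excluded_middle_informative (D z)) as [|_]; [tauto|].
        destruct (excluded_middle_informative (D w)) as [Dw|_]; [|lra].
        apply Rmax_lub; [lra|]. apply Rle_trans with c0; [|lra].
        unfold c0. apply Rmult_le_compat; auto using Cmod_ge_0.
        specialize (Hgauss1 w). lra.
      + apply not_all_ex_not in Hncl. destruct Hncl as [d Hd].
        apply imply_to_and in Hd. destruct Hd as [Hd Hd'].
        exists d. split; [exact Hd|]. intros w Hw. unfold phi.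
        destruct (excluded_middle_informative (D z)) as [|_]; [tauto|].
        destruct (excluded_middle_informative (D w)) as [Dw|_]; [|lra].
        exfalso. apply Hd'. now exists w. }
  assert (Hsq : forall w, D w -> phi w <= phi z1).
  { intros w Hw. specialize (HA w Hw). apply Hz1.
    - apply Rle_trans with (1 := Rabs_fst_le w). exact HA.
    - apply Rle_trans with (1 := Rabs_snd_le w). exact HA. }
  assert (Hz01 : c0 < phi z1).
  { apply Rlt_le_trans with (2 := Hsq z0 Hz0). unfold phi.
    destruct (excluded_middle_informative (D z0)) as [_|]; [|tauto].
    apply Rlt_le_trans with (2 := Rmax_r _ _). apply Rlt_le_trans with (1 := Hc0z).
    specialize (Hgauss1 z0). pose proof (Cmod_ge_0 (G z0)). nra. }
  assert (Dz1 : D z1).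
  { apply NNPP. intros Hn. unfold phi in Hz01. destruct (excluded_middle_informative (D z1)); [tauto|lra]. }
  assert (Ephi : phi z1 = Cmod (G z1) * gauss z1).
  { unfold phi in *. destruct (excluded_middle_informative (D z1)); [|tauto].
    unfold Rmax in *. destruct (Rle_dec c0 (Cmod (G z1) * gauss z1)); [reflexivity|lra]. }
  destruct (Hopen z1 Dz1) as [d [Hd H]].
  apply (no_interior_max G z1 eps d); auto.
  - intros Hc. rewrite Ephi, Hc, Cmod_0 in Hz01. lra.
  - intros w Hw. specialize (Hsq w (H w Hw)). rewrite Ephi in Hsq.
    apply Rle_trans with (2 := Hsq). unfold phi.
    destruct (excluded_middle_informative (D w)) as [_|Hn]; [|destruct Hn; now apply H].
    apply Rmax_r.
Qed.

(** * The Looman-Menchoff theorem *)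

Lemma le_of_exp_decay (a K c : R) : 0 <= a ->
  (forall eps, 0 < eps -> a * exp (- eps * c) <= K) -> a <= K.
Proof.
  intros Ha H. apply Rnot_lt_le. intros Hlt.
  set (eps := (a - K) / (2 * ((a + 1) * (Rabs c + 1)))).
  pose proof (Rabs_pos c).
  assert (Hp : 0 < (a + 1) * (Rabs c + 1)) by (apply Rmult_lt_0_compat; lra).
  assert (Heps : 0 < eps) by (unfold eps; apply Rdiv_lt_0_compat; lra).
  specialize (H eps Heps).
  assert (He : 1 + - eps * c <= exp (- eps * c)) by apply exp_ineq1_le.
  assert (Hc : eps * c <= eps * Rabs c) by (apply Rmult_le_compat_l; [lra|apply Rle_abs]).
  assert (Hid : eps * ((a + 1) * (Rabs c + 1)) = (a - K) / 2) by (unfold eps; field; lra).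
  assert (a * (eps * Rabs c) <= eps * ((a + 1) * (Rabs c + 1))).
  { assert (0 <= eps * Rabs c) by (apply Rmult_le_pos; lra). 
    assert (0 <= eps * a) by (apply Rmult_le_pos; lra). nra. }
  assert (a * (1 + - eps * c) <= a * exp (- eps * c)) by now apply Rmult_le_compat_l.
  nra.
Qed.

(** Taking [n]-th roots makes the constants [c] and [d] disappear in the limit. *)
Lemma le_of_pow_le (q K c d : R) : 0 <= q -> 0 < K -> 0 < c ->
  (forall n, q ^ n * c <= K ^ n * d) -> q <= K.
Proof.
  intros Hq HK Hc H. apply Rnot_lt_le. intros Hlt.
  assert (Hr : Rabs (q / K) > 1).
  { rewrite Rabs_pos_eq by (apply Rmult_le_pos; [lra|apply Rlt_le, Rinv_0_lt_compat; lra]).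
    apply Rmult_lt_reg_r with K; [exact HK|]. unfold Rdiv. rewrite Rmult_assoc, Rinv_l by lra. lra. }
  destruct (Pow_x_infinity _ Hr (d / c + 1)) as [n Hn]. specialize (Hn n (Nat.le_refl n)). specialize (H n).
  unfold Rdiv at 1 in Hn. rewrite Rpow_mult_distr, pow_inv in Hn.
  assert (HKn : 0 < K ^ n) by now apply pow_lt.
  assert (Hqn : 0 <= q ^ n) by now apply pow_le.
  rewrite Rabs_pos_eq in Hn by (apply Rmult_le_pos; [lra|apply Rlt_le, Rinv_0_lt_compat; lra]).
  assert (q ^ n * / K ^ n <= d / c).
  { apply Rmult_le_reg_r with (K ^ n * c); [now apply Rmult_lt_0_compat|].
    replace (q ^ n * / K ^ n * (K ^ n * c)) with (q ^ n * c) by (field; lra).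
    replace (d / c * (K ^ n * c)) with (K ^ n * d) by (field; lra). exact H. }
  lra.
Qed.

Lemma is_derive_bound (u : R -> R) (t l L delta : R) : 0 < delta -> is_derive u t l ->
  (forall h, Rabs h < delta -> Rabs (u (t + h) - u t) <= L * Rabs h) -> Rabs l <= L.
Proof.
  intros Hd Hu H. apply Rnot_lt_le. intros Hlt.
  apply is_derive_Reals in Hu. destruct (Hu (Rabs l - L)) as [d Hdd]; [lra|].
  pose proof (cond_pos d).
  assert (Hm : 0 < Rmin d delta) by now apply Rmin_pos.
  pose proof (Rmin_l d delta). pose proof (Rmin_r d delta).
  set (h := Rmin d delta / 2) in *. assert (Hh : 0 < h) by (unfold h; lra).
  assert (Hhd : Rabs h < d) by (rewrite Rabs_pos_eq; unfold h; lra).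
  assert (Hhd' : Rabs h < delta) by (rewrite Rabs_pos_eq; unfold h; lra).
  specialize (Hdd h ltac:(lra) Hhd). specialize (H h Hhd').
  rewrite (Rabs_pos_eq h) in H by lra.
  assert (Hq : Rabs ((u (t + h) - u t) / h) <= L).
  { unfold Rdiv. rewrite Rabs_mult, (Rabs_pos_eq (/ h)) by (apply Rlt_le, Rinv_0_lt_compat; lra).
    apply Rmult_le_reg_r with h; [exact Hh|]. rewrite Rmult_assoc, Rinv_l by lra. lra. }
  pose proof (Rabs_triang_inv l ((u (t + h) - u t) / h)). rewrite Rabs_minus_sym in Hdd. lra.
Qed.

Lemma is_derive_lipschitz (u : R -> R) (t l : R) : is_derive u t l ->
  exists delta, 0 < delta /\ forall h, Rabs h < delta -> Rabs (u (t + h) - u t) <= (Rabs l + 1) * Rabs h.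
Proof.
  intros Hu. apply is_derive_Reals in Hu. destruct (Hu 1 Rlt_0_1) as [d Hd].
  exists d. split; [apply cond_pos|]. intros h Hh.
  destruct (Req_dec h 0) as [->|Hn].
  { rewrite Rplus_0_r, Rminus_diag, Rabs_R0. lra. }
  specialize (Hd h Hn Hh). pose proof (Rabs_pos_lt h Hn) as Hp.
  replace (u (t + h) - u t) with ((u (t + h) - u t) / h * h) by (field; exact Hn).
  rewrite Rabs_mult. apply Rmult_le_compat_r; [lra|].
  pose proof (Rabs_triang_inv ((u (t + h) - u t) / h) l). lra.
Qed.

(** Fixing both the constant and the radius makes this a closed condition on [z], while every point
    with partial derivatives satisfies it for some pair: the exhaustion that Baire's theorem
    needs. *)
Definition axis_lipschitz (f : C -> C) (L r : R) (z : C) : Prop :=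
  forall h : R, Rabs h < r ->
    Cmod (f (z + h)%C - f z) <= L * Rabs h /\ Cmod (f (z + Ci * h)%C - f z) <= L * Rabs h.

Lemma axis_x (z : C) (h : R) : (z + h)%C = (fst z + h, snd z).
Proof. unfold Cplus, RtoC; simpl. f_equal. ring. Qed.

Lemma axis_y (z : C) (h : R) : (z + Ci * h)%C = (fst z, snd z + h).
Proof. unfold Cplus, Cmult, Ci, RtoC; simpl. f_equal; ring. Qed.

Lemma complex_deriv_axis_lipschitz f z d : complex_deriv f z d ->
  exists L r, 0 < r /\ axis_lipschitz f L r z.
Proof.
  assert (Hcurve : forall (g : R -> C) t e, curve_deriv g t e -> exists L r, 0 <= L /\ 0 < r /\
     forall h, Rabs h < r -> Cmod (g (t + h) - g t) <= L * Rabs h).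
  { intros g t e [H1 H2]. destruct (is_derive_lipschitz _ _ _ H1) as [d1 [Hd1 A1]].
    destruct (is_derive_lipschitz _ _ _ H2) as [d2 [Hd2 A2]].
    exists (Rabs (fst e) + 1 + (Rabs (snd e) + 1)), (Rmin d1 d2).
    pose proof (Rabs_pos (fst e)). pose proof (Rabs_pos (snd e)).
    split; [lra|]. split; [now apply Rmin_pos|]. intros h Hh.
    specialize (A1 h (Rlt_le_trans _ _ _ Hh (Rmin_l _ _))). specialize (A2 h (Rlt_le_trans _ _ _ Hh (Rmin_r _ _))).
    apply Rle_trans with (1 := Cmod_le_sum _). simpl. unfold Rminus in *. lra. }
  intros [H1 H2].
  destruct (Hcurve _ _ _ H1) as (L1 & r1 & HL1 & Hr1 & A1).
  destruct (Hcurve _ _ _ H2) as (L2 & r2 & HL2 & Hr2 & A2).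
  exists (L1 + L2), (Rmin r1 r2). split; [now apply Rmin_pos|]. intros h Hh. rewrite axis_x, axis_y.
  specialize (A1 h (Rlt_le_trans _ _ _ Hh (Rmin_l _ _))). specialize (A2 h (Rlt_le_trans _ _ _ Hh (Rmin_r _ _))).
  rewrite Cpair_surjective in A1, A2. pose proof (Rabs_pos h). split; nra.
Qed.

Lemma axis_lipschitz_deriv_bound f L r z d : 0 < r -> axis_lipschitz f L r z -> complex_deriv f z d ->
  Cmod d <= 2 * L.
Proof.
  intros Hr H [[H1 H2] _].
  assert (A : forall h, Rabs h < r -> Cmod (f (fst z + h, snd z) - f (fst z, snd z)) <= L * Rabs h).
  { intros h Hh. destruct (H h Hh) as [Hx _]. rewrite axis_x in Hx. rewrite Cpair_surjective. exact Hx. }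
  assert (B1 : Rabs (fst d) <= L).
  { apply (is_derive_bound _ _ _ _ _ Hr H1). intros h Hh.
    apply Rle_trans with (2 := A h Hh). apply (Rabs_fst_le (Cminus (f (fst z + h, snd z)) (f (fst z, snd z)))). }
  assert (B2 : Rabs (snd d) <= L).
  { apply (is_derive_bound _ _ _ _ _ Hr H2). intros h Hh.
    apply Rle_trans with (2 := A h Hh). apply (Rabs_snd_le (Cminus (f (fst z + h, snd z)) (f (fst z, snd z)))). }
  apply Rle_trans with (1 := Cmod_le_sum d). lra.
Qed.

(** A violation is a strict inequality at one fixed [h], hence it persists nearby by continuity of
    [f]. *)
Lemma not_axis_lipschitz_open f L r z :
  (forall w, Cmod (w - z) < r -> continuous_C f w) -> ~ axis_lipschitz f L r z ->
  exists delta, 0 < delta /\ forall w, Cmod (w - z) < delta -> ~ axis_lipschitz f L r w.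
Proof.
  intros Hc Hn.
  assert (Hstep : forall (v : C) (h : R), Rabs h < r -> Cmod v = Rabs h -> 
     L * Rabs h < Cmod (f (z + v)%C - f z) -> exists delta, 0 < delta /\
       forall w, Cmod (w - z) < delta -> L * Rabs h < Cmod (f (w + v)%C - f w)).
  { intros v h Hh Hv Hlt. set (e := (Cmod (f (z + v)%C - f z) - L * Rabs h) / 2).
    assert (He : 0 < e) by (unfold e; lra).
    destruct (Hc (z + v)%C) with (eps := e) as [d1 [Hd1 H1]]; [|exact He|].
    { replace (z + v - z)%C with v by ring. lra. }
    destruct (Hc z) with (eps := e) as [d2 [Hd2 H2]]; [|exact He|].
    { rewrite Cmod_minus_diag. pose proof (Rabs_pos h). lra. }
    exists (Rmin d1 d2). split; [now apply Rmin_pos|]. intros w Hw.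
    assert (A1 : Cmod (f (w + v)%C - f (z + v)%C) < e).
    { apply H1. replace (w + v - (z + v))%C with (w - z)%C by ring. apply (Rlt_le_trans _ _ _ Hw), Rmin_l. }
    assert (A2 : Cmod (f w - f z) < e) by (apply H2, (Rlt_le_trans _ _ _ Hw), Rmin_r).
    pose proof (Cmod_triang_minus (f (z + v)%C) (f (w + v)%C) (f z)) as T1.
    pose proof (Cmod_triang_minus (f (w + v)%C) (f w) (f z)) as T2.
    rewrite Cmod_minus_sym in A1. unfold e in *. lra. }
  apply not_all_ex_not in Hn. destruct Hn as [h Hn]. apply imply_to_and in Hn. destruct Hn as [Hh Hn].
  apply not_and_or in Hn. destruct Hn as [Hn|Hn]; apply Rnot_le_lt in Hn.
  - destruct (Hstep (RtoC h) h Hh (Cmod_R h) Hn) as [d [Hd H]]. exists d. split; [exact Hd|].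
    intros w Hw Ha. destruct (Ha h Hh) as [Ha1 _]. specialize (H w Hw). lra.
  - destruct (Hstep (Ci * h)%C h Hh) as [d [Hd H]].
    { rewrite Cmod_mult, Cmod_Ci, Cmod_R. ring. }
    { exact Hn. }
    exists d. split; [exact Hd|].
    intros w Hw Ha. destruct (Ha h Hh) as [_ Ha1]. specialize (H w Hw). lra.
Qed.

(** Completeness is used in each coordinate; adding the two coordinate errors yields the factor 2,
    which the Baire construction anticipates by controlling balls of twice the radius. *)
Lemma nested_balls (z : nat -> C) (delta : nat -> R) :
  (forall n, 0 < delta n) -> (forall n, delta (S n) <= delta n / 2) ->
  (forall n, Cmod (z (S n) - z n) <= delta n / 2) ->
  exists l, forall n, Cmod (l - z n) <= 2 * delta n.
Proof.
  intros Hd Hhalf Hz.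
  assert (Hm : forall n k, Cmod (z (n + k)%nat - z n) <= delta n - delta (n + k)%nat).
  { intros n k. induction k as [|k IH].
    - rewrite Nat.add_0_r, Cmod_minus_diag. lra.
    - rewrite Nat.add_succ_r. pose proof (Cmod_triang_minus (z (S (n + k))) (z (n + k)%nat) (z n)).
      specialize (Hz (n + k)%nat). specialize (Hhalf (n + k)%nat). lra. }
  assert (Hpow : forall n, delta n <= delta O * (/ 2) ^ n).
  { induction n as [|n IH]; simpl; [lra|]. specialize (Hhalf n). lra. }
  assert (Hsmall : forall e, 0 < e -> exists N, delta N < e).
  { intros e He. destruct (pow_lt_1_zero (/ 2)) with (y := e / delta O) as [N HN].
    - rewrite Rabs_pos_eq; lra.
    - apply Rdiv_lt_0_compat; auto.
    - exists N. specialize (HN N (Nat.le_refl N)). rewrite Rabs_pos_eq in HN by (apply pow_le; lra).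
      apply Rle_lt_trans with (1 := Hpow N).
      apply Rmult_lt_compat_l with (r := delta O) in HN; [|apply Hd].
      replace (delta O * (e / delta O)) with e in HN by (field; apply Rgt_not_eq, Hd). exact HN. }
  assert (Hco : forall pr : C -> R, (forall a b, Rabs (pr a - pr b) <= Cmod (a - b)) ->
    exists l, forall n, Rabs (l - pr (z n)) <= delta n).
  { intros pr Hpr.
    assert (Hb : forall n k, Rabs (pr (z (n + k)%nat) - pr (z n)) <= delta n).
    { intros n k. apply Rle_trans with (1 := Hpr _ _). specialize (Hm n k). specialize (Hd (n + k)%nat). lra. }
    destruct (Rcomplete.R_complete (fun n => pr (z n))) as [l Hl].
    { intros e He. destruct (Hsmall (e / 2)) as [N HN]; [lra|]. exists N. intros n m Hn Hm'.
      unfold Rdist. pose proof (Hb N (n - N)%nat) as B1. pose proof (Hb N (m - N)%nat) as B2.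
      replace (N + (n - N))%nat with n in B1 by lia. replace (N + (m - N))%nat with m in B2 by lia.
      apply Rabs_le_between in B1, B2. apply Rabs_lt_between. lra. }
    exists l. intros n. apply le_epsilon. intros e He.
    destruct (Hl e He) as [N HN]. specialize (HN (n + N)%nat ltac:(lia)).
    unfold Rdist in HN. specialize (Hb n N). apply Rabs_lt_between in HN. apply Rabs_le_between in Hb.
    apply Rabs_le_between. lra. }
  destruct (Hco fst) as [l1 H1].
  { intros a b. apply (Rabs_fst_le (a - b)). }
  destruct (Hco snd) as [l2 H2].
  { intros a b. apply (Rabs_snd_le (a - b)). }
  exists (l1, l2). intros n. apply Rle_trans with (1 := Cmod_le_sum _). simpl.
  specialize (H1 n). specialize (H2 n). unfold Rminus in *. lra.
Qed.

(** * The Baire category argument *)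

Section LipschitzPortion.
Variables (f : C -> C) (Om : C -> Prop).
Hypothesis Om_open : forall z, Om z -> exists delta, 0 < delta /\ forall w, Cmod (w - z) < delta -> Om w.
Hypothesis f_cont : forall z, Om z -> continuous_C f z.
Hypothesis f_deriv : forall z, Om z -> exists d, complex_deriv f z d.

Let E (z : C) : Prop := Om z /\ ~ deriv_bounded f z.

(* Baire's theorem in the closed set [E], exhausted by the closed sets of points with a given axis
   Lipschitz constant. *)
Lemma lipschitz_portion z0 : E z0 -> exists z1 delta L, E z1 /\ 0 < delta /\ 0 <= L /\
  (forall w, Cmod (w - z1) < delta -> Om w /\ Cmod (f w - f z1) < 1) /\
  (forall w, E w -> Cmod (w - z1) < delta -> axis_lipschitz f L (2 * delta) w).
Proof.
  intros [Hz0 Hbad0]. destruct (Om_open z0 Hz0) as [r0 [Hr0 HOm]].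
  (* A quarter of [r0], so that centres, nearby points and axis steps of length at most [r] all stay
     in the disc where [Om] holds. *)
  set (r := r0 / 4). assert (Hr : 0 < r) by (unfold r; lra).
  set (rn := fun n : nat => r / (INR n + 1)).
  assert (Hrn : forall n, 0 < rn n <= r).
  { intros n. unfold rn. pose proof (pos_INR n). split; [apply Rdiv_lt_0_compat; lra|].
    apply Rmult_le_reg_r with (INR n + 1); [lra|].
    replace (r / (INR n + 1) * (INR n + 1)) with r by (field; lra). nra. }
  set (bad := fun (n : nat) w => ~ axis_lipschitz f (INR n) (rn n) w).
  assert (HP : exists n z1 delta, E z1 /\ Cmod (z1 - z0) < r /\ 0 < delta /\
     forall w, E w -> Cmod (w - z1) < delta -> axis_lipschitz f (INR n) (rn n) w).
  { apply NNPP. intros Hno.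
    (* A pair is a centre and a radius, and the bound on [Cmod (fst p - z0) + 2 * snd p] keeps the
       limit of the centres near [z0]. When the premises fail, the pair itself serves as a vacuous
       witness, since [choice] needs a total relation. *)
    assert (Hstep : forall (n : nat) (p : C * R), exists p' : C * R,
      E (fst p) -> 0 < snd p -> Cmod (fst p - z0) + 2 * snd p < r ->
      E (fst p') /\ 0 < snd p' /\ snd p' <= snd p / 2 /\ Cmod (fst p' - fst p) <= snd p / 2 /\
      Cmod (fst p' - z0) + 2 * snd p' < r /\
      forall w, Cmod (w - fst p') <= 2 * snd p' -> bad n w).
    { intros n [z d]. simpl.
      destruct (classic (E z /\ 0 < d /\ Cmod (z - z0) + 2 * d < r)) as [(Ez & Hd & Hzd)|Hn].
      2:{ exists (z, d). tauto. }
      destruct (classic (exists w, E w /\ Cmod (w - z) < d / 2 /\ bad n w)) as [(w & Ew & Hw & Hb)|Hn].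
      2:{ exfalso. apply Hno. exists n, z, (d / 2). split; [exact Ez|]. split; [lra|]. split; [lra|].
          intros w Ew Hw. apply NNPP. intros Hb. apply Hn. now exists w. }
      destruct (not_axis_lipschitz_open f (INR n) (rn n) w) as [d' [Hd' H]].
      { intros v Hv. apply f_cont, HOm. specialize (Hrn n).
        pose proof (Cmod_triang_minus v w z0). pose proof (Cmod_triang_minus w z z0). unfold r in *. lra. }
      { exact Hb. }
      exists (w, Rmin (d / 2) (d' / 3)). intros _ _ _. simpl.
      pose proof (Rmin_l (d / 2) (d' / 3)). pose proof (Rmin_r (d / 2) (d' / 3)).
      pose proof (Cmod_triang_minus w z z0).
      assert (Hmp : 0 < Rmin (d / 2) (d' / 3)) by (apply Rmin_pos; lra).
      split; [exact Ew|]. split; [exact Hmp|]. split; [lra|]. split; [lra|]. split; [lra|].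
      intros v Hv. apply H. lra. }
    destruct (choice (fun (np : nat * (C * R)) (p' : C * R) =>
      E (fst (snd np)) -> 0 < snd (snd np) -> Cmod (fst (snd np) - z0) + 2 * snd (snd np) < r ->
      E (fst p') /\ 0 < snd p' /\ snd p' <= snd (snd np) / 2 /\ Cmod (fst p' - fst (snd np)) <= snd (snd np) / 2 /\
      Cmod (fst p' - z0) + 2 * snd p' < r /\
      forall w, Cmod (w - fst p') <= 2 * snd p' -> bad (fst np) w)) as [F HF].
    { intros [n p]. apply Hstep. }
    set (s := fix s (n : nat) : C * R := match n with O => (z0, r / 3) | S m => F (m, s m) end).
    assert (Hs : forall n, E (fst (s n)) /\ 0 < snd (s n) /\ Cmod (fst (s n) - z0) + 2 * snd (s n) < r).
    { induction n as [|n IH].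
      - simpl. rewrite Cmod_minus_diag. split; [split; assumption|]. lra.
      - destruct IH as (I1 & I2 & I3). destruct (HF (n, s n) I1 I2 I3) as (J1 & J2 & J3 & J4 & J5 & J6).
        simpl. tauto. }
    destruct (nested_balls (fun n => fst (s n)) (fun n => snd (s n))) as [l Hl].
    { intros n. apply Hs. }
    { intros n. destruct (Hs n) as (I1 & I2 & I3). apply (HF (n, s n) I1 I2 I3). }
    { intros n. destruct (Hs n) as (I1 & I2 & I3). apply (HF (n, s n) I1 I2 I3). }
    assert (Hlr : Cmod (l - z0) < r).
    { specialize (Hl O). simpl in Hl. lra. }
    assert (HOl : Om l) by (apply HOm; unfold r in *; lra).
    assert (Hbad : forall n, bad n l).
    { intros n. destruct (Hs n) as (I1 & I2 & I3). destruct (HF (n, s n) I1 I2 I3) as (_ & _ & _ & _ & _ & J6).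
      apply J6. apply (Hl (S n)). }
    destruct (f_deriv l HOl) as [d Hd].
    destruct (complex_deriv_axis_lipschitz f l d Hd) as (L & rho & Hrho & HL).
    (* The limit [l] violates the condition for every [n], but its derivative gives a constant [L]
       on a radius [rho]; an [n] above both [L] and [r / rho] is contradictory. *)
    destruct (INR_unbounded (Rmax L (r / rho))) as [n Hn].
    apply (Hbad n). intros h Hh.
    assert (HLn : L <= INR n) by (pose proof (Rmax_l L (r / rho)); lra).
    assert (Hrr : rn n < rho).
    { unfold rn. pose proof (pos_INR n). apply Rmult_lt_reg_r with (INR n + 1); [lra|].
      replace (r / (INR n + 1) * (INR n + 1)) with r by (field; lra).
      assert (H2 : r / rho < INR n + 1) by (pose proof (Rmax_r L (r / rho)); lra).
      apply Rmult_lt_compat_r with (r := rho) in H2; [|exact Hrho].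
      replace (r / rho * rho) with r in H2 by (field; lra). lra. }
    destruct (HL h ltac:(lra)) as [A1 A2]. pose proof (Rabs_pos h). split; nra. }
  destruct HP as (n & z1 & d1 & Ez1 & Hz1 & Hd1 & HP).
  destruct (f_cont z1 (proj1 Ez1) 1 Rlt_0_1) as [d2 [Hd2 H2]].
  (* Two points of the [delta]-disc can be [2 * delta] apart, so the axis bound must reach that far;
     hence half of [rn n]. *)
  set (delta := Rmin (rn n / 2) (Rmin d1 d2)).
  assert (Hb : 0 < delta /\ delta <= rn n / 2 /\ delta <= d1 /\ delta <= d2).
  { unfold delta. specialize (Hrn n). split; [repeat apply Rmin_pos; lra|].
    split; [apply Rmin_l|]. split.
    - apply Rle_trans with (1 := Rmin_r _ _), Rmin_l.
    - apply Rle_trans with (1 := Rmin_r _ _), Rmin_r. }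
  exists z1, delta, (INR n). split; [exact Ez1|]. split; [lra|]. split; [apply pos_INR|]. split.
  - intros w Hw. split.
    + apply HOm. specialize (Hrn n). pose proof (Cmod_triang_minus w z1 z0). unfold r in *. lra.
    + apply H2. lra.
  - intros w Ew Hw h Hh. apply HP; auto; lra.
Qed.
End LipschitzPortion.

(** Turns a bound on the quotient at a boundary point into the nearby bound with slack that
    [max_principle] expects. *)
Lemma lipschitz_quotient_near (g : C -> C) (zeta w c : C) (K eta : R) :
  continuous_C g zeta -> zeta <> w -> 0 <= K -> 0 < eta -> Cmod (g zeta - c) <= K * Cmod (zeta - w) ->
  exists delta, 0 < delta /\ forall v, Cmod (v - zeta) < delta -> Cmod (g v - c) <= (K + eta) * Cmod (v - w).
Proof.
  intros Hg Hne HK Heta H.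
  set (m := Cmod (zeta - w)) in *.
  assert (Hm : 0 < m).
  { apply Cmod_gt_0. intros Hc. apply Hne. replace zeta with (zeta - w + w)%C by ring. rewrite Hc. ring. }
  destruct (Hg (eta * m / 4)) as [d [Hd H1]]; [assert (0 < eta * m) by (now apply Rmult_lt_0_compat); lra|].
  assert (Hd2 : 0 < eta * m / (4 * (K + 1))).
  { apply Rdiv_lt_0_compat; [now apply Rmult_lt_0_compat|lra]. }
  exists (Rmin d (Rmin (m / 2) (eta * m / (4 * (K + 1))))). split.
  { repeat apply Rmin_pos; lra. }
  intros v Hv.
  assert (V1 : Cmod (v - zeta) < d) by (apply (Rlt_le_trans _ _ _ Hv), Rmin_l).
  assert (V2 : Cmod (v - zeta) < m / 2).
  { apply (Rlt_le_trans _ _ _ Hv), (Rle_trans _ _ _ (Rmin_r _ _)), Rmin_l. }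
  assert (V3 : Cmod (v - zeta) < eta * m / (4 * (K + 1))).
  { apply (Rlt_le_trans _ _ _ Hv), (Rle_trans _ _ _ (Rmin_r _ _)), Rmin_r. }
  specialize (H1 v V1).
  pose proof (Cmod_triang_minus (g v) (g zeta) c) as T1.
  pose proof (Cmod_triang_minus zeta v w) as T2. rewrite (Cmod_minus_sym zeta v) in T2. fold m in T2.
  assert (V4 : K * Cmod (v - zeta) <= eta * m / 4).
  { assert (eta * m / (4 * (K + 1)) * (K + 1) = eta * m / 4) by (field; lra).
    pose proof (Cmod_ge_0 (v - zeta)). nra. }
  assert (V5 : K * m <= K * (Cmod (v - zeta) + Cmod (v - w))) by now apply Rmult_le_compat_l.
  assert (V6 : eta * (m / 2) <= eta * Cmod (v - w)) by (apply Rmult_le_compat_l; lra).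
  lra.
Qed.

(** * Propagation of the Lipschitz bound off the bad set *)

Section LipschitzPropagation.
Variables (f : C -> C) (z1 : C) (delta L : R) (E : C -> Prop).
Hypothesis Hdelta : 0 < delta.
Hypothesis HL : 0 <= L.
Hypothesis E_dec : forall w, Cmod (w - z1) < delta -> ~ E w -> deriv_bounded f w.
Hypothesis f_cont : forall w, Cmod (w - z1) < delta -> continuous_C f w.
Hypothesis f_osc : forall w, Cmod (w - z1) < delta -> Cmod (f w - f z1) < 1.
Hypothesis E_closed : forall w, Cmod (w - z1) < delta -> ~ E w ->
  exists d, 0 < d /\ forall v, Cmod (v - w) < d -> ~ E v.
Hypothesis E_lip : forall w, E w -> Cmod (w - z1) < delta -> axis_lipschitz f L (2 * delta) w.

(** [2 * L] serves between two bad points. [8 / delta] serves on the circle of radius [3/4 * delta]: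
    the oscillation is at most 2, and the distance to a [w] in the half disc is at least
    [delta / 4]. *)
Let K := 2 * L + 8 / delta.

Lemma lipschitz_constant_bounds : 0 < K /\ 2 * L <= K /\ 8 / delta <= K.
Proof. unfold K. assert (0 < 8 / delta) by (apply Rdiv_lt_0_compat; lra). lra. Qed.

Lemma oscillation_le v w : Cmod (v - z1) < delta -> Cmod (w - z1) < delta -> Cmod (f v - f w) <= 2.
Proof.
  intros Hv Hw. apply f_osc in Hv, Hw. pose proof (Cmod_triang_minus (f v) (f z1) (f w)) as T.
  rewrite (Cmod_minus_sym (f z1)) in T. lra.
Qed.

Lemma lipschitz_on_cross w z : E w -> Cmod (w - z1) < delta -> Cmod (z - z1) < delta ->
  fst z = fst w \/ snd z = snd w -> Cmod (f z - f w) <= L * Cmod (z - w).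
Proof.
  intros Ew Hw Hz Hcr.
  pose proof (Cmod_triang_minus z z1 w) as T. rewrite (Cmod_minus_sym z1) in T.
  pose proof (Rabs_fst_le (z - w)) as Hx. pose proof (Rabs_snd_le (z - w)) as Hy. simpl in Hx, Hy.
  destruct Hcr as [Hc|Hc].
  - destruct (E_lip w Ew Hw (snd z - snd w)) as [_ A]; [unfold Rminus; lra|].
    rewrite axis_y in A. replace (snd w + (snd z - snd w)) with (snd z) in A by ring.
    rewrite <- Hc, Cpair_surjective in A. apply Rle_trans with (1 := A). unfold Rminus.
    apply Rmult_le_compat_l; [exact HL|exact Hy].
  - destruct (E_lip w Ew Hw (fst z - fst w)) as [A _]; [unfold Rminus; lra|].
    rewrite axis_x in A. replace (fst w + (fst z - fst w)) with (fst z) in A by ring.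
    rewrite <- Hc, Cpair_surjective in A. apply Rle_trans with (1 := A). unfold Rminus.
    apply Rmult_le_compat_l; [exact HL|exact Hx].
Qed.

(** Move horizontally from [w] and vertically from [z] to the common corner [(fst z, snd w)]. The
    corner may leave the disc, which the radius [2 * delta] of the axis bounds allows. *)
Lemma lipschitz_on_bad w z : E w -> E z -> Cmod (w - z1) < delta -> Cmod (z - z1) < delta ->
  Cmod (f z - f w) <= 2 * L * Cmod (z - w).
Proof.
  intros Ew Ez Hw Hz.
  pose proof (Cmod_triang_minus z z1 w) as T. rewrite (Cmod_minus_sym z1) in T.
  pose proof (Rabs_fst_le (z - w)) as Hx. pose proof (Rabs_snd_le (z - w)) as Hy. simpl in Hx, Hy.
  destruct (E_lip w Ew Hw (fst z - fst w)) as [A _]; [unfold Rminus; lra|].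
  destruct (E_lip z Ez Hz (snd w - snd z)) as [_ B].
  { rewrite Rabs_minus_sym. unfold Rminus; lra. }
  rewrite axis_x in A. rewrite axis_y in B.
  replace (fst w + (fst z - fst w)) with (fst z) in A by ring.
  replace (snd z + (snd w - snd z)) with (snd w) in B by ring.
  rewrite (Rabs_minus_sym (snd w)) in B. rewrite Cmod_minus_sym in B. unfold Rminus in A, B.
  pose proof (Cmod_triang_minus (f z) (f (fst z, snd w)) (f w)) as T2.
  assert (L * Rabs (fst z + - fst w) <= L * Cmod (z - w)) by (now apply Rmult_le_compat_l).
  assert (L * Rabs (snd z + - snd w) <= L * Cmod (z - w)) by (now apply Rmult_le_compat_l).
  lra.
Qed.

(* Phragmen-Lindelof at the corner [w] of each quadrant: the quotient is only known to be
   [o (1 / |z - w|)] there, which the factor [exp (- eps (s1 + i s2) / (z - w))] absorbs. *)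
Lemma lipschitz_from_bad w z : E w -> Cmod (w - z1) < delta / 2 -> Cmod (z - z1) < 3 / 4 * delta ->
  Cmod (f z - f w) <= K * Cmod (z - w).
Proof.
  intros Ew Hw Hz. pose proof lipschitz_constant_bounds as (HK & HK1 & HK2).
  assert (Hw' : Cmod (w - z1) < delta) by lra.
  destruct (classic (E z)) as [Ez|Ez].
  { apply Rle_trans with (2 * L * Cmod (z - w)); [apply lipschitz_on_bad; auto; lra|].
    apply Rmult_le_compat_r; [apply Cmod_ge_0|lra]. }
  destruct (classic (fst z = fst w \/ snd z = snd w)) as [Hcr|Hcr].
  { apply Rle_trans with (L * Cmod (z - w)); [apply lipschitz_on_cross; auto; lra|].
    apply Rmult_le_compat_r; [apply Cmod_ge_0|lra]. }
  (* The signs select the open quadrant at [w] containing [z]. Its boundary rays lie on the cross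
     through [w], where the axis bound already controls [f]. *)
  assert (Hsign : exists s1 s2, (s1 = 1 \/ s1 = -1) /\ (s2 = 1 \/ s2 = -1) /\
     0 < s1 * (fst z - fst w) /\ 0 < s2 * (snd z - snd w)).
  { assert (Hone : forall t, t <> 0 -> exists s, (s = 1 \/ s = -1) /\ 0 < s * t).
    { intros t Ht. destruct (Rtotal_order t 0) as [H|[H|H]]; [exists (-1)|contradiction|exists 1]; lra. }
    destruct (Hone (fst z - fst w)) as [s1 [H1 H1']]; [lra|].
    destruct (Hone (snd z - snd w)) as [s2 [H2 H2']]; [lra|].
    exists s1, s2. auto. }
  destruct Hsign as (s1 & s2 & Hs1 & Hs2 & Hzs1 & Hzs2).
  set (D := fun v : C => Cmod (v - z1) < 3 / 4 * delta /\ ~ E v /\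
      0 < s1 * (fst v - fst w) /\ 0 < s2 * (snd v - snd w)).
  assert (Hne : forall v, D v -> (v - w)%C <> 0%C).
  { intros v (_ & _ & H & _) Hc. assert (Hf : fst (v - w)%C = 0) by (rewrite Hc; reflexivity).
    simpl in Hf. replace (fst v - fst w) with 0 in H by lra. lra. }
  assert (Hquot : forall c v, (v - w)%C <> 0%C -> Cmod (f v - f w) <= c * Cmod (v - w) ->
     Cmod ((f v - f w) * / (v - w))%C <= c).
  { intros c v Hv Hc. rewrite Cmod_mult, Cmod_inv by exact Hv. apply Cmod_gt_0 in Hv.
    apply Rmult_le_reg_r with (Cmod (v - w)); [exact Hv|]. rewrite Rmult_assoc, Rinv_l by lra. lra. }
  (* The real part of [(s1 - i s2)(v - w)] up to conjugation of signs, that is [s1 x + s2 y]: on the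
     quadrant it dominates [|v - w|], so the modulus of the auxiliary factor is at most
     [exp (- eps / |v - w|)]. *)
  set (xi := fun v : C => s1 * (fst v - fst w) + s2 * (snd v - snd w)).
  assert (Hxi : forall v, D v -> Cmod (v - w) <= xi v).
  { intros v (_ & _ & H1 & H2). apply Rle_trans with (1 := Cmod_le_sum _). simpl. unfold xi.
    unfold Rminus in *. apply Rplus_le_compat; unfold Rabs;
     destruct Hs1 as [->| ->], Hs2 as [->| ->]; repeat destruct Rcase_abs; lra. }
  assert (HMP : forall eps, 0 < eps ->
     Cmod ((f z - f w) * / (z - w))%C * exp (- eps * (xi z / (Cmod (z - w) * Cmod (z - w)))) <= K).
  { intros eps Heps.
    set (b := (- eps * s1, - eps * s2) : C).
    set (G := fun v => ((f v - f w) * / (v - w) * Cexp (b * / (v - w)))%C).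
    assert (HG : forall v, D v -> Cmod (G v) = Cmod ((f v - f w) * / (v - w))%C
        * exp (- eps * (xi v / (Cmod (v - w) * Cmod (v - w))))).
    { intros v Hv. unfold G. rewrite Cmod_mult, Cmod_Cexp. f_equal. f_equal.
      pose proof (Hne v Hv) as Hn. apply Csq_norm_pos in Hn. rewrite Cmod_sq. unfold b. simpl in Hn |- *. unfold xi. field.
      unfold Rminus. lra. }
    assert (Dz : D z) by (unfold D; auto).
    rewrite <- HG by exact Dz.
    apply (max_principle D G (Cmod z1 + delta) K); [lra| | | | |exact Dz].
    - intros v (H1 & H2 & H3 & H4).
      destruct (E_closed v) as [d [Hd Hcl]]; [lra|exact H2|].
      set (a := s1 * (fst v - fst w)) in *. set (a' := s2 * (snd v - snd w)) in *.
      exists (Rmin (3 / 4 * delta - Cmod (v - z1)) (Rmin d (Rmin a a'))).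
      split; [repeat apply Rmin_pos; lra|]. intros u Hu.
      assert (U1 : Cmod (u - v) < 3 / 4 * delta - Cmod (v - z1)) by (apply (Rlt_le_trans _ _ _ Hu), Rmin_l).
      assert (U2 : Cmod (u - v) < d).
      { apply (Rlt_le_trans _ _ _ Hu), (Rle_trans _ _ _ (Rmin_r _ _)), Rmin_l. }
      assert (U3 : Cmod (u - v) < a).
      { apply (Rlt_le_trans _ _ _ Hu), (Rle_trans _ _ _ (Rmin_r _ _)), (Rle_trans _ _ _ (Rmin_r _ _)), Rmin_l. }
      assert (U4 : Cmod (u - v) < a').
      { apply (Rlt_le_trans _ _ _ Hu), (Rle_trans _ _ _ (Rmin_r _ _)), (Rle_trans _ _ _ (Rmin_r _ _)), Rmin_r. }
      pose proof (Cmod_triang_minus u v z1). 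
      pose proof (Rabs_fst_le (u - v)) as Hx. pose proof (Rabs_snd_le (u - v)) as Hy. simpl in Hx, Hy.
      apply Rabs_le_between in Hx, Hy.
      split; [lra|]. split; [now apply Hcl|].
      unfold a, a' in *. split.
      + destruct Hs1 as [->| ->]; lra.
      + destruct Hs2 as [->| ->]; lra.
    - intros v (H1 & _). pose proof (Cmod_le_minus v z1). lra.
    - intros v Hv. pose proof (Hne v Hv) as Hn. destruct Hv as (H1 & H2 & _).
      assert (Hinv : deriv_bounded (fun u => / (u - w))%C v).
      { apply (deriv_bounded_inv (fun u => u - w)%C); [|exact Hn].
        apply (deriv_bounded_minus (fun u => u) (fun _ => w)); [apply deriv_bounded_id|apply deriv_bounded_const]. }
      unfold G. apply deriv_bounded_mult.
      + apply (deriv_bounded_mult (fun u => f u - f w)%C); [|exact Hinv].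
        apply (deriv_bounded_minus f (fun _ => f w)); [|apply deriv_bounded_const].
        apply E_dec; [lra|exact H2].
      + apply (deriv_bounded_exp (fun u => b * / (u - w))%C).
        apply deriv_bounded_mult; [apply deriv_bounded_const|exact Hinv].
    - intros zeta Hzeta Hcl eta Heta.
      assert (Hz34 : Cmod (zeta - z1) <= 3 / 4 * delta).
      { apply le_epsilon. intros e He. destruct (Hcl e He) as [v [(Hv & _) Hvz]].
        pose proof (Cmod_triang_minus zeta v z1) as T. rewrite (Cmod_minus_sym zeta v) in T. lra. }
      assert (Hzd : Cmod (zeta - z1) < delta) by lra.
      destruct (classic (zeta = w)) as [->|Hzw].
      (* With [t = |v - w|], the quotient is at most [2 / t] and the exponential factor at most
         [4 t^2 / eps^2]; the product [8 t / eps^2] is below [eta] for this choice of [d]. *)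
      + set (d := Rmin (delta / 2) (eta * (eps * eps) / 8)).
        assert (Hd : 0 < d).
        { apply Rmin_pos; [lra|]. assert (0 < eta * (eps * eps)) by (repeat apply Rmult_lt_0_compat; lra). lra. }
        exists d. split; [exact Hd|]. intros v Dv Hv. rewrite HG by exact Dv.
        pose proof (Hne v Dv) as Hn. assert (Ht := proj1 (Cmod_gt_0 _) Hn).
        specialize (Hxi v Dv). set (t := Cmod (v - w)) in *.
        assert (Hvd : Cmod (v - z1) < delta) by (destruct Dv; lra).
        assert (Q : Cmod ((f v - f w) * / (v - w))%C <= 2 / t).
        { apply Hquot; [exact Hn|]. fold t. replace (2 / t * t) with 2 by (field; lra). now apply oscillation_le. }
        assert (X : exp (- eps * (xi v / (t * t))) <= 4 * (t * t) / (eps * eps)).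
        (* The factor is at most [exp (- y)], and [exp y >= (1 + y / 2)^2 >= y^2 / 4]. *)
        { set (y := eps / t). assert (Hy : 0 < y) by (unfold y; now apply Rdiv_lt_0_compat).
          assert (Hey : y * y / 4 <= exp y).
          { replace y with (y / 2 + y / 2) at 3 by lra. rewrite exp_plus.
            assert (1 + y / 2 <= exp (y / 2)) by apply exp_ineq1_le. nra. }
          assert (Hle : - eps * (xi v / (t * t)) <= - y).
          { unfold y. assert (/ t <= xi v / (t * t)).
            { apply Rmult_le_reg_r with (t * t); [now apply Rmult_lt_0_compat|].
              replace (/ t * (t * t)) with t by (field; lra).
              replace (xi v / (t * t) * (t * t)) with (xi v) by (field; lra). exact Hxi. }
            unfold Rdiv at 2. nra. }
          apply Rle_trans with (exp (- y)).
          { destruct Hle as [Hlt|Heq]; [now apply Rlt_le, exp_increasing|rewrite Heq; lra]. }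
          rewrite exp_Ropp. replace (4 * (t * t) / (eps * eps)) with (/ (y * y / 4)) by (unfold y; field; lra).
          apply Rinv_le_contravar; [nra|exact Hey]. }
        apply Rle_trans with (2 / t * (4 * (t * t) / (eps * eps))).
        * apply Rmult_le_compat; auto using Cmod_ge_0. apply Rlt_le, exp_pos.
        * replace (2 / t * (4 * (t * t) / (eps * eps))) with (8 * t / (eps * eps)) by (field; lra).
          assert (Ht2 : t < eta * (eps * eps) / 8) by (apply (Rlt_le_trans _ _ _ Hv), Rmin_r).
          assert (8 * t / (eps * eps) <= eta); [|lra].
          apply Rmult_le_reg_r with (eps * eps); [now apply Rmult_lt_0_compat|].
          replace (8 * t / (eps * eps) * (eps * eps)) with (8 * t) by (field; lra). lra.
      + assert (Hb : Cmod (f zeta - f w) <= K * Cmod (zeta - w)).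
        { assert (Hpos := Cmod_ge_0 (zeta - w)).
          destruct (classic (E zeta)) as [Ez'|Ez'].
          { apply Rle_trans with (1 := lipschitz_on_bad w zeta Ew Ez' Hw' Hzd). now apply Rmult_le_compat_r. }
          destruct (classic (fst zeta = fst w \/ snd zeta = snd w)) as [Hcr'|Hcr'].
          { apply Rle_trans with (1 := lipschitz_on_cross w zeta Ew Hw' Hzd Hcr').
            apply Rmult_le_compat_r; lra. }
          (* A limit of points of the quadrant that avoids the cross is still in the open quadrant;
             being neither bad nor in [D], it can only lie on the outer arc. *)
          assert (Hge : 3 / 4 * delta <= Cmod (zeta - z1)).
          { apply Rnot_lt_le. intros Hlt. apply Hzeta.
            assert (Hq : forall (pr : C -> R) s, (s = 1 \/ s = -1) ->
               (forall a b, Rabs (pr a - pr b) <= Cmod (a - b)) ->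
               (forall v, D v -> 0 < s * (pr v - pr w)) -> pr zeta <> pr w -> 0 < s * (pr zeta - pr w)).
            { intros pr s Hs Hpr HD Hnz. apply Rnot_le_lt. intros Hle.
              set (m := - (s * (pr zeta - pr w))).
              assert (Hm : 0 < m).
              { unfold m. destruct Hs as [->| ->]; lra. }
              destruct (Hcl m Hm) as [v [Dv Hv]]. specialize (HD v Dv). specialize (Hpr v zeta).
              unfold m in Hv. apply Rabs_le_between in Hpr. destruct Hs as [->| ->]; lra. }
            split; [exact Hlt|]. split; [exact Ez'|]. split.
            - apply (Hq fst s1); auto.
              + intros u v. apply (Rabs_fst_le (u - v)).
              + intros v Dv. apply Dv.
            - apply (Hq snd s2); auto.
              + intros u v. apply (Rabs_snd_le (u - v)).
              + intros v Dv. apply Dv. }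
          apply Rle_trans with 2; [now apply oscillation_le|].
          pose proof (Cmod_triang_minus zeta w z1) as T.
          assert (8 / delta * (delta / 4) <= K * Cmod (zeta - w)).
          { apply Rmult_le_compat; try lra. apply Rlt_le, Rdiv_lt_0_compat; lra. }
          replace (8 / delta * (delta / 4)) with 2 in * by (field; lra). lra. }
        destruct (lipschitz_quotient_near f zeta w (f w) K eta) as [d [Hd H]]; auto; [lra|].
        exists d. split; [exact Hd|]. intros v Dv Hv. rewrite HG by exact Dv.
        pose proof (Hne v Dv) as Hn. specialize (H v Hv). apply (Hquot _ _ Hn) in H.
        apply Rle_trans with (2 := H). rewrite <- (Rmult_1_r (Cmod ((f v - f w) * / (v - w))%C)) at 2.
        apply Rmult_le_compat_l; [apply Cmod_ge_0|].
        rewrite <- exp_0. assert (Hx0 : 0 < xi v / (Cmod (v - w) * Cmod (v - w))).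
        { apply Cmod_gt_0 in Hn. specialize (Hxi v Dv). apply Rdiv_lt_0_compat; [lra|]. now apply Rmult_lt_0_compat. }
        apply Rlt_le, exp_increasing. assert (0 < eps * (xi v / (Cmod (v - w) * Cmod (v - w)))) by now apply Rmult_lt_0_compat. lra. }
  apply le_of_exp_decay in HMP; [|apply Cmod_ge_0].
  assert (Dz : D z) by (unfold D; auto). pose proof (Hne z Dz) as Hn.
  rewrite Cmod_mult, Cmod_inv in HMP by exact Hn. apply Cmod_gt_0 in Hn.
  apply Rmult_le_compat_r with (r := Cmod (z - w)) in HMP; [|lra].
  rewrite Rmult_assoc, Rinv_l in HMP by lra. lra.
Qed.

(* A Schwarz lemma: the [n]-th powers of the quotient [(f - f z) / (. - z)] times [. - z] vanish at [z]. *)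
Lemma lipschitz_off_bad z d : 0 < d -> Cmod (z - z1) + d < delta ->
  (forall v, Cmod (v - z) < d -> ~ E v) ->
  (forall v, Cmod (v - z) <= d -> Cmod (f v - f z) <= 5 * K * d) ->
  forall v, Cmod (v - z) < d -> Cmod (f v - f z) <= (5 * K + 1) * Cmod (v - z).
Proof.
  intros Hd Hdz HE Hosc v0 Hv0. pose proof lipschitz_constant_bounds as (HK & _ & _).
  destruct (classic (v0 = z)) as [->|Hvz]; [rewrite !Cmod_minus_diag; lra|].
  set (D := fun v : C => 0 < Cmod (v - z) < d).
  assert (Hn : forall v, D v -> (v - z)%C <> 0%C) by (intros v [H _]; now apply Cmod_gt_0).
  assert (Dv0 : D v0).
  { split; [|exact Hv0]. apply Cmod_gt_0. intros Hc. apply Hvz.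
    replace v0 with (v0 - z + z)%C by ring. rewrite Hc. ring. }
  set (q := fun v => ((f v - f z) * / (v - z))%C).
  assert (Hquot : forall c v, D v -> Cmod (f v - f z) <= c * Cmod (v - z) -> Cmod (q v) <= c).
  { intros c v Hv Hc. unfold q. rewrite Cmod_mult, Cmod_inv by now apply Hn. destruct Hv as [Hv _].
    apply Rmult_le_reg_r with (Cmod (v - z)); [exact Hv|]. rewrite Rmult_assoc, Rinv_l by lra. lra. }
  assert (Hpow : forall n, Cmod (q v0) ^ n * Cmod (v0 - z) <= (5 * K + 1) ^ n * d).
  { intros n. set (G := fun v => (Cpow (q v) n * (v - z))%C).
    assert (HG : forall v, Cmod (G v) = Cmod (q v) ^ n * Cmod (v - z)).
    { intros v. unfold G. now rewrite Cmod_mult, Cmod_pow. }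
    rewrite <- HG. assert (HKn : 0 <= (5 * K + 1) ^ n) by (apply pow_le; lra).
    apply (max_principle D G (Cmod z1 + delta)); [apply Rmult_le_pos; lra| | | | |exact Dv0].
    - intros v [H1 H2]. exists (Rmin (Cmod (v - z)) (d - Cmod (v - z))). split; [apply Rmin_pos; lra|].
      intros u Hu.
      assert (U1 : Cmod (u - v) < Cmod (v - z)) by (apply (Rlt_le_trans _ _ _ Hu), Rmin_l).
      assert (U2 : Cmod (u - v) < d - Cmod (v - z)) by (apply (Rlt_le_trans _ _ _ Hu), Rmin_r).
      pose proof (Cmod_triang_minus u v z). pose proof (Cmod_triang_minus v u z) as T.
      rewrite (Cmod_minus_sym v u) in T. unfold D. lra.
    - intros v [H1 H2]. pose proof (Cmod_le_minus v z1). pose proof (Cmod_triang_minus v z z1). lra.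
    - intros v Hv.
      assert (Hsub : deriv_bounded (fun u => u - z)%C v).
      { apply (deriv_bounded_minus (fun u => u) (fun _ => z)); [apply deriv_bounded_id|apply deriv_bounded_const]. }
      unfold G. apply deriv_bounded_mult; [|exact Hsub]. apply deriv_bounded_pow. unfold q.
      apply (deriv_bounded_mult (fun u => f u - f z)%C (fun u => / (u - z))%C).
      + apply (deriv_bounded_minus f (fun _ => f z)); [|apply deriv_bounded_const].
        destruct Hv as [_ Hv]. apply E_dec; [|now apply HE].
        pose proof (Cmod_triang_minus v z z1). lra.
      + apply (deriv_bounded_inv (fun u => u - z)%C); [exact Hsub|now apply Hn].
    - intros zeta Hzeta Hcl eta Heta.
      destruct (classic (zeta = z)) as [->|Hzz].
      (* At the puncture the quotient is only known to be bounded by some [4 * N] unrelated to [K];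
         the extra factor [v - z] removes its contribution. *)
      + destruct (E_dec z) as (r & N & Hr & HN); [lra|apply HE; rewrite Cmod_minus_diag; exact Hd|].
        assert (HN0 : 0 <= N).
        { destruct (HN z) as [e [_ He]]; [rewrite Cmod_minus_diag; exact Hr|]. pose proof (Cmod_ge_0 e). lra. }
        assert (HNn : 0 <= (4 * N) ^ n) by (apply pow_le; lra).
        assert (Hm : 0 < eta / ((4 * N) ^ n + 1)) by (apply Rdiv_lt_0_compat; lra).
        exists (Rmin r (eta / ((4 * N) ^ n + 1))). split; [now apply Rmin_pos|]. intros v Dv Hv.
        assert (V1 : Cmod (v - z) < r) by (apply (Rlt_le_trans _ _ _ Hv), Rmin_l).
        assert (V2 : Cmod (v - z) < eta / ((4 * N) ^ n + 1)) by (apply (Rlt_le_trans _ _ _ Hv), Rmin_r).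
        pose proof (deriv_bounded_lipschitz f z r N HN v V1) as Hl. apply (Hquot _ _ Dv) in Hl.
        rewrite HG. assert (P : Cmod (q v) ^ n <= (4 * N) ^ n) by (apply pow_incr; split; [apply Cmod_ge_0|exact Hl]).
        destruct Dv as [D1 _].
        assert (Hid : eta / ((4 * N) ^ n + 1) * ((4 * N) ^ n + 1) = eta) by (field; lra).
        assert (Cmod (q v) ^ n * Cmod (v - z) <= (4 * N) ^ n * Cmod (v - z)) by (apply Rmult_le_compat_r; lra).
        assert (0 <= (5 * K + 1) ^ n * d) by (apply Rmult_le_pos; lra). nra.
      + assert (Hle : Cmod (zeta - z) <= d).
        { apply le_epsilon. intros e He. destruct (Hcl e He) as [v [[_ Hv] Hvz']].
          pose proof (Cmod_triang_minus zeta v z) as T. rewrite (Cmod_minus_sym zeta v) in T. lra. }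
        assert (Heq : Cmod (zeta - z) = d).
        { apply Rle_antisym; [exact Hle|]. apply Rnot_lt_le. intros Hlt. apply Hzeta. split; [|exact Hlt].
          apply Cmod_gt_0. intros Hc. apply Hzz. replace zeta with (zeta - z + z)%C by ring. rewrite Hc. ring. }
        (* The slack 1 is the origin of [5 * K + 1]. It does not depend on [d], so the final bound
           is uniform. *)
        destruct (lipschitz_quotient_near f zeta z (f z) (5 * K) 1) as [r [Hr H]]; auto; try lra.
        { apply f_cont. pose proof (Cmod_triang_minus zeta z z1). lra. }
        { rewrite Heq. now apply Hosc. }
        exists r. split; [exact Hr|]. intros v Dv Hv. specialize (H v Hv). apply (Hquot _ _ Dv) in H.
        rewrite HG. assert (P : Cmod (q v) ^ n <= (5 * K + 1) ^ n) by (apply pow_incr; split; [apply Cmod_ge_0|exact H]).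
        destruct Dv as [D1 D2].
        assert (Cmod (q v) ^ n * Cmod (v - z) <= (5 * K + 1) ^ n * d).
        { apply Rmult_le_compat; try lra. apply pow_le, Cmod_ge_0. }
        lra. }
  apply le_of_pow_le in Hpow; [|apply Cmod_ge_0|lra|apply Dv0].
  unfold q in Hpow. rewrite Cmod_mult, Cmod_inv in Hpow by now apply Hn.
  destruct Dv0 as [D1 D2]. apply Rmult_le_compat_r with (r := Cmod (v0 - z)) in Hpow; [|lra].
  rewrite Rmult_assoc, Rinv_l in Hpow by lra. lra.
Qed.

(** Let [d] be the distance from a good point [z] to the bad set. The disc of radius [d] at [z] is
    free of bad points, and some bad [e] lies within [2 d]. Comparing through [e] gives oscillation
    at most [K (3 d + 2 d)], and the Schwarz-type lemma turns this into a derivative bound in which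
    [d] cancels. The radius [delta / 16] keeps [e] within [delta / 2] of [z1]. *)
Lemma deriv_bound_near z d0 : E z1 -> Cmod (z - z1) < delta / 16 -> complex_deriv f z d0 ->
  Cmod d0 <= 2 * (5 * K + 1).
Proof.
  intros Ez1 Hz Hd0. pose proof lipschitz_constant_bounds as (HK & HK1 & HK2).
  destruct (classic (E z)) as [Ez|Ez].
  { apply Rle_trans with (2 * L); [|lra].
    apply (axis_lipschitz_deriv_bound f L (2 * delta) z d0); auto; [lra|]. apply E_lip; auto; lra. }
  (* The infimum of distances is obtained as minus the supremum of their opposites. It need not be
     attained, hence the factor 2 in the choice of [e]. *)
  set (dist := fun y => exists e, E e /\ Cmod (e - z1) < delta /\ y = - Cmod (z - e)).
  destruct (completeness dist) as [S [HS1 HS2]].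
  { exists 0. intros y (e & _ & _ & ->). pose proof (Cmod_ge_0 (z - e)). lra. }
  { exists (- Cmod (z - z1)). exists z1. rewrite Cmod_minus_diag. auto. }
  set (d := - S).
  assert (Hinf : forall e, E e -> Cmod (e - z1) < delta -> d <= Cmod (z - e)).
  { intros e He1 He2. assert (- Cmod (z - e) <= S) by (apply HS1; now exists e). unfold d. lra. }
  assert (Hd16 : d < delta / 16).
  { apply Rle_lt_trans with (2 := Hz). apply Hinf; [exact Ez1|]. rewrite Cmod_minus_diag. exact Hdelta. }
  assert (Hd : 0 < d).
  { destruct (E_closed z) as [r [Hr H]]; [lra|exact Ez|].
    assert (S <= - r); [|unfold d; lra]. apply HS2. intros y (e & He1 & He2 & ->).
    assert (r <= Cmod (z - e)); [|lra]. apply Rnot_lt_le. intros Hlt. rewrite Cmod_minus_sym in Hlt.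
    now apply (H e). }
  assert (He : exists e, E e /\ Cmod (e - z1) < delta /\ Cmod (z - e) < 2 * d).
  { apply NNPP. intros Hno. assert (S <= - (2 * d)); [|unfold d in *; lra]. apply HS2.
    intros y (e & He1 & He2 & ->). apply Ropp_le_contravar, Rnot_lt_le. intros Hlt. apply Hno. now exists e. }
  destruct He as (e & He1 & He2 & He3).
  assert (He4 : Cmod (e - z1) < delta / 2).
  { pose proof (Cmod_triang_minus e z z1) as T. rewrite (Cmod_minus_sym e z) in T. lra. }
  assert (Hball : forall v, Cmod (v - z) <= d -> Cmod (v - z1) < delta / 8).
  { intros v Hv. pose proof (Cmod_triang_minus v z z1). lra. }
  assert (HE : forall v, Cmod (v - z) < d -> ~ E v).
  { intros v Hv Ev. assert (Hv1 := Hball v (Rlt_le _ _ Hv)).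
    specialize (Hinf v Ev ltac:(lra)). rewrite Cmod_minus_sym in Hinf. lra. }
  assert (Hosc : forall v, Cmod (v - z) <= d -> Cmod (f v - f z) <= 5 * K * d).
  { intros v Hv. specialize (Hball v Hv).
    pose proof (lipschitz_from_bad e v He1 He4 ltac:(lra)) as A1.
    pose proof (lipschitz_from_bad e z He1 He4 ltac:(lra)) as A2.
    pose proof (Cmod_triang_minus (f v) (f e) (f z)) as T. rewrite (Cmod_minus_sym (f e)) in T.
    pose proof (Cmod_triang_minus v z e).
    assert (K * Cmod (v - e) <= K * (3 * d)) by (apply Rmult_le_compat_l; lra).
    assert (K * Cmod (z - e) <= K * (2 * d)) by (apply Rmult_le_compat_l; lra). lra. }
  apply (axis_lipschitz_deriv_bound f (5 * K + 1) d z d0 Hd); [|exact Hd0].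
  intros h Hh.
  assert (N1 : Cmod (z + h - z)%C = Rabs h).
  { replace (z + h - z)%C with (RtoC h) by ring. apply Cmod_R. }
  assert (N2 : Cmod (z + Ci * h - z)%C = Rabs h).
  { replace (z + Ci * h - z)%C with (Ci * h)%C by ring. rewrite Cmod_mult, Cmod_Ci, Cmod_R. ring. }
  split.
  - rewrite <- N1. apply (lipschitz_off_bad z d); auto; lra.
  - rewrite <- N2. apply (lipschitz_off_bad z d); auto; lra.
Qed.
End LipschitzPropagation.

Theorem looman_menchoff (f : C -> C) (Om : C -> Prop) :
  (forall z, Om z -> exists delta, 0 < delta /\ forall w, Cmod (w - z) < delta -> Om w) ->
  (forall z, Om z -> continuous_C f z) ->
  (forall z, Om z -> exists d, complex_deriv f z d) ->
  forall z, Om z -> deriv_bounded f z.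
Proof.
  intros Hopen Hcont Hder z0 Hz0. apply NNPP. intros Hbad.
  destruct (lipschitz_portion f Om Hopen Hcont Hder z0 (conj Hz0 Hbad))
    as (z1 & delta & L & [Hz1 Hb1] & Hdelta & HL & Hball & Hlip).
  apply Hb1.
  exists (delta / 16), (2 * (5 * (2 * L + 8 / delta) + 1)). split; [lra|]. intros w Hw.
  destruct (Hball w ltac:(lra)) as [HOw _]. destruct (Hder w HOw) as [d Hd].
  exists d. split; [exact Hd|].
  apply (deriv_bound_near f z1 delta L (fun z => Om z /\ ~ deriv_bounded f z)) with w; auto.
  - intros v Hv Hn. apply NNPP. intros Hc. apply Hn. split; [|exact Hc]. now apply Hball.
  - intros v Hv. now apply Hcont, Hball.
  - intros v Hv. now apply Hball.
  - intros v Hv Hn. assert (Hg : deriv_bounded f v).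
    { apply NNPP. intros Hc. apply Hn. split; [|exact Hc]. now apply Hball. }
    destruct (deriv_bounded_open f v Hg) as [r [Hr H]]. exists r. split; [exact Hr|].
    intros u Hu [_ Hc]. now apply Hc, H.
Qed.

(** * Phragmen-Lindelof in a sector *)

(** The principal logarithm, with the half-angle formula [arg z = 2 atan (y / (x + |z|))]. Unlike
    [atan (y / x)] it covers the whole slit plane, as sectors of opening beyond [PI] require. *)
Definition Clog (z : C) : C :=
  (ln (fst z * fst z + snd z * snd z) / 2,
   2 * atan (snd z / (fst z + sqrt (fst z * fst z + snd z * snd z)))).

(** The complement of the nonpositive real axis, written as positivity of the denominator in
    [Clog]. *)
Definition slit_plane (z : C) : Prop := 0 < fst z + Cmod z.

Lemma Cmod_sqrt (z : C) : Cmod z = sqrt (fst z * fst z + snd z * snd z).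
Proof. unfold Cmod. f_equal. ring. Qed.

Lemma slit_plane_neq0 z : slit_plane z -> z <> 0%C.
Proof. unfold slit_plane. intros H ->. rewrite Cmod_0 in H. simpl in H. lra. Qed.

Lemma complex_deriv_log z : slit_plane z -> complex_deriv Clog z (/ z)%C.
Proof.
  intros Hz. pose proof (slit_plane_neq0 z Hz) as Hn. apply Csq_norm_pos in Hn.
  unfold slit_plane in Hz. rewrite Cmod_sqrt in Hz.
  assert (Hr := sqrt_lt_R0 _ Hn). assert (Hrr := sqrt_sqrt _ (Rlt_le _ _ Hn)).
  destruct z as [x y]. unfold Clog, complex_deriv, curve_deriv; simpl in *.
  set (r := sqrt (x * x + y * y)) in *.
  assert (Hden : 1 + y / (x + r) * (y / (x + r)) = 2 * r / (x + r)).
  { replace (1 + y / (x + r) * (y / (x + r))) with (((x + r) * (x + r) + y * y) / ((x + r) * (x + r))) by (field; lra).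
    replace ((x + r) * (x + r) + y * y) with (2 * r * (x + r)) by nra. field. lra. }
  split; split.
  - auto_derive; [exact Hn|]. field. lra.
  - auto_derive; [fold r; repeat split; lra|]. fold r. rewrite !Rmult_1_r.
    replace (1 + y * / (x + r) * (y * / (x + r))) with (2 * r / (x + r)) by (symmetry; exact Hden).
    rewrite <- Hrr. field. lra.
  - auto_derive; [exact Hn|]. field. lra.
  - auto_derive; [fold r; repeat split; lra|]. fold r. rewrite !Rmult_1_r.
    replace (1 + y * / (x + r) * (y * / (x + r))) with (2 * r / (x + r)) by (symmetry; exact Hden).
    replace (x * x + y * y) with (r * r) by exact Hrr.
    assert (Hyy : y * y = r * r - x * x) by lra.
    field_simplify_eq; [|lra]. nra.
Qed.

Lemma deriv_bounded_log z : slit_plane z -> deriv_bounded Clog z.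
Proof.
  intros Hz. assert (Hn := proj1 (Cmod_gt_0 _) (slit_plane_neq0 z Hz)).
  unfold slit_plane in Hz.
  exists (Rmin ((fst z + Cmod z) / 2) (Cmod z / 2)), (/ (Cmod z / 2)).
  split; [apply Rmin_pos; lra|]. intros w Hw.
  assert (W1 : Cmod (w - z) < (fst z + Cmod z) / 2) by (apply (Rlt_le_trans _ _ _ Hw), Rmin_l).
  assert (W2 : Cmod (w - z) < Cmod z / 2) by (apply (Rlt_le_trans _ _ _ Hw), Rmin_r).
  pose proof (Cmod_le_minus z w) as T. rewrite Cmod_minus_sym in T.
  pose proof (Rabs_fst_le (w - z)) as Hx. simpl in Hx. apply Rabs_le_between in Hx.
  assert (Hs : slit_plane w) by (unfold slit_plane; lra).
  exists (/ w)%C. split; [now apply complex_deriv_log|].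
  rewrite Cmod_inv by now apply slit_plane_neq0. apply Rinv_le_contravar; lra.
Qed.

Definition of_polar (r th : R) : C := (r * cos th, r * sin th).

Lemma Cmod_of_polar r th : 0 < r -> Cmod (of_polar r th) = r.
Proof.
  intros Hr. rewrite Cmod_sqrt. simpl.
  replace (_ + _) with (r * r * (Rsqr (sin th) + Rsqr (cos th))) by (unfold Rsqr; ring).
  rewrite sin2_cos2, Rmult_1_r. apply sqrt_square. lra.
Qed.

Lemma slit_plane_of_polar r th : 0 < r -> - PI < th < PI -> slit_plane (of_polar r th).
Proof.
  intros Hr Hth. unfold slit_plane. rewrite Cmod_of_polar by exact Hr. simpl.
  assert (Hc : 0 < cos (th / 2)) by (apply cos_gt_0; lra).
  replace th with (2 * (th / 2)) by lra. rewrite cos_2a_cos.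
  assert (0 < r * (cos (th / 2) * cos (th / 2))) by (repeat apply Rmult_lt_0_compat; auto). nra.
Qed.

Lemma Clog_of_polar r th : 0 < r -> - PI < th < PI -> Clog (of_polar r th) = (ln r, th).
Proof.
  intros Hr Hth. pose proof (Cmod_of_polar r th Hr) as Hm. rewrite Cmod_sqrt in Hm.
  pose proof (Cmod_sq (of_polar r th)) as Hs. rewrite (Cmod_of_polar r th Hr) in Hs.
  unfold Clog. rewrite Hm, <- Hs. f_equal.
  - rewrite ln_mult by exact Hr. field.
  - simpl. assert (Hc : 0 < cos (th / 2)) by (apply cos_gt_0; lra).
    replace (r * sin th / (r * cos th + r)) with (tan (th / 2)).
    + rewrite atan_tan by lra. field.
    + unfold tan. replace th with (2 * (th / 2)) at 3 4 by lra. rewrite sin_2a, cos_2a_cos. field.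
      assert (0 < r * (cos (th / 2) * cos (th / 2))) by (repeat apply Rmult_lt_0_compat; auto).
      split; lra.
Qed.

Definition sector (phi : R) (z : C) : Prop :=
  exists r th, 0 < r /\ Rabs th < phi / 2 /\ z = of_polar r th.

Section PhragmenLindelof.
Variables (alpha b M R0 : R) (F : C -> C).
Hypothesis Halpha : alpha > 1 / 2.
Hypothesis Hb : b < alpha.
Hypothesis HM : 0 <= M.
Hypothesis sector_open : forall z, sector (PI / alpha) z -> exists delta, 0 < delta /\
  forall w, Cmod (w - z) < delta -> sector (PI / alpha) w.
Hypothesis F_cont : forall z, sector (PI / alpha) z -> continuous_C F z.
Hypothesis F_deriv : forall z, sector (PI / alpha) z -> exists d, complex_deriv F z d.
Hypothesis F_boundary : forall z, ~ sector (PI / alpha) z ->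
  (forall delta, 0 < delta -> exists w, sector (PI / alpha) w /\ Cmod (w - z) < delta) ->
  forall eta, 0 < eta -> exists delta, 0 < delta /\
    forall w, sector (PI / alpha) w -> Cmod (w - z) < delta -> Cmod (F w) <= M + eta.
Hypothesis F_growth : forall z, sector (PI / alpha) z -> Cmod z > R0 ->
  Cmod (F z) <= exp (exp (b * ln (Cmod z))).

(** [b] carries no sign hypothesis; the maximum with 0 makes [beta] positive as well as strictly
    between [b] and [alpha]. *)
Let beta := (Rmax b 0 + alpha) / 2.

Lemma beta_bounds : b < beta < alpha /\ 0 < beta.
Proof.
  unfold beta. pose proof (Rmax_l b 0). pose proof (Rmax_r b 0).
  assert (Rmax b 0 < alpha) by (apply Rmax_lub_lt; lra). lra.
Qed.

(** The minimum of [cos (beta * th)] over the closed sector, positive because [beta < alpha]; it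
    gives the lower bound [c |z|^beta] for the real part of the power. *)
Let c := cos (beta * (PI / alpha / 2)).

Lemma angle_bounds : 0 < PI / alpha / 2 < PI /\ 0 < beta * (PI / alpha / 2) < PI / 2.
Proof.
  pose proof beta_bounds as (Hb1 & Hb2). pose proof PI_RGT_0 as HPI.
  assert (Hp : 0 < PI / alpha) by (apply Rdiv_lt_0_compat; lra).
  assert (Hid : PI / alpha * alpha = PI) by (field; lra).
  split; [split; [lra|nra]|]. split; [apply Rmult_lt_0_compat; lra|]. nra.
Qed.

Lemma cos_half_angle_pos : 0 < c.
Proof. pose proof angle_bounds. apply cos_gt_0; lra. Qed.

Lemma cos_ge_cos_half_angle th : Rabs th < PI / alpha / 2 -> c <= cos (beta * th).
Proof.
  intros Hth. pose proof angle_bounds as (A1 & A2). pose proof beta_bounds as (_ & B2). pose proof PI_RGT_0.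
  assert (Habs : cos (beta * th) = cos (beta * Rabs th)).
  { unfold Rabs. destruct (Rcase_abs th); [|reflexivity].
    replace (beta * - th) with (- (beta * th)) by ring. now rewrite cos_neg. }
  rewrite Habs. pose proof (Rabs_pos th). unfold c.
  assert (0 <= beta * Rabs th) by (apply Rmult_le_pos; lra).
  assert (beta * Rabs th <= beta * (PI / alpha / 2)) by (apply Rmult_le_compat_l; lra).
  apply cos_decr_1; lra.
Qed.

Let power (z : C) : C := Cexp (RtoC beta * Clog z)%C.

Lemma power_re r th : 0 < r -> Rabs th < PI / alpha / 2 ->
  fst (power (of_polar r th)) = exp (beta * ln r) * cos (beta * th).
Proof.
  intros Hr Hth. pose proof angle_bounds as (A1 & _).
  unfold power. rewrite Clog_of_polar; [|exact Hr|apply Rabs_lt_between in Hth; lra].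
  unfold Cexp. simpl. f_equal; f_equal; ring.
Qed.

Lemma power_re_ge z : sector (PI / alpha) z -> exp (beta * ln (Cmod z)) * c <= fst (power z).
Proof.
  intros (r & th & Hr & Hth & ->). rewrite Cmod_of_polar, power_re by assumption.
  apply Rmult_le_compat_l; [apply Rlt_le, exp_pos|now apply cos_ge_cos_half_angle].
Qed.

Lemma deriv_bounded_power z : sector (PI / alpha) z -> deriv_bounded power z.
Proof.
  intros (r & th & Hr & Hth & ->). pose proof angle_bounds as (A1 & _).
  apply (deriv_bounded_exp (fun w => RtoC beta * Clog w)%C).
  apply deriv_bounded_mult; [apply deriv_bounded_const|]. apply deriv_bounded_log, slit_plane_of_polar; auto.
  apply Rabs_lt_between in Hth. lra.
Qed.

Lemma large_radius eps eta Rmin0 : 0 < eps -> 0 < eta ->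
  exists rho, Rmin0 < rho /\ 1 < rho /\ exp (exp (b * ln rho)) * exp (- eps * (exp (beta * ln rho) * c)) <= eta.
Proof.
  intros Heps Heta. pose proof cos_half_angle_pos as Hc. pose proof beta_bounds as ((Hb1 & Hb2) & Hb3).
  set (k := eps * c / 2). assert (Hk : 0 < k) by (unfold k; assert (0 < eps * c) by (now apply Rmult_lt_0_compat); lra).
  (* In the scale [rho = exp T], the four entries ensure [rho > Rmin0], [rho > 1],
     [exp (b T) <= k exp (beta T)] and [- ln eta <= k exp (beta T)]. As [k] is half of [eps * c],
     one half absorbs the growth and the other reaches [eta]. *)
  set (T := Rmax (Rmax (ln (Rmax Rmin0 1) + 1) 1) (Rmax (- ln k / (beta - b)) ((Rmax (- ln eta) 0 / k) / beta))).
  assert (T1 : ln (Rmax Rmin0 1) + 1 <= T) by (apply Rle_trans with (2 := Rmax_l _ _), Rmax_l).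
  assert (T2 : 1 <= T) by (apply Rle_trans with (2 := Rmax_l _ _), Rmax_r).
  assert (T3 : - ln k / (beta - b) <= T) by (apply Rle_trans with (2 := Rmax_r _ _), Rmax_l).
  assert (T4 : (Rmax (- ln eta) 0 / k) / beta <= T) by (apply Rle_trans with (2 := Rmax_r _ _), Rmax_r).
  exists (exp T). rewrite ln_exp. split; [|split].
  - apply Rle_lt_trans with (Rmax Rmin0 1); [apply Rmax_l|].
    pose proof (Rmax_r Rmin0 1). rewrite <- (exp_ln (Rmax Rmin0 1)) by lra. apply exp_increasing. lra.
  - rewrite <- exp_0. apply exp_increasing. lra.
  - rewrite <- exp_plus. rewrite <- (exp_ln eta) by exact Heta.
    assert (Hle : exp (b * T) + - eps * (exp (beta * T) * c) <= ln eta).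
    { assert (S1 : exp (b * T) <= k * exp (beta * T)).
      { rewrite <- (exp_ln k) by exact Hk. rewrite <- exp_plus.
        assert (b * T <= ln k + beta * T).
        { apply Rmult_le_compat_r with (r := beta - b) in T3; [|lra].
          replace (- ln k / (beta - b) * (beta - b)) with (- ln k) in T3 by (field; lra). lra. }
        destruct H as [H|H]; [now apply Rlt_le, exp_increasing|rewrite H; lra]. }
      assert (S2 : - ln eta <= k * exp (beta * T)).
      { apply Rle_trans with (Rmax (- ln eta) 0); [apply Rmax_l|].
        assert (S3 : Rmax (- ln eta) 0 / k <= beta * T).
        { apply Rmult_le_compat_r with (r := beta) in T4; [|lra].
          replace (Rmax (- ln eta) 0 / k / beta * beta) with (Rmax (- ln eta) 0 / k) in T4 by (field; lra). lra. }
        assert (S4 : beta * T <= exp (beta * T)) by (pose proof (exp_ineq1_le (beta * T)); lra).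
        replace (Rmax (- ln eta) 0) with (k * (Rmax (- ln eta) 0 / k)) by (field; lra).
        apply Rmult_le_compat_l; lra. }
      replace (- eps * (exp (beta * T) * c)) with (- 2 * (k * exp (beta * T))) by (unfold k; field). lra. }
    destruct Hle as [H|H]; [now apply Rlt_le, exp_increasing|rewrite H; lra].
Qed.

Theorem phragmen_lindelof_sector : forall z, sector (PI / alpha) z -> Cmod (F z) <= M.
Proof.
  intros z0 Hz0.
  assert (F_good := looman_menchoff F (sector (PI / alpha)) sector_open F_cont F_deriv).
  pose proof cos_half_angle_pos as Hc.
  apply (le_of_exp_decay _ _ (fst (power z0))); [apply Cmod_ge_0|]. intros eps Heps.
  set (G := fun z => (F z * Cexp (RtoC (- eps) * power z))%C).
  assert (HG : forall z, Cmod (G z) = Cmod (F z) * exp (- eps * fst (power z))).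
  { intros z. unfold G. rewrite Cmod_mult, Cmod_Cexp. f_equal. f_equal. simpl. ring. }
  assert (HG_good : forall z, sector (PI / alpha) z -> deriv_bounded G z).
  { intros z Hz. apply deriv_bounded_mult; [now apply F_good|].
    apply (deriv_bounded_exp (fun w => RtoC (- eps) * power w)%C).
    apply deriv_bounded_mult; [apply deriv_bounded_const|now apply deriv_bounded_power]. }
  assert (HG_le : forall z, sector (PI / alpha) z -> Cmod (G z) <= Cmod (F z)).
  { intros z Hz. rewrite HG. rewrite <- (Rmult_1_r (Cmod (F z))) at 2.
    apply Rmult_le_compat_l; [apply Cmod_ge_0|]. rewrite <- exp_0.
    assert (Hp : 0 < fst (power z)).
    { apply Rlt_le_trans with (2 := power_re_ge z Hz). apply Rmult_lt_0_compat; [apply exp_pos|exact Hc]. }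
    apply Rlt_le, exp_increasing. assert (0 < eps * fst (power z)) by now apply Rmult_lt_0_compat. lra. }
  rewrite <- HG. apply le_epsilon. intros eta Heta.
  destruct (large_radius eps eta (Rmax R0 (Cmod z0)) Heps Heta) as (rho & Hrho & Hrho1 & Hdecay).
  assert (Hr0 : R0 < rho) by (apply Rle_lt_trans with (2 := Hrho), Rmax_l).
  assert (Hrz : Cmod z0 < rho) by (apply Rle_lt_trans with (2 := Hrho), Rmax_r).
  (* On the truncated sector, the arc contributes at most [eta] by the choice of [rho]. The sides
     and the vertex contribute at most [M], since the exponential factor has modulus at most 1. *)
  apply (max_principle (fun z => sector (PI / alpha) z /\ Cmod z < rho) G rho); [lra| | | | |now split].
  - intros z [Hz Hzr]. destruct (sector_open z Hz) as [d [Hd H]].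
    exists (Rmin d (rho - Cmod z)). split; [apply Rmin_pos; lra|]. intros w Hw. split.
    + apply H, (Rlt_le_trans _ _ _ Hw), Rmin_l.
    + assert (Cmod (w - z) < rho - Cmod z) by (apply (Rlt_le_trans _ _ _ Hw), Rmin_r).
      pose proof (Cmod_le_minus w z). lra.
  - intros z [_ Hz]. lra.
  - intros z [Hz _]. now apply HG_good.
  - intros z Hz Hcl e He.
    destruct (classic (sector (PI / alpha) z)) as [Hsz|Hsz].
    + assert (Hge : rho <= Cmod z) by (apply Rnot_lt_le; tauto).
      assert (Hle : Cmod z <= rho).
      { apply le_epsilon. intros e' He'. destruct (Hcl e' He') as [w [[_ Hw] Hwz]].
        pose proof (Cmod_le_minus z w) as T. rewrite Cmod_minus_sym in T. lra. }
      assert (Heq : Cmod z = rho) by lra.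
      assert (HGz : Cmod (G z) <= eta).
      { apply Rle_trans with (2 := Hdecay). rewrite HG. rewrite <- Heq.
        apply Rmult_le_compat; [apply Cmod_ge_0|apply Rlt_le, exp_pos| |].
        - apply F_growth; [exact Hsz|lra].
        - assert (Hx : - eps * fst (power z) <= - eps * (exp (beta * ln (Cmod z)) * c)).
          { pose proof (power_re_ge z Hsz). nra. }
          destruct Hx as [H|H]; [now apply Rlt_le, exp_increasing|rewrite H; lra]. }
      destruct (deriv_bounded_continuous G z (HG_good z Hsz) e He) as [d [Hd H]].
      exists d. split; [exact Hd|]. intros w _ Hw. specialize (H w Hw).
      pose proof (Cmod_le_minus (G w) (G z)). lra.
    + destruct (F_boundary z Hsz) with (eta := e) as [d [Hd H]]; [|exact He|].
      { intros d Hd. destruct (Hcl d Hd) as [w [[Hw _] Hwz]]. now exists w. }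
      exists d. split; [exact Hd|]. intros w [Hw _] Hwz. apply Rle_trans with (1 := HG_le w Hw).
      specialize (H w Hw Hwz). lra.
Qed.
End PhragmenLindelof.

(** * Reduction to a slice *)

Definition qdot (p q : quat) : R := qre p * qre q + qi p * qi q + qj p * qj q + qk p * qk q.

(* The component of [p] along the orthonormal frame [v, I v]; it is complex linear in [p] when [C]
   acts through left multiplication by [R + R I]. *)
Definition qcoord (I v p : quat) : C := (qdot p v, qdot p (qmul I v)).

Lemma qnorm_ge_0 q : 0 <= qnorm q.
Proof. apply sqrt_pos. Qed.

Lemma qnorm_sq q : qnorm q * qnorm q = qdot q q.
Proof. unfold qnorm, qdot. rewrite sqrt_sqrt; [ring|]. nra. Qed.

Lemma qdot_diag_ge_0 q : 0 <= qdot q q.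
Proof. unfold qdot. nra. Qed.

(** For imaginary [I] of norm 1, [I v] is a unit vector orthogonal to [v]; Bessel's inequality
    follows from the residual [u] having nonnegative square norm. *)
Lemma qcoord_bessel I v p : in_S I -> qdot v v = 1 -> Cmod (qcoord I v p) <= qnorm p.
Proof.
  intros [HI0 HI] Hv.
  apply Rsqr_incr_0_var; [|apply qnorm_ge_0]. unfold Rsqr. rewrite Cmod_sq, qnorm_sq. simpl.
  set (w := qmul I v). set (a := qdot p v). set (b := qdot p w).
  assert (Hw : qdot w w = 1).
  { transitivity ((qi I ^ 2 + qj I ^ 2 + qk I ^ 2) * qdot v v); [|rewrite HI, Hv; ring].
    unfold w, qdot, qmul. simpl. rewrite HI0. ring. }
  assert (Hvw : qdot v w = 0).
  { unfold w, qdot, qmul. simpl. rewrite HI0. ring. }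
  set (u := mkQ (qre p - a * qre v - b * qre w) (qi p - a * qi v - b * qi w)
                (qj p - a * qj v - b * qj w) (qk p - a * qk v - b * qk w)).
  assert (Hu : qdot u u = qdot p p - 2 * a * a - 2 * b * b + a * a * qdot v v + b * b * qdot w w + 2 * a * b * qdot v w).
  { replace (2 * a * a) with (2 * a * qdot p v) by reflexivity.
    replace (2 * b * b) with (2 * b * qdot p w) by reflexivity.
    clearbody a b w. unfold u, qdot. simpl. ring. }
  pose proof (qdot_diag_ge_0 u). rewrite Hu, Hv, Hw, Hvw in H. lra.
Qed.

Lemma qcoord_sub I v p q : qcoord I v (qsub p q) = (qcoord I v p - qcoord I v q)%C.
Proof. unfold qcoord, qdot, qsub, Cminus, Cplus, Copp. simpl. f_equal; ring. Qed.

Lemma qderiv_qdot g t d v : qderiv_lim g t d -> is_derive (fun s => qdot (g s) v) t (qdot d v).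
Proof.
  intros (H1 & H2 & H3 & H4). apply is_derive_Reals in H1, H2, H3, H4.
  assert (Hs : forall (u : R -> R) l k, is_derive u t l -> is_derive (fun s => u s * k) t (l * k)).
  { intros u l k Hu. eapply is_derive_val.
    - apply (is_derive_mult_R u (fun _ => k) t l 0 Hu). apply (is_derive_const (V := R_NormedModule)).
    - ring. }
  unfold qdot.
  repeat apply (is_derive_plus (V := R_NormedModule)); now apply Hs.
Qed.

Lemma qcoord_deriv I v g t d : qderiv_lim g t d -> curve_deriv (fun s => qcoord I v (g s)) t (qcoord I v d).
Proof. intros H. split; simpl; now apply qderiv_qdot. Qed.

(** Left multiplication by [I] is a skew-adjoint isometry, so the relation [dx = - I dy] becomes
    multiplication by [Ci] on coordinates. *)
Lemma qcoord_cauchy_riemann I v dx dy : in_S I ->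
  qmul (mkQ (1/2) 0 0 0) (qadd dx (qmul I dy)) = qzero ->
  qcoord I v dy = (Ci * qcoord I v dx)%C.
Proof.
  intros [HI0 HI] Heq.
  assert (Hdx : dx = qsub qzero (qmul I dy)).
  { destruct dx as [a b c d]. unfold qmul, qadd, qsub, qzero in *. simpl in *. injection Heq. intros.
    f_equal; lra. }
  rewrite Hdx. unfold qcoord, Ci, Cmult. simpl.
  assert (E1 : qdot (qsub qzero (qmul I dy)) (qmul I v) = - qdot dy v).
  { transitivity (- ((qi I ^ 2 + qj I ^ 2 + qk I ^ 2) * qdot dy v)); [|rewrite HI; ring].
    unfold qdot, qmul, qsub, qzero. simpl. rewrite HI0. ring. }
  rewrite E1. f_equal; [ring|].
  unfold qdot, qmul, qsub, qzero. simpl. rewrite HI0. ring.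
Qed.

Lemma slice_isometry I z w : in_S I ->
  qnorm (qsub (slice I (fst z) (snd z)) (slice I (fst w) (snd w))) = Cmod (z - w).
Proof.
  intros [HI0 HI]. unfold qnorm, Cmod. f_equal. unfold qsub, slice. simpl. rewrite HI0.
  transitivity ((fst z - fst w) ^ 2 + (snd z - snd w) ^ 2 * (qi I ^ 2 + qj I ^ 2 + qk I ^ 2)); [ring|].
  rewrite HI. ring.
Qed.

Lemma qnorm_slice I z : in_S I -> qnorm (slice I (fst z) (snd z)) = Cmod z.
Proof.
  intros [HI0 HI]. unfold qnorm, Cmod. f_equal. unfold slice. simpl. rewrite HI0.
  transitivity ((fst z) ^ 2 + (snd z) ^ 2 * (qi I ^ 2 + qj I ^ 2 + qk I ^ 2)); [ring|].
  rewrite HI. ring.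
Qed.

(* The converse inclusion uses that the cone is invariant under conjugation: the same quaternion is
   written with [(J, th)] or with [(- J, - th)]. *)
Lemma cone_slice phi I z : in_S I -> (cone phi (slice I (fst z) (snd z)) <-> sector phi z).
Proof.
  intros HI. split.
  - intros (r & J & th & Hr & Hth & HJ & Heq).
    destruct HI as [HI0 HI]. destruct HJ as [HJ0 HJ].
    unfold polar, slice in Heq. injection Heq. intros E4 E3 E2 E1.
    rewrite HI0, HJ0 in E1.
    assert (Hsq : snd z * snd z = (r * sin th) * (r * sin th)).
    { transitivity (snd z * snd z * (qi I ^ 2 + qj I ^ 2 + qk I ^ 2)); [rewrite HI; ring|].
      transitivity ((r * sin th) * (r * sin th) * (qi J ^ 2 + qj J ^ 2 + qk J ^ 2)); [|rewrite HJ; ring].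
      transitivity ((snd z * qi I) ^ 2 + (snd z * qj I) ^ 2 + (snd z * qk I) ^ 2); [ring|].
      rewrite E2, E3, E4. ring. }
    assert (Hpm : snd z = r * sin th \/ snd z = - (r * sin th)).
    { assert (H0 : (snd z - r * sin th) * (snd z + r * sin th) = 0) by lra.
      apply Rmult_integral in H0. lra. }
    destruct z as [x y]. simpl in *. unfold sector, of_polar.
    destruct Hpm as [Hp|Hp].
    + exists r, th. split; [exact Hr|]. split; [exact Hth|]. f_equal; lra.
    + exists r, (- th). rewrite Rabs_Ropp, cos_neg, sin_neg. split; [exact Hr|]. split; [exact Hth|].
      f_equal; lra.
  - intros (r & th & Hr & Hth & ->). exists r, I, th. auto.
Qed.

Lemma closure_slice phi I z : in_S I ->
  (forall delta, 0 < delta -> exists w, sector phi w /\ Cmod (w - z) < delta) ->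
  closure (cone phi) (slice I (fst z) (snd z)).
Proof.
  intros HI H eps Heps. destruct (H eps Heps) as [w [Hw Hwz]].
  exists (slice I (fst w) (snd w)). split; [now apply cone_slice|]. now rewrite slice_isometry.
Qed.

(** Holds for every real [x], the right side being positive. Used twice, it undoes the iterated
    [lnp] of the order without comparing the maximum modulus with 1. *)
Lemma le_exp_lnp x : x <= exp (lnp x).
Proof.
  unfold lnp. destruct (Rle_dec x 0) as [Hx|Hx].
  - pose proof (exp_pos (Rmax (ln x) 0)). lra.
  - rewrite <- (exp_ln x) at 1 by lra.
    destruct (Rmax_l (ln x) 0) as [H|H]; [now apply Rlt_le, exp_increasing|rewrite <- H; lra].
Qed.

Theorem theorem3p2 (alpha : R) (f : quat -> quat) (M : R) :
  alpha > 1/2 ->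
  slice_regular f (cone (PI / alpha)) ->
  continuous_on_closure f (cone (PI / alpha)) ->
  order_lt f (cone (PI / alpha)) alpha ->
  M >= 0 ->
  (forall q, boundary (cone (PI / alpha)) q -> qnorm (f q) <= M) ->
  forall q, cone (PI / alpha) q -> qnorm (f q) <= M.
Proof.
  intros Halpha [Hopen Hreg] Hcont (Mf & HMf & b & Hb & R0 & HR0) HM Hbd q Hq.
  destruct (Req_dec (qnorm (f q)) 0) as [Hz|Hz]; [lra|].
  assert (Hpos : 0 < qnorm (f q)) by (pose proof (qnorm_ge_0 (f q)); lra).
  destruct Hq as (r & I & th & Hr & Hth & HI & ->).
  set (z0 := of_polar r th).
  change (polar r I th) with (slice I (fst z0) (snd z0)) in *.
  set (q0 := slice I (fst z0) (snd z0)) in *.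
  set (n := qnorm (f q0)) in *.
  set (v := mkQ (qre (f q0) / n) (qi (f q0) / n) (qj (f q0) / n) (qk (f q0) / n)).
  assert (Hn2 := qnorm_sq (f q0)). fold n in Hn2.
  assert (Hfv : qdot (f q0) v = n).
  { transitivity (qdot (f q0) (f q0) / n); [unfold qdot, v; simpl; field; lra|].
    rewrite <- Hn2. field. lra. }
  assert (Hv : qdot v v = 1).
  { transitivity (qdot (f q0) (f q0) / (n * n)); [unfold qdot, v; simpl; field; lra|].
    rewrite <- Hn2. field. lra. }
  set (F := fun z : C => qcoord I v (f (slice I (fst z) (snd z)))).
  assert (HF : forall z, Cmod (F z) <= qnorm (f (slice I (fst z) (snd z)))).
  { intros z. now apply qcoord_bessel. }
  assert (Hcl : forall z, sector (PI / alpha) z -> closure (cone (PI / alpha)) (slice I (fst z) (snd z))).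
  { intros z Hs. apply closure_slice; [exact HI|]. intros d Hd. exists z. split; [exact Hs|].
    now rewrite Cmod_minus_diag. }
  assert (Hnear : forall z, closure (cone (PI / alpha)) (slice I (fst z) (snd z)) ->
    forall eps, 0 < eps -> exists d, 0 < d /\ forall w, sector (PI / alpha) w -> Cmod (w - z) < d ->
      Cmod (F w - F z) < eps).
  { intros z Hz' eps Heps. destruct (Hcont _ Hz' eps Heps) as [d [Hd H]]. exists d. split; [exact Hd|].
    intros w Hw Hwz. unfold F. rewrite <- qcoord_sub.
    apply Rle_lt_trans with (1 := qcoord_bessel I v _ HI Hv). apply H; [now apply Hcl|].
    now rewrite slice_isometry. }
  (* Openness of the plane sector is inherited from that of the cone, which slice regularity
     includes, through the isometric slice embedding. *)
  assert (Hso : forall z, sector (PI / alpha) z -> exists delta, 0 < delta /\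
    forall w, Cmod (w - z) < delta -> sector (PI / alpha) w).
  { intros z Hs. apply (cone_slice _ I z HI) in Hs. destruct (Hopen _ Hs) as [d [Hd H]].
    exists d. split; [exact Hd|]. intros w Hw. apply (cone_slice _ I w HI), H. now rewrite slice_isometry. }
  apply Rle_trans with (Cmod (F z0)).
  { rewrite <- Hfv. apply Rle_trans with (1 := Rle_abs _). apply (Rabs_fst_le (F z0)). }
  (* Beyond radius 1 the logarithm is positive, so the quotient defining the order can be multiplied
     out. *)
  apply (phragmen_lindelof_sector alpha b M (Rmax R0 1) F); auto; try lra.
  - intros z Hs eps Heps. destruct (Hnear z (Hcl z Hs) eps Heps) as [d [Hd H]].
    destruct (Hso z Hs) as [d' [Hd' H']]. exists (Rmin d d'). split; [now apply Rmin_pos|].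
    intros w Hw. apply H; [apply H', (Rlt_le_trans _ _ _ Hw), Rmin_r|apply (Rlt_le_trans _ _ _ Hw), Rmin_l].
  - intros z Hs. destruct (Hreg I HI (fst z) (snd z)) as (dx & dy & Hdx & Hdy & Heq).
    { now apply cone_slice. }
    exists (qcoord I v dx). split.
    + apply (qcoord_deriv I v (fun s => f (slice I s (snd z)))), Hdx.
    + rewrite <- (qcoord_cauchy_riemann I v dx dy HI Heq).
      apply (qcoord_deriv I v (fun s => f (slice I (fst z) s))), Hdy.
  - intros z Hs Hclz eta Heta.
    assert (Hc := closure_slice _ I z HI Hclz).
    assert (HFM : Cmod (F z) <= M).
    (* A boundary point of the sector lands on the boundary of the cone: it is a limit of cone
       points and, not being in the cone, itself witnesses closeness to the complement. *)
    { apply Rle_trans with (1 := HF z). apply Hbd. split; [exact Hc|].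
      intros eps Heps. exists (slice I (fst z) (snd z)). split.
      - intros Hcone. apply Hs. now apply (cone_slice _ I z HI).
      - rewrite slice_isometry, Cmod_minus_diag; assumption. }
    destruct (Hnear z Hc eta Heta) as [d [Hd H]]. exists d. split; [exact Hd|]. intros w Hw Hwz.
    specialize (H w Hw Hwz). pose proof (Cmod_le_minus (F w) (F z)). lra.
  - intros z Hs Hzr. apply Rle_trans with (1 := HF z).
    assert (Hz1 : R0 < Cmod z /\ 1 < Cmod z).
    { pose proof (Rmax_l R0 1). pose proof (Rmax_r R0 1). lra. }
    destruct Hz1 as [Hz1 Hz2]. destruct (HMf (Cmod z)) as [_ HMz]; [lra|].
    apply Rle_trans with (Mf (Cmod z)).
    { apply HMz; [now apply Hcl|now apply qnorm_slice]. }
    assert (Hln : 0 < ln (Cmod z)) by (rewrite <- ln_1; apply ln_increasing; lra).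
    specialize (HR0 (Cmod z) Hz1). simpl in HR0.
    assert (Hl : lnp (lnp (Mf (Cmod z))) <= b * ln (Cmod z)).
    { apply Rmult_le_compat_r with (r := ln (Cmod z)) in HR0; [|lra].
      unfold Rdiv in HR0. rewrite Rmult_assoc, Rinv_l in HR0 by lra. lra. }
    assert (Hmono : forall s t, s <= t -> exp s <= exp t).
    { intros s t [H|H]; [now apply Rlt_le, exp_increasing|rewrite H; lra]. }
    apply Rle_trans with (1 := le_exp_lnp _). apply Hmono.
    apply Rle_trans with (1 := le_exp_lnp _). now apply Hmono.
  - exists r, th. auto.
Qed.
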